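(* Let $\mathsf{QHE}$ be a symmetric-key quantum homomorphic encryption scheme. Then $\mathsf{QHE}$ is q-IND-CPA secure if and only if $\mathsf{QHE}$ is q-IND-CPA-mult secure (both notions taken in the symmetric-key setting, with adversaries having access to an encryption oracle).
   Context: Conventions. $D(\mathcal X)$ is the set of density operators on a complex Euclidean space (quantum register) $\mathcal X$; a quantum channel acting on one register is implicitly extended by the identity on all other registers. A function $\eta$ is negligible if for every polynomial $p$ there is $N$ with $\eta(n)<1/p(n)$ for all integers $n>N$. A quantum algorithm is a polynomial-time uniform family of quantum circuits, implementing a family of quantum channels. $\kappa$ is the security parameter. Symmetric-key QHE scheme. A 4-tuple of quantum algorithms: $\mathsf{KeyGen}:1^\kappa\to(sk,\rho_{evk})$ with classical secret encryption/decryption key $sk$ and quantum evaluation key $\rho_{evk}\in D(\mathcal R_{evk})$; $\mathsf{Enc}_{sk}:D(\mathcal M)\to D(\mathcal C)$; $\mathsf{Eval}^{\mathsf C}:D(\mathcal R_{evk}\otimes\mathcal C^{\otimes n})\to D(\mathcal C'^{\otimes m})$ for every quantum circuit $\mathsf C$ from $n$ to $m$ message registers; $\mathsf{Dec}_{sk}:D(\mathcal C')\to D(\mathcal M)$. Adversaries with an encryption oracle. Such an adversary making $q$ calls is a tuple of channels $(\mathscr A^{(1)},\dots,\mathscr A^{(q+1)})$, where $\mathscr A^{(1)}:D(\mathcal X)\to D(\mathcal M\otimes\mathcal E)$, $\mathscr A^{(i)}:D(\mathcal C\otimes\mathcal E)\to D(\mathcal M\otimes\mathcal E)$ for $2\le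 i\le q$, and $\mathscr A^{(q+1)}:D(\mathcal C\otimes\mathcal E)\to D(\mathcal Y)$; between consecutive channels $\mathsf{Enc}_{sk}$ is applied to the register $\mathcal M$ (output in $\mathcal C$). q-IND-CPA (symmetric key). In $\mathsf{SymK}^{\mathsf{cpa}}_{\mathscr A,\mathsf{QHE}}(\kappa)$ with $\mathscr A=(\mathscr A_1,\mathscr A_2)$ a pair of adversaries with access to an encryption oracle: (1) $(sk,\rho_{evk})\leftarrow\mathsf{KeyGen}(1^\kappa)$; (2) $\mathscr A_1$ gets $\rho_{evk}$, may make polynomially many calls to $\mathsf{Enc}_{sk}$, and outputs a state on $\mathcal M\otimes\mathcal E$; (3) a uniformly random bit $r$ is chosen and $\Xi^{\mathsf{cpa},r}$ is applied to $\mathcal M$, where $\Xi^{\mathsf{cpa},0}(\rho)=\mathsf{Enc}_{sk}(|\mathbf 0\rangle\langle\mathbf 0|)$, $\Xi^{\mathsf{cpa},1}(\rho)=\mathsf{Enc}_{sk}(\rho)$; (4) $\mathscr A_2$ gets the system $\mathcal C\otimes\mathcal E$, may make polynomially many calls to $\mathsf{Enc}_{sk}$, and outputs a bit $r'$; (5) the output is $1$ if $r'=r$, else $0$. The scheme is q-IND-CPA secure if for every quantum polynomial-time $\mathscr A$ with oracle access there is a negligible $\eta$ with $\Pr[\mathsf{SymK}^{\mathsf{cpa}}_{\mathscr A,\mathsf{QHE}}(\kappa)=1]\le\frac12+\eta(\kappa)$. q-IND-CPA-mult (symmetric key). The same, except that $\mathscr A_1$ outputs a state on $\mathcal M_0\otimes\mathcal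 M_1\otimes\mathcal E$ with $\mathcal M_r=\mathcal M_r^1\otimes\cdots\otimes\mathcal M_r^t$, each $\mathcal M_r^i$ a copy of $\mathcal M$, for some $t\ge1$, $t\in O(\mathrm{poly}(\kappa))$ chosen by the adversary; and the challenger, for uniformly random $r$, applies $\mathsf{Enc}_{sk}^{\otimes t}$ to $\mathcal M_r$ and traces out $\mathcal M_{1-r}$, passing $\mathcal C^{\otimes t}\otimes\mathcal E$ to $\mathscr A_2$. Security requires winning probability at most $\frac12+\eta(\kappa)$ for some negligible $\eta$, for every quantum polynomial-time $\mathscr A$ with oracle access. *)

(* Defs.v *)
From mathcomp Require Import all_boot all_order all_algebra.
From mathcomp Require Import complex.
From mathcomp Require Import reals.

Set Implicit Arguments.
Unset Strict Implicit.
Unset Printing Implicit Defensive.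

Import Order.TTheory GRing.Theory Num.Theory.

(* Polynomial time.  The machine model is a WHILE language with a single      *)
(* tree-valued variable.  Each step is charged the size of the tree that it   *)
(* copies, so that intermediate and final values are no larger than the cost  *)
(* plus the size of the input, and the model is polynomially equivalent to    *)
(* Turing machines.                                                           *)

Inductive tree := Leaf | Node of tree & tree.

Fixpoint tsize (x : tree) : nat :=
  if x is Node y z then (tsize y + tsize z).+1 else 1.

Inductive prog :=
  | PId | PLeaf | PFst | PSnd
  | PPair of prog & prog
  | PComp of prog & prog
  | PIf of prog & prog & prog
  | PWhile of prog & prog.

(* [exec P x y c]: on input [x], the program [P] halts with output [y] after  *)
(* [c] units of time.                                                         *)
Inductive exec : prog -> tree -> tree -> nat -> Prop :=
  | ExId x : exec PId x x (tsize x).+1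
  | ExLeaf x : exec PLeaf x Leaf 1
  | ExFst0 : exec PFst Leaf Leaf 1
  | ExFst x y : exec PFst (Node x y) x (tsize x).+1
  | ExSnd0 : exec PSnd Leaf Leaf 1
  | ExSnd x y : exec PSnd (Node x y) y (tsize y).+1
  | ExPair P Q x y z c d :
      exec P x y c -> exec Q x z d -> exec (PPair P Q) x (Node y z) (c + d).+1
  | ExComp P Q x y z c d :
      exec Q x y c -> exec P y z d -> exec (PComp P Q) x z (c + d).+1
  | ExIfT B P Q x u v y c d :
      exec B x (Node u v) c -> exec P x y d -> exec (PIf B P Q) x y (c + d).+1
  | ExIfF B P Q x y c d :
      exec B x Leaf c -> exec Q x y d -> exec (PIf B P Q) x y (c + d).+1
  | ExWhileT B P x u v y z c d e :
      exec B x (Node u v) c -> exec P x y d -> exec (PWhile B P) y z e ->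
      exec (PWhile B P) x z (c + d + e).+1
  | ExWhileF B P x c :
      exec B x Leaf c -> exec (PWhile B P) x x (c + tsize x).+1.

Definition polytime_on (A B : Type) (encA : A -> tree) (encB : B -> tree)
    (D : A -> Prop) (f : A -> B) : Prop :=
  exists (P : prog) (p : {poly nat}), forall a, D a ->
    exists2 c, exec P (encA a) (encB (f a)) c & c <= p.[tsize (encA a)]%R.

Fixpoint tree_nat (n : nat) : tree :=
  if n is n'.+1 then Node Leaf (tree_nat n') else Leaf.

Definition tree_seq (A : Type) (e : A -> tree) (s : seq A) : tree :=
  foldr (fun a t => Node (e a) t) Leaf s.

Definition tree_pair (A B : Type) (eA : A -> tree) (eB : B -> tree)
  (u : A * B) : tree := Node (eA u.1) (eB u.2).

(* The input [1^kappa] is the unary encoding [tree_nat kappa].                *)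
Definition uniform (B : Type) (encB : B -> tree) (f : nat -> B) : Prop :=
  polytime_on tree_nat encB (fun=> True) f.

(* Quantum circuits over the gate set {Toffoli, Hadamard, phase shift by i,   *)
(* ancilla, erasure}; [Swap] is a wire crossing.  Wires are numbered from 0;  *)
(* [Anc i] inserts a new wire in state |0> in position [i], and [Erase i]     *)
(* traces out wire [i]; the wires beyond are renumbered.                      *)

Inductive gate :=
  | Toffoli of nat & nat & nat
  | Hadamard of nat
  | Phase of nat
  | Swap of nat & nat
  | Anc of nat
  | Erase of nat.

(* The inputs (outputs) of a circuit are a sequence of registers, given by    *)
(* their numbers of qubits and laid out on consecutive wires.                 *)
Record circuit := Circuit {
  c_in : seq nat;
  c_gates : seq gate;
  c_out : seq nat }.

Definition tree_gate (g : gate) : tree :=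
  let t n s := Node (tree_nat n) (tree_seq tree_nat s) in
  match g with
  | Toffoli i j k => t 0 [:: i; j; k]
  | Hadamard i => t 1 [:: i]
  | Phase i => t 2 [:: i]
  | Swap i j => t 3 [:: i; j]
  | Anc i => t 4 [:: i]
  | Erase i => t 5 [:: i]
  end.

(* All numbers are written in unary, so a circuit that is output in           *)
(* polynomial time has polynomially many wires, including its idle ones.      *)
Definition tree_circuit (C : circuit) : tree :=
  Node (tree_seq tree_nat (c_in C))
    (Node (tree_seq tree_gate (c_gates C)) (tree_seq tree_nat (c_out C))).

(* The number of wires after [g] is applied to [n] wires, [None] when [g]     *)
(* does not fit.                                                              *)
Definition gate_arity (n : nat) (g : gate) : option nat :=
  match g with
  | Toffoli i j k =>
      if [&& uniq [:: i; j; k], i < n, j < n & k < n] then Some n else None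
  | Hadamard i | Phase i => if i < n then Some n else None
  | Swap i j => if (i < n) && (j < n) then Some n else None
  | Anc i => if i <= n then Some n.+1 else None
  | Erase i => if i < n then Some n.-1 else None
  end.

Definition gates_arity (n : nat) (s : seq gate) : option nat :=
  foldl (fun o g => obind (gate_arity^~ g) o) (Some n) s.

Definition circuit_from_to (X Y : seq nat) (C : circuit) : Prop :=
  [/\ c_in C = X, c_out C = Y & gates_arity (sumn X) (c_gates C) = Some (sumn Y)].

Record qhe := QHE {
  sk_len : nat -> nat;
  evk_len : nat -> nat;
  msg_len : nat -> nat;
  ct_len : nat -> nat;
  ect_len : nat -> nat;
  keygen : nat -> circuit;
  enc : nat -> circuit;
  eval : nat -> circuit -> circuit;
  dec : nat -> circuit;
  keygenT : forall k,
    circuit_from_to [::] [:: sk_len k; evk_len k] (keygen k);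
  encT : forall k,
    circuit_from_to [:: sk_len k; msg_len k] [:: ct_len k] (enc k);
  evalT : forall k n m C,
    circuit_from_to (nseq n (msg_len k)) (nseq m (msg_len k)) C ->
    circuit_from_to (evk_len k :: nseq n (ct_len k)) (nseq m (ect_len k))
      (eval k C);
  decT : forall k,
    circuit_from_to [:: sk_len k; ect_len k] [:: msg_len k] (dec k);
  keygen_poly : uniform tree_circuit keygen;
  enc_poly : uniform tree_circuit enc;
  eval_poly :
    polytime_on (tree_pair tree_nat tree_circuit) tree_circuit
      (fun u => exists n m,
        circuit_from_to (nseq n (msg_len u.1)) (nseq m (msg_len u.1)) u.2)
      (fun u => eval u.1 u.2);
  dec_poly : uniform tree_circuit dec }.

(* [(A, [:: B1; ...; Bq])] is the tuple (A, B1, ..., Bq) of an adversary that *)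
(* makes q calls to its oracle.                                               *)
Definition oracle_adversary := (circuit * seq circuit)%type.

Definition tree_oracle_adversary : oracle_adversary -> tree :=
  tree_pair tree_circuit (tree_seq tree_circuit).

(* [e] is the size of the private register kept during the oracle calls.      *)
Fixpoint adv_from_to_rec (S : qhe) (k e : nat) (X Y : seq nat)
    (A : circuit) (s : seq circuit) : Prop :=
  if s is B :: s' then
    circuit_from_to X [:: msg_len S k; e] A /\
    adv_from_to_rec S k e [:: ct_len S k; e] Y B s'
  else circuit_from_to X Y A.

Definition adv_from_to (S : qhe) (k e : nat) (X Y : seq nat)
    (A : oracle_adversary) : Prop := adv_from_to_rec S k e X Y A.1 A.2.

Local Open Scope ring_scope.
Local Open Scope complex_scope.

Section Semantics.
Variable R : realType.

(* [rho x y] is the matrix entry <x|rho|y>.  An operator on n qubits is       *)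
(* represented by its values on bit strings of length n; the values on other  *)
(* strings are irrelevant.  With this convention a tensor product of          *)
(* registers is the concatenation of strings, and an operation on some wires  *)
(* acts as the identity on all the others.                                    *)
Definition operator := seq bool -> seq bool -> R[i].

Definition set_bit (x : seq bool) (i : nat) (b : bool) : seq bool :=
  set_nth false x i b.

Definition apply_unitary1 (U : bool -> bool -> R[i]) (i : nat)
    (rho : operator) : operator := fun x y =>
  \sum_(a : bool) \sum_(b : bool)
    U (nth false x i) a * rho (set_bit x i a) (set_bit y i b)
      * (U (nth false y i) b)^*.

(* Conjugation by the permutation matrix of an involution [f].                *)
Definition apply_involution (f : seq bool -> seq bool) (rho : operator)
  : operator := fun x y => rho (f x) (f y).

Definition hadamard_mx (a b : bool) : R[i] :=
  (-1) ^+ (a && b) / (Num.sqrt (2 : R))%:C.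

Definition phase_mx (a b : bool) : R[i] :=
  if a == b then (if a then 'i else 1) else 0.

(* Insertion of registers in state |s><s| from wire [k] on.                   *)
Definition insert_basis (k : nat) (s : seq bool) (rho : operator) : operator :=
  fun x y =>
    ((take (size s) (drop k x) == s) && (take (size s) (drop k y) == s))%:R
    * rho (take k x ++ drop (k + size s) x) (take k y ++ drop (k + size s) y).

(* Partial trace over wires [k], ..., [k + n - 1].                            *)
Definition trace_out (k n : nat) (rho : operator) : operator := fun x y =>
  \sum_(w : n.-tuple bool)
    rho (take k x ++ w ++ drop k x) (take k y ++ w ++ drop k y).

(* The gate [g], with its wires counted from wire [k].                        *)
Definition apply_gate (k : nat) (rho : operator) (g : gate) : operator :=
  match g with
  | Toffoli i j l => apply_involution (fun x =>
      set_bit x (k + l) (nth false x (k + l) (+)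
        (nth false x (k + i) && nth false x (k + j)))) rho
  | Hadamard i => apply_unitary1 hadamard_mx (k + i) rho
  | Phase i => apply_unitary1 phase_mx (k + i) rho
  | Swap i j => apply_involution (fun x =>
      set_bit (set_bit x (k + i) (nth false x (k + j)))
        (k + j) (nth false x (k + i))) rho
  | Anc i => insert_basis (k + i) [:: false] rho
  | Erase i => trace_out (k + i) 1 rho
  end.

(* The circuit [C] applied to its input registers, located from wire [k] on.  *)
Definition apply_circuit (k : nat) (C : circuit) (rho : operator) : operator :=
  foldl (apply_gate k) rho (c_gates C).

(* The state of no qubits.                                                    *)
Definition unit_state : operator := fun _ _ => 1.

Section Games.
Variables (S : qhe) (k : nat).

(* The key [sk] is classical: the key register of [keygen] is measured in the *)
(* computational basis, and [evk_state sk] is the block of the key [sk], that *)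
(* is Pr[sk] times the evaluation key conditioned on [sk].                    *)
Definition evk_state (sk : seq bool) : operator := fun x y =>
  apply_circuit 0 (keygen S k) unit_state (sk ++ x) (sk ++ y).

(* Enc_sk on the message register located from wire [i] on.                   *)
Definition apply_enc (sk : seq bool) (i : nat) (rho : operator) : operator :=
  apply_circuit i (enc S k) (insert_basis i sk rho).

Fixpoint run_adv_rec (sk : seq bool) (A : circuit) (s : seq circuit)
    (rho : operator) : operator :=
  let rho' := apply_circuit 0 A rho in
  if s is B :: s' then run_adv_rec sk B s' (apply_enc sk 0 rho') else rho'.

Definition run_adv (sk : seq bool) (A : oracle_adversary) (rho : operator)
  : operator := run_adv_rec sk A.1 A.2 rho.

(* On M (x) E.                                                                *)
Definition cpa_challenge (sk : seq bool) (r : bool) (rho : operator)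
    : operator :=
  let m := msg_len S k in
  apply_enc sk 0
    (if r then rho else insert_basis 0 (nseq m false) (trace_out 0 m rho)).

(* On M_0 (x) M_1 (x) E.  The j-th message is encrypted when the messages     *)
(* before it have already been replaced with ciphertexts.                     *)
Definition mult_challenge (t : nat) (sk : seq bool) (r : bool) (rho : operator)
    : operator :=
  let n := (t * msg_len S k)%N in
  foldl (fun sigma j => apply_enc sk (j * ct_len S k) sigma)
    (if r then trace_out 0 n rho else trace_out n n rho) (iota 0 t).

(* The probability that r' = r, with r uniform and sk drawn by [keygen].      *)
Definition win_prob (challenge : seq bool -> bool -> operator -> operator)
    (A1 A2 : oracle_adversary) : R :=
  \sum_(sk : (sk_len S k).-tuple bool) \sum_(r : bool)
    2^-1 * complex.Re
      (run_adv sk A2 (challenge sk r (run_adv sk A1 (evk_state sk)))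
         [:: r] [:: r]).

End Games.

Definition negligible (eta : nat -> R) : Prop :=
  forall p : {poly R}, (forall n : nat, 0 < p.[n%:R]) ->
    exists N : nat, forall n : nat, (N < n)%N -> eta n < 1 / p.[n%:R].

Definition q_ind_cpa (S : qhe) : Prop :=
  forall (e e1 e2 : nat -> nat) (A1 A2 : nat -> oracle_adversary),
    (forall k,
      adv_from_to S k (e1 k) [:: evk_len S k] [:: msg_len S k; e k] (A1 k)) ->
    (forall k, adv_from_to S k (e2 k) [:: ct_len S k; e k] [:: 1%N] (A2 k)) ->
    uniform tree_oracle_adversary A1 ->
    uniform tree_oracle_adversary A2 ->
    exists2 eta, negligible eta &
      forall k, win_prob S k (cpa_challenge S k) (A1 k) (A2 k) <= 2^-1 + eta k.

Definition q_ind_cpa_mult (S : qhe) : Prop :=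
  forall (t e e1 e2 : nat -> nat) (A1 A2 : nat -> oracle_adversary),
    (forall k, (1 <= t k)%N) ->
    (exists p : {poly nat}, forall k, (t k <= p.[k])%N) ->
    (forall k, adv_from_to S k (e1 k) [:: evk_len S k]
      (nseq (t k) (msg_len S k) ++ nseq (t k) (msg_len S k) ++ [:: e k])
      (A1 k)) ->
    (forall k, adv_from_to S k (e2 k)
      (nseq (t k) (ct_len S k) ++ [:: e k]) [:: 1%N] (A2 k)) ->
    uniform tree_oracle_adversary A1 ->
    uniform tree_oracle_adversary A2 ->
    exists2 eta, negligible eta &
      forall k,
        win_prob S k (mult_challenge S k (t k)) (A1 k) (A2 k) <= 2^-1 + eta k.

End Semantics.

(* Main.v *)
(* From multiple-message to single-message adversaries, take t = 1 and         *)
(* M_0 = |0>.  Conversely, let N = 2^L be the least power of two with t <= N,  *)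
(* fix a bit b, and pad M_b with |0> registers to N slots.  With F_b(j) the    *)
(* probability that the multiple-message adversary answers b on encryptions    *)
(* of the N slots, the first j being replaced with |0>, an adversary that      *)
(* draws j < N uniformly and submits slot j to the challenger has advantage    *)
(* (F_b(0) - F_b(N)) / 2N, since the sum telescopes.  As F_1(N) + F_0(N) = 1,  *)
(* the two adversaries b = 0, 1 bound the advantage in the multiple-message    *)
(* game up to the polynomial factor N.                                         *)
(*                                                                             *)
(* The index j is drawn bit by bit, by L control wires in state H|0>: at the   *)
(* level of 2h slots, the control wire decides whether the challenge is in the *)
(* first half (the second half is kept) or in the second half (the first half  *)
(* is replaced with |0>, and the halves are swapped so that the challenge      *)
(* ends up in front).  The swaps are undone on the ciphertexts.                *)

Require Import Defs.
From mathcomp Require Import all_boot all_order all_algebra.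
From mathcomp Require Import reals.
From mathcomp Require Import complex zify ring lra.

Set Implicit Arguments.
Unset Strict Implicit.
Unset Printing Implicit Defensive.

Import Order.TTheory GRing.Theory Num.Theory.

(** The hybrid argument is carried out as an exact identity, [win_mult]: the advantage in the
    multiple-message game equals N times the sum of the advantages of two single-message
    adversaries, one for each b. As N is at most 2t + 1 and t is polynomially bounded, negligible
    bounds for these two give one for the multiple-message game ([negligible_sum]). In the other
    direction, [mult1_cpa] identifies the single-message game with a multiple-message game for t =
    1.

    The identity rests on three facts. By [hybrid], submitting a uniformly drawn slot, with the
    earlier slots zeroed and the later ones kept, scales the difference between encrypting all slots
    and encrypting only zeros by the factor 1/N; N is a power of two so that Hadamard gates draw the
    slot exactly uniformly. By [decide_encs] and [decide_zero], the first end of the chain of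
    hybrids is the multiple-message game with r = b, and the other end does not depend on b, so that
    its two answers have total probability 1. By [back_front], routing wires to the front and back
    again lets the oracle, which acts on a front register next to a private register of fixed size,
    act on any slot.

    These facts use three properties of circuits, collected in [channel]: linearity, locality and
    preservation of the trace. The reduction must also be printed in polynomial time; for this,
    functions on encoded data are shown to be closed under composition, lists, unary arithmetic and
    folds of polynomially bounded size, and the recursive families of gates are rewritten as maps
    over lists. *)

Local Notation tsize := Defs.tsize.

(** * Polynomial-time functions *)

Lemma horner_nat_mono (p : {poly nat}) m n : m <= n -> p.[m]%R <= p.[n]%R.
Proof.
move=> le_mn; elim/poly_ind: p => [|p c IH]; first by rewrite !horner0.
by rewrite !hornerMXaddC leq_add ?leq_mul.
Qed.

Definition polybnd (b : nat -> nat) := exists p : {poly nat}, forall n, b n <= p.[n]%R.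

Lemma polybnd_horner (p : {poly nat}) : polybnd (fun n => p.[n]%R).
Proof. by exists p. Qed.

Lemma polybnd_const c : polybnd (fun=> c).
Proof. by exists (c%:P)%R => n; rewrite hornerC. Qed.

Lemma polybnd_id : polybnd id.
Proof. by exists 'X%R => n; rewrite hornerX. Qed.

Lemma polybndD b d : polybnd b -> polybnd d -> polybnd (fun n => b n + d n).
Proof.
move=> [p hp] [q hq]; exists (p + q)%R => n.
by rewrite hornerD leq_add.
Qed.

Lemma polybndM b d : polybnd b -> polybnd d -> polybnd (fun n => b n * d n).
Proof.
move=> [p hp] [q hq]; exists (p * q)%R => n.
by rewrite hornerM leq_mul.
Qed.

Lemma polybnd_comp b d : polybnd b -> polybnd d -> polybnd (fun n => b (d n)).
Proof.
move=> [p hp] [q hq]; exists (p \Po q)%R => n; rewrite horner_comp.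
exact: leq_trans (hp _) (horner_nat_mono _ (hq _)).
Qed.

Lemma polybndS b : polybnd b -> polybnd (fun n => (b n).+1).
Proof.
move=> hb; have [p hp] := polybndD (polybnd_const 1) hb.
by exists p => n; apply: hp.
Qed.

Ltac polyb := repeat first
  [ exact: polybnd_const | exact: polybnd_id | exact: polybnd_horner
  | apply: polybndS | apply: polybndD | apply: polybndM
  | apply: (polybnd_comp (polybnd_horner _)) ].

(** Every rule that copies a tree pays for its size, so a time bound is also a bound on the output.
    This is what makes polynomial bounds compose in [pt_comp]. *)
Lemma exec_tsize P x y c : exec P x y c -> tsize y <= c.
Proof. by elim=> //=; lia. Qed.

Lemma tsize_gt0 x : 0 < tsize x.
Proof. by case: x. Qed.

Definition ptime (A B : Type) (eA : A -> tree) (eB : B -> tree) (f : A -> B) :=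
  polytime_on eA eB (fun=> True) f.

Lemma ptimeI (A B : Type) (eA : A -> tree) (eB : B -> tree) (f : A -> B) P b :
  polybnd b ->
  (forall a, exists2 c, exec P (eA a) (eB (f a)) c & c <= b (tsize (eA a))) ->
  ptime eA eB f.
Proof.
move=> [p hp] h; exists P, p => a _; have [c hc le_c] := h a.
by exists c => //; apply: leq_trans le_c (hp _).
Qed.

Lemma ptime_exec A B (eA : A -> tree) (eB : B -> tree) f : ptime eA eB f ->
  exists P (p : {poly nat}), forall a,
    exists2 c, exec P (eA a) (eB (f a)) c & c <= p.[tsize (eA a)]%R.
Proof. by move=> [P [p h]]; exists P, p => a; apply: h. Qed.

Lemma ptime_tsize A B (eA : A -> tree) (eB : B -> tree) f : ptime eA eB f ->
  exists p : {poly nat}, forall a, tsize (eB (f a)) <= p.[tsize (eA a)]%R.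
Proof.
move=> /ptime_exec[P [p h]]; exists p => a; have [c hc le_c] := h a.
exact: leq_trans (exec_tsize hc) le_c.
Qed.

(* Functions between types are identified with their effect on the encodings, *)
(* so a change of encoding that does not change the tree is free.             *)
Lemma ptime_recode A B B' (eA : A -> tree) (eB : B -> tree) (eB' : B' -> tree)
    f f' : (forall a, eB' (f' a) = eB (f a)) -> ptime eA eB f -> ptime eA eB' f'.
Proof.
by move=> eq_f [P [p h]]; exists P, p => a Da; have := h a Da; rewrite eq_f.
Qed.

Section Closure.
Variables (G : Type) (eG : G -> tree).

Lemma pt_eq A (eA : A -> tree) f f' : f =1 f' -> ptime eG eA f -> ptime eG eA f'.
Proof. by move=> eq_f; apply: ptime_recode => g; rewrite eq_f. Qed.

Lemma pt_id : ptime eG eG id.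
Proof.
apply: (@ptimeI _ _ _ _ _ PId succn); first by polyb.
by move=> a; exists (tsize (eG a)).+1 => //; constructor.
Qed.

Lemma pt_comp A B (eA : A -> tree) (eB : B -> tree) (h : A -> B) f :
  ptime eA eB h -> ptime eG eA f -> ptime eG eB (fun g => h (f g)).
Proof.
move=> /ptime_exec[P [p hP]] /ptime_exec[Q [q hQ]].
apply: (@ptimeI _ _ _ _ _ (PComp P Q) (fun n => (q.[n]%R + p.[q.[n]]%R).+1)).
  by polyb.
move=> g; have [c hc le_c] := hQ g; have [d hd le_d] := hP (f g).
exists (c + d).+1; first by econstructor; eassumption.
rewrite ltnS leq_add // (leq_trans le_d) // horner_nat_mono //.
exact: leq_trans (exec_tsize hc) le_c.
Qed.

Lemma pt_const A (eA : A -> tree) (a : A) : ptime eG eA (fun=> a).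
Proof.
have [P [c hP]] : exists P c, forall x, exec P x (eA a) c.
  elim: (eA a) => [|x [P [c hP]] y [Q [d hQ]]]; first by exists PLeaf, 1; constructor.
  by exists (PPair P Q), (c + d).+1 => z; constructor.
by apply: (ptimeI (polybnd_const c)) => g; exists c.
Qed.

Lemma pt_pair A B (eA : A -> tree) (eB : B -> tree) f h :
  ptime eG eA f -> ptime eG eB h ->
  ptime eG (tree_pair eA eB) (fun g => (f g, h g)).
Proof.
move=> /ptime_exec[P [p hP]] /ptime_exec[Q [q hQ]].
apply: (@ptimeI _ _ _ _ _ (PPair P Q) (fun n => (p.[n]%R + q.[n]%R).+1)).
  by polyb.
move=> g; have [c hc le_c] := hP g; have [d hd le_d] := hQ g.
by exists (c + d).+1; [constructor | rewrite ltnS leq_add].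
Qed.

Lemma pt_fst A B (eA : A -> tree) (eB : B -> tree) f :
  ptime eG (tree_pair eA eB) f -> ptime eG eA (fun g => (f g).1).
Proof.
have hf : ptime (tree_pair eA eB) eA fst.
  apply: (@ptimeI _ _ _ _ _ PFst succn); first by polyb.
  by case=> a b; exists (tsize (eA a)).+1; [constructor | rewrite /=; lia].
exact: pt_comp.
Qed.

Lemma pt_snd A B (eA : A -> tree) (eB : B -> tree) f :
  ptime eG (tree_pair eA eB) f -> ptime eG eB (fun g => (f g).2).
Proof.
have hf : ptime (tree_pair eA eB) eB snd.
  apply: (@ptimeI _ _ _ _ _ PSnd succn); first by polyb.
  by case=> a b; exists (tsize (eB b)).+1; [constructor | rewrite /=; lia].
exact: pt_comp.
Qed.

Lemma pt_if0 A (eA : A -> tree) n f h :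
  ptime eG tree_nat n -> ptime eG eA f -> ptime eG eA h ->
  ptime eG eA (fun g => if n g == 0 then f g else h g).
Proof.
move=> /ptime_exec[B [b hB]] /ptime_exec[P [p hP]] /ptime_exec[Q [q hQ]].
apply: (@ptimeI _ _ _ _ _ (PIf B Q P) (fun n => (b.[n]%R + (p.[n]%R + q.[n]%R)).+1)).
  by polyb.
move=> g; have [c hc le_c] := hP g; have [d hd le_d] := hQ g.
have [e he le_e] := hB g; case: (n g) he => [|m] /= he.
  by exists (e + c).+1; [apply: ExIfF | rewrite ltnS leq_add // (leq_trans le_c) // leq_addr].
exists (e + d).+1; [exact: ExIfT he hd|].
by rewrite ltnS leq_add // (leq_trans le_d) // leq_addl.
Qed.

End Closure.

Lemma tsize_seq_size A (eA : A -> tree) s : size s <= tsize (tree_seq eA s).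
Proof. by elim: s => //= a s; lia. Qed.

Lemma tsize_take A (eA : A -> tree) i s :
  tsize (tree_seq eA (take i s)) <= tsize (tree_seq eA s).
Proof. by elim: s i => [|a s IH] [|i] //=; have := IH i; lia. Qed.

(** * Folds as while loops *)

Section Fold.
Variables (G A B : Type) (eG : G -> tree) (eA : A -> tree) (eB : B -> tree).
Variable F : G -> B -> A -> B.

(** The loop state encodes [(g, (b, s))], with accumulator [b] and remaining list [s]. The test
    reads [s], which is a [Node] exactly when it is nonempty. *)
Let fold_test := PComp PSnd PSnd.
Let fold_body PF :=
  PPair PFst (PPair
    (PComp PF (PPair PFst (PPair (PComp PFst PSnd) (PComp PFst (PComp PSnd PSnd)))))
    (PComp PSnd (PComp PSnd PSnd))).
Let fold_loop PF := PWhile fold_test (fold_body PF).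

(** [M] bounds the state after every prefix of the list, hence the cost of each round; the constants
    20 and 30 generously cover the bookkeeping. A bound on all intermediate accumulators is
    essential, since a step that doubles the accumulator would be cheap on its own. *)
Lemma exec_fold_loop PF (p : {poly nat}) g M :
  (forall b a, exists2 c,
     exec PF (tree_pair eG (tree_pair eB eA) (g, (b, a))) (eB (F g b a)) c &
     c <= p.[tsize (tree_pair eG (tree_pair eB eA) (g, (b, a)))]%R) ->
  forall s b,
    (forall i, tsize (eG g) + tsize (eB (foldl (F g) b (take i s)))
               + tsize (tree_seq eA s) + 2 <= M) ->
  exists2 c,
    exec (fold_loop PF) (Node (eG g) (Node (eB b) (tree_seq eA s)))
      (Node (eG g) (Node (eB (foldl (F g) b s)) Leaf)) c &
    c <= (size s).+1 * (p.[M]%R + 20 * M + 30).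
Proof.
move=> hF; elim=> [|a s IH] b hM /=.
  eexists; first by apply: ExWhileF; repeat econstructor.
  by have := hM 0; rewrite /=; lia.
have hM' i : tsize (eG g) + tsize (eB (foldl (F g) (F g b a) (take i s)))
               + tsize (tree_seq eA s) + 2 <= M.
  by apply: leq_trans (hM i.+1); rewrite /=; lia.
have [c hc le_c] := IH _ hM'; have [d hd le_d] := hF b a.
have le_sz : tsize (tree_pair eG (tree_pair eB eA) (g, (b, a))) <= M.
  by have := hM 0; rewrite /=; have := tsize_gt0 (tree_seq eA s); lia.
have {}le_d := leq_trans le_d (horner_nat_mono p le_sz).
eexists.
  apply: ExWhileT; [by repeat econstructor | | exact: hc].
  apply: ExPair; first by econstructor.
  apply: ExPair.
    apply: ExComp; last exact: hd.
    by repeat econstructor.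
  by repeat econstructor.
have := hM 0; have := le_sz; rewrite /=.
have := tsize_gt0 (eA a); have := tsize_gt0 (eB b); have := tsize_gt0 (eG g).
have := tsize_gt0 (tree_seq eA s).
move: (p.[M])%R le_c le_d => pM le_c le_d.
move: (tsize (eA a)) (tsize (eB b)) (tsize (eG g)) (tsize (tree_seq eA s)).
move=> n1 n2 n3 n4; rewrite [(size s).+2 * _]mulSn; nia.
Qed.

Lemma pt_foldl s b :
  ptime (tree_pair eG (tree_pair eB eA)) eB (fun u => F u.1 u.2.1 u.2.2) ->
  ptime eG (tree_seq eA) s -> ptime eG eB b ->
  (exists q : {poly nat}, forall g i,
     tsize (eB (foldl (F g) (b g) (take i (s g)))) <= q.[tsize (eG g)]%R) ->
  ptime eG eB (fun g => foldl (F g) (b g) (s g)).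
Proof.
move=> /ptime_exec[PF [p hF]] /ptime_exec[Ps [r hs]] /ptime_exec[Pb [t hb]] [q hq].
pose M n := (n + q.[n]%R + r.[n]%R + 2)%N.
apply: (@ptimeI _ _ _ _ _
  (PComp (PComp PFst PSnd) (PComp (fold_loop PF) (PPair PId (PPair Pb Ps))))
  (fun n => (r.[n]%R).+1 * (p.[M n]%R + 20 * M n + 30)
            + (n + 3 * q.[n]%R + t.[n]%R + r.[n]%R + 20))).
  by rewrite /M; polyb.
move=> g; have [c hc le_c] := hs g; have [d hd le_d] := hb g.
have le_sz := leq_trans (exec_tsize hc) le_c.
have hM i : tsize (eG g) + tsize (eB (foldl (F g) (b g) (take i (s g))))
               + tsize (tree_seq eA (s g)) + 2 <= M (tsize (eG g)).
  by rewrite /M; have := hq g i; lia.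
have [e he le_e] := exec_fold_loop (fun b a => hF (g, (b, a))) hM.
eexists.
  apply: ExComp; last by repeat econstructor.
  apply: ExComp; last exact: he.
  by repeat (econstructor; try eassumption).
have le_s := leq_trans (tsize_seq_size eA (s g)) le_sz.
have := hq g (size (s g)); rewrite take_size => h1.
have {}le_e : e <= (r.[tsize (eG g)]%R).+1 *
    (p.[M (tsize (eG g))]%R + 20 * M (tsize (eG g)) + 30).
  by apply: leq_trans le_e _; rewrite leq_mul.
by rewrite /=; lia.
Qed.

End Fold.

Lemma tsize_foldl_inc (A B : Type) (eA : A -> tree) (eB : B -> tree)
    (F : B -> A -> B) q M :
  (forall b a, tsize (eA a) <= M -> tsize (eB (F b a)) <= tsize (eB b) + q) ->
  forall s b, tsize (tree_seq eA s) <= M ->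
  tsize (eB (foldl F b s)) <= tsize (eB b) + size s * q.
Proof.
move=> hF; elim=> [|a s IH] b /= le_s; first by rewrite addn0.
have /(_ (F b a)) := IH _ (leq_trans _ le_s).
by have := hF b a; lia.
Qed.

(** The growth [q] of the accumulator depends on [g] but not on the accumulator itself, so
    polynomially many rounds keep it polynomial. *)
Lemma pt_foldl_inc (G A B : Type) (eG : G -> tree) (eA : A -> tree)
    (eB : B -> tree) (F : G -> B -> A -> B) s b :
  ptime (tree_pair eG (tree_pair eB eA)) eB (fun u => F u.1 u.2.1 u.2.2) ->
  ptime eG (tree_seq eA) s -> ptime eG eB b ->
  (exists2 q, polybnd q & forall g b a,
     tsize (eA a) <= tsize (tree_seq eA (s g)) ->
     tsize (eB (F g b a)) <= tsize (eB b) + q (tsize (eG g))) ->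
  ptime eG eB (fun g => foldl (F g) (b g) (s g)).
Proof.
move=> hF hs hb [q pq hq]; apply: (pt_foldl hF hs hb).
have [r hr] := ptime_tsize hs; have [t ht] := ptime_tsize hb.
suff [p hp] : polybnd (fun n => t.[n]%R + r.[n]%R * q n).
  exists p => g i; apply: leq_trans (hp _).
  have le_sz : size (take i (s g)) <= r.[tsize (eG g)]%R.
    apply: leq_trans (hr g); apply: leq_trans (tsize_take eA i _).
    exact: tsize_seq_size.
  apply: leq_trans (leq_add (ht g) (leq_mul le_sz (leqnn _))).
  exact: tsize_foldl_inc (hq g) _ _ (tsize_take _ _ _).
by polyb.
Qed.

(** * Polynomial-time list operations and unary arithmetic *)

Lemma pt_cons (G : Type) (eG : G -> tree)
    A (eA : A -> tree) x s : ptime eG eA x ->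
  ptime eG (tree_seq eA) s -> ptime eG (tree_seq eA) (fun g => x g :: s g).
Proof. by move=> hx hs; apply: ptime_recode (pt_pair hx hs). Qed.

Lemma pt_behead (G : Type) (eG : G -> tree)
    A (eA : A -> tree) s : ptime eG (tree_seq eA) s ->
  ptime eG (tree_seq eA) (fun g => behead (s g)).
Proof.
suff h : ptime (tree_seq eA) (tree_seq eA) behead by apply: pt_comp.
apply: (@ptimeI _ _ _ _ _ PSnd succn); first by polyb.
case=> [|a l] /=; first by exists 1 => //; constructor.
by eexists; [constructor | lia].
Qed.

Lemma pt_catrev (G : Type) (eG : G -> tree) A (eA : A -> tree) s1 s2 :
  ptime eG (tree_seq eA) s1 -> ptime eG (tree_seq eA) s2 ->
  ptime eG (tree_seq eA) (fun g => catrev (s1 g) (s2 g)).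
Proof.
move=> h1 h2.
apply: (@pt_eq _ _ _ _ (fun g => foldl (fun b a => a :: b) (s2 g) (s1 g))).
  by move=> g; elim: (s1 g) (s2 g) => //= a s IH b; rewrite IH.
have [q hq] := ptime_tsize h1.
apply: (@pt_foldl_inc _ _ _ _ _ _ (fun _ b a => a :: b) _ _ _ h1 h2).
  apply: pt_cons; first by apply: pt_snd; apply: pt_snd; apply: pt_id.
  by apply: pt_fst; apply: pt_snd; apply: pt_id.
exists (fun n => q.[n]%R.+1); first by polyb.
by move=> g b a /=; have := hq g; lia.
Qed.

Lemma pt_rev (G : Type) (eG : G -> tree)
    A (eA : A -> tree) s : ptime eG (tree_seq eA) s ->
  ptime eG (tree_seq eA) (fun g => rev (s g)).
Proof. by move=> h; apply: pt_catrev => //; apply: pt_const. Qed.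

Lemma pt_cat (G : Type) (eG : G -> tree) A (eA : A -> tree) s1 s2 :
  ptime eG (tree_seq eA) s1 -> ptime eG (tree_seq eA) s2 ->
  ptime eG (tree_seq eA) (fun g => s1 g ++ s2 g).
Proof.
move=> h1 h2; apply: pt_eq (pt_catrev (pt_rev h1) h2) => g.
by rewrite catrevE revK.
Qed.

Lemma pt_map (G : Type) (eG : G -> tree)
    A B (eA : A -> tree) (eB : B -> tree) (F : G -> A -> B) s :
  ptime (tree_pair eG eA) eB (fun u => F u.1 u.2) ->
  ptime eG (tree_seq eA) s ->
  ptime eG (tree_seq eB) (fun g => [seq F g a | a <- s g]).
Proof.
move=> hF hs.
apply: (@pt_eq _ _ _ _
  (fun g => rev (foldl (fun b a => F g a :: b) [::] (s g)))).
  move=> g; rewrite -[RHS]revK; congr rev.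
  rewrite -[rev _]cats0; elim: (s g) [::] => //= a l IH b.
  by rewrite IH rev_cons cat_rcons.
apply: pt_rev; have [p hp] := ptime_tsize hF; have [q hq] := ptime_tsize hs.
apply: (@pt_foldl_inc _ _ _ _ _ _ (fun g b a => F g a :: b) _ _ _ hs (pt_const _ _ _)).
  apply: pt_cons; last by apply: pt_fst; apply: pt_snd; apply: pt_id.
  apply: (pt_comp (f := fun u => (u.1, u.2.2)) hF); apply: pt_pair.
    by apply: pt_fst; apply: pt_id.
  by apply: pt_snd; apply: pt_snd; apply: pt_id.
exists (fun n => p.[(n + q.[n]%R).+1]%R.+1); first by polyb.
move=> g b a le_a /=; rewrite addnS ltnS addnC leq_add2l.
apply: leq_trans (hp (g, a)) _; apply: horner_nat_mono.
by rewrite /= ltnS leq_add2l (leq_trans le_a).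
Qed.

Lemma tsize_cat A (eA : A -> tree) s1 s2 :
  tsize (tree_seq eA (s1 ++ s2)) <=
  tsize (tree_seq eA s1) + tsize (tree_seq eA s2).
Proof. by elim: s1 => [|a s IH] /=; lia. Qed.

Lemma pt_flatten (G : Type) (eG : G -> tree)
    A (eA : A -> tree) s : ptime eG (tree_seq (tree_seq eA)) s ->
  ptime eG (tree_seq eA) (fun g => flatten (s g)).
Proof.
move=> hs; have [q hq] := ptime_tsize hs.
apply: (@pt_eq _ _ _ _ (fun g => foldl cat [::] (s g))).
  move=> g; rewrite -[RHS]cat0s; elim: (s g) [::] => [|a l IH] b /=.
    by rewrite cats0.
  by rewrite IH catA.
apply: (@pt_foldl_inc _ _ _ _ _ _ (fun _ => cat) _ _ _ hs (pt_const _ _ _)).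
  apply: pt_cat; first by apply: pt_fst; apply: pt_snd; apply: pt_id.
  by apply: pt_snd; apply: pt_snd; apply: pt_id.
exists (fun n => q.[n]%R); first by polyb.
move=> g b a le_a; apply: leq_trans (tsize_cat _ _ _) _.
by rewrite leq_add2l (leq_trans le_a).
Qed.

Lemma pt_last (G : Type) (eG : G -> tree)
    A (eA : A -> tree) x s : ptime eG eA x ->
  ptime eG (tree_seq eA) s -> ptime eG eA (fun g => last (x g) (s g)).
Proof.
move=> hx hs; have [q hq] := ptime_tsize hs.
apply: (@pt_eq _ _ _ _ (fun g => foldl (fun _ a => a) (x g) (s g))).
  by move=> g; elim: (s g) (x g) => //=.
apply: (@pt_foldl_inc _ _ _ _ _ _ (fun _ _ a => a) _ _ _ hs hx).
  by apply: pt_snd; apply: pt_snd; apply: pt_id.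
exists (fun n => q.[n]%R); first by polyb.
by move=> g b a le_a; rewrite (leq_trans le_a) // (leq_trans (hq g)) // leq_addl.
Qed.

Lemma pt_head (G : Type) (eG : G -> tree)
    A (eA : A -> tree) x s : ptime eG eA x ->
  ptime eG (tree_seq eA) s -> ptime eG eA (fun g => head (x g) (s g)).
Proof.
move=> hx hs; apply: pt_eq (pt_last hx (pt_rev hs)) => g.
by case: (s g) => // a l; rewrite rev_cons last_rcons.
Qed.

Definition tree_unit (_ : unit) := Leaf.

(** Unary numbers and lists of units have the same trees, so arithmetic reduces to list processing
    by [ptime_recode]. *)
Lemma tree_nat_nseq n : tree_nat n = tree_seq tree_unit (nseq n tt).
Proof. by elim: n => //= n ->. Qed.

Lemma pt_unary (G : Type) (eG : G -> tree) n : ptime eG tree_nat n ->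
  ptime eG (tree_seq tree_unit) (fun g => nseq (n g) tt).
Proof. by apply: ptime_recode => g; rewrite tree_nat_nseq. Qed.

Lemma pt_size (G : Type) (eG : G -> tree)
    A (eA : A -> tree) s : ptime eG (tree_seq eA) s ->
  ptime eG tree_nat (fun g => size (s g)).
Proof.
move=> hs.
have hu : ptime eG (tree_seq tree_unit) (fun g => [seq tt | _ <- s g]).
  by apply: pt_map hs; apply: pt_const.
apply: ptime_recode hu => g; rewrite tree_nat_nseq.
by elim: (s g) => //= a l ->.
Qed.

Lemma pt_nseq (G : Type) (eG : G -> tree)
    A (eA : A -> tree) n x : ptime eG tree_nat n -> ptime eG eA x ->
  ptime eG (tree_seq eA) (fun g => nseq (n g) (x g)).
Proof.
move=> hn hx.
apply: (@pt_eq _ _ _ _ (fun g => [seq x g | _ <- nseq (n g) tt])).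
  by move=> g; rewrite map_nseq.
apply: pt_map (pt_unary hn); apply: (pt_comp hx).
by apply: pt_fst; apply: pt_id.
Qed.

Lemma pt_addn (G : Type) (eG : G -> tree)
    m n : ptime eG tree_nat m -> ptime eG tree_nat n ->
  ptime eG tree_nat (fun g => m g + n g).
Proof.
move=> hm hn; apply: pt_eq (pt_size (pt_cat (pt_unary hm) (pt_unary hn))) => g.
by rewrite size_cat !size_nseq.
Qed.

Lemma pt_succn (G : Type) (eG : G -> tree)
    n : ptime eG tree_nat n -> ptime eG tree_nat (fun g => (n g).+1).
Proof. by move=> hn; apply: (pt_addn (pt_const _ tree_nat 1) hn). Qed.

Lemma pt_muln (G : Type) (eG : G -> tree)
    m n : ptime eG tree_nat m -> ptime eG tree_nat n ->
  ptime eG tree_nat (fun g => m g * n g).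
Proof.
move=> hm hn.
apply: pt_eq (pt_size (pt_flatten (pt_nseq hm (pt_unary hn)))) => g.
by rewrite size_flatten /shape map_nseq size_nseq sumn_nseq mulnC.
Qed.

Lemma pt_predn (G : Type) (eG : G -> tree)
    n : ptime eG tree_nat n -> ptime eG tree_nat (fun g => (n g).-1).
Proof.
move=> hn; apply: pt_eq (pt_size (pt_behead (pt_unary hn))) => g.
by rewrite size_behead size_nseq.
Qed.

Lemma pt_subn (G : Type) (eG : G -> tree)
    m n : ptime eG tree_nat m -> ptime eG tree_nat n ->
  ptime eG tree_nat (fun g => m g - n g).
Proof.
move=> hm hn.
apply: (@pt_eq _ _ _ _ (fun g => foldl (fun b _ => b.-1) (m g) (nseq (n g) tt))).
  by move=> g; elim: (n g) (m g) => [|k IH] b /=; [rewrite subn0 | rewrite IH; lia].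
apply: (@pt_foldl_inc _ _ _ _ _ _ (fun _ b _ => b.-1) _ _ _ (pt_unary hn) hm).
  by apply: pt_predn; apply: pt_fst; apply: pt_snd; apply: pt_id.
exists (fun=> 0); first by polyb.
by move=> g [|b] a _ //=; lia.
Qed.

Lemma tsize_nat n : tsize (tree_nat n) = n.*2.+1.
Proof. by elim: n => //= n ->; lia. Qed.

Lemma tsize_seq_le A (eA : A -> tree) M s : all (fun a => tsize (eA a) <= M) s ->
  tsize (tree_seq eA s) <= (size s * M.+1).+1.
Proof. by elim: s => //= x s IH /andP[le_x /IH]; lia. Qed.

Lemma pt_iota0 (G : Type) (eG : G -> tree) n : ptime eG tree_nat n ->
  ptime eG (tree_seq tree_nat) (fun g => iota 0 (n g)).
Proof.
move=> hn.
(* The length of the accumulator serves as the counter; the list comes out reversed. *)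
have foldE k : foldl (fun (b : seq nat) (_ : unit) => size b :: b) [::] (nseq k tt)
    = rev (iota 0 k).
  elim: k => // k IH; rewrite -addn1 nseqD iotaD foldl_cat IH /= size_rev size_iota.
  by rewrite rev_cat.
apply: (@pt_eq _ _ _ _ (fun g =>
  rev (foldl (fun b _ => size b :: b) [::] (nseq (n g) tt)))).
  by move=> g; rewrite foldE revK.
apply: pt_rev.
apply: (@pt_foldl _ _ _ _ _ _ (fun _ b _ => size b :: b) _ _ _ (pt_unary hn)).
- have h : ptime (tree_pair eG (tree_pair (tree_seq tree_nat) tree_unit))
      (tree_seq tree_nat) (fun u => u.2.1).
    by apply: pt_fst; apply: pt_snd; apply: pt_id.
  by apply: pt_cons => //; apply: pt_size h.
- exact: pt_const.
have [q hq] := ptime_tsize hn.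
suff [p hp] : polybnd (fun n => (q.[n]%R * (2 * q.[n]%R + 2)).+1).
  exists p => g i; apply: leq_trans (hp _).
  have [k le_k ->] : exists2 k, k <= n g & take i (nseq (n g) tt) = nseq k tt.
    have [le_i | /ltnW lt_i] := leqP i (n g).
      by exists i; rewrite ?take_nseq.
    by exists (n g); rewrite ?take_oversize ?size_nseq.
  rewrite foldE.
  have le_n : k <= q.[tsize (eG g)]%R.
    by have := hq g; rewrite tsize_nat; lia.
  apply: leq_trans (tsize_seq_le (M := (2 * q.[tsize (eG g)]%R).+1) _) _.
    by apply/allP => x; rewrite mem_rev mem_iota tsize_nat; lia.
  by rewrite size_rev size_iota ltnS leq_mul //; lia.
by polyb.
Qed.

Lemma pt_iota (G : Type) (eG : G -> tree)
    m n : ptime eG tree_nat m -> ptime eG tree_nat n ->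
  ptime eG (tree_seq tree_nat) (fun g => iota (m g) (n g)).
Proof.
move=> hm hn.
apply: (@pt_eq _ _ _ _ (fun g => [seq m g + i | i <- iota 0 (n g)])).
  by move=> g; rewrite -iotaDl addn0.
apply: pt_map (pt_iota0 hn).
apply: pt_addn; first by apply: (pt_comp hm); apply: pt_fst; apply: pt_id.
by apply: pt_snd; apply: pt_id.
Qed.

(** * Gates and circuits as data *)

Lemma pt_toffoli (G : Type) (eG : G -> tree)
    i j l : ptime eG tree_nat i -> ptime eG tree_nat j ->
  ptime eG tree_nat l -> ptime eG tree_gate (fun g => Toffoli (i g) (j g) (l g)).
Proof.
move=> hi hj hl; apply: (@ptime_recode _ _ _ _ (tree_pair tree_nat (tree_seq tree_nat))
  _ (fun g => (0, [:: i g; j g; l g]))) => //.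
apply: pt_pair; first exact: pt_const.
by do 3!apply: pt_cons => //; apply: pt_const.
Qed.

Lemma pt_swap (G : Type) (eG : G -> tree)
    i j : ptime eG tree_nat i -> ptime eG tree_nat j ->
  ptime eG tree_gate (fun g => Swap (i g) (j g)).
Proof.
move=> hi hj; apply: (@ptime_recode _ _ _ _ (tree_pair tree_nat (tree_seq tree_nat))
  _ (fun g => (3, [:: i g; j g]))) => //.
apply: pt_pair; first exact: pt_const.
by do 2!apply: pt_cons => //; apply: pt_const.
Qed.

Lemma pt_gate1 (G : Type) (eG : G -> tree) (h : nat -> gate) n i :
  (forall x, tree_gate (h x) = Node (tree_nat n) (tree_seq tree_nat [:: x])) ->
  ptime eG tree_nat i -> ptime eG tree_gate (fun g => h (i g)).
Proof.
move=> hE hi; apply: (@ptime_recode _ _ _ _ (tree_pair tree_nat (tree_seq tree_nat))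
  _ (fun g => (n, [:: i g]))) => [g|]; first by rewrite hE.
apply: pt_pair; first exact: pt_const.
by apply: pt_cons => //; apply: pt_const.
Qed.

Lemma pt_hadamard (G : Type) (eG : G -> tree) i : ptime eG tree_nat i ->
  ptime eG tree_gate (fun g => Hadamard (i g)).
Proof. exact: (pt_gate1 (n := 1)). Qed.

Lemma pt_anc (G : Type) (eG : G -> tree)
    i : ptime eG tree_nat i -> ptime eG tree_gate (fun g => Anc (i g)).
Proof. exact: (pt_gate1 (n := 4)). Qed.

Lemma pt_erase (G : Type) (eG : G -> tree) i : ptime eG tree_nat i ->
  ptime eG tree_gate (fun g => Erase (i g)).
Proof. exact: (pt_gate1 (n := 5)). Qed.

Definition tree_circuit_data := tree_pair (tree_seq tree_nat)
  (tree_pair (tree_seq tree_gate) (tree_seq tree_nat)).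

Lemma pt_circuit (G : Type) (eG : G -> tree)
    X g Y : ptime eG (tree_seq tree_nat) X ->
  ptime eG (tree_seq tree_gate) g -> ptime eG (tree_seq tree_nat) Y ->
  ptime eG tree_circuit (fun a => Circuit (X a) (g a) (Y a)).
Proof. by move=> hX hg hY; apply: ptime_recode (pt_pair hX (pt_pair hg hY)). Qed.

Lemma ptime_circuit (G : Type) (eG : G -> tree) C : ptime eG tree_circuit C ->
  ptime eG tree_circuit_data (fun a => (c_in (C a), (c_gates (C a), c_out (C a)))).
Proof. exact: ptime_recode. Qed.

Lemma pt_c_in (G : Type) (eG : G -> tree) C : ptime eG tree_circuit C ->
  ptime eG (tree_seq tree_nat) (fun a => c_in (C a)).
Proof. by move=> /ptime_circuit/pt_fst. Qed.

Lemma pt_c_gates (G : Type) (eG : G -> tree) C : ptime eG tree_circuit C ->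
  ptime eG (tree_seq tree_gate) (fun a => c_gates (C a)).
Proof. by move=> /ptime_circuit/pt_snd/pt_fst. Qed.

Lemma pt_c_out (G : Type) (eG : G -> tree) C : ptime eG tree_circuit C ->
  ptime eG (tree_seq tree_nat) (fun a => c_out (C a)).
Proof. by move=> /ptime_circuit/pt_snd/pt_snd. Qed.

Local Open Scope ring_scope.
Local Open Scope complex_scope.

(** * Channels and their kernels *)

(** Plain lists instead of tuples, so that splitting a sum along a concatenation in [sum_bits_cat]
    requires no casts. *)
Definition bits n : seq (seq bool) := [seq val w | w : n.-tuple bool].

Lemma mem_bits n s : (s \in bits n) = (size s == n).
Proof.
apply/mapP/eqP => [[w _ ->]|sz]; first by rewrite size_tuple.
by exists (tcast sz (in_tuple s)); rewrite ?mem_enum //= val_tcast.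
Qed.

Lemma bits_uniq n : uniq (bits n).
Proof. by rewrite map_inj_uniq ?enum_uniq //; apply: val_inj. Qed.

Lemma sum_tuple_bits (V : nmodType) n (F : seq bool -> V) :
  \sum_(w : n.-tuple bool) F w = \sum_(w <- bits n) F w.
Proof. by rewrite big_map big_enum. Qed.

Lemma eq_sum_bits (V : nmodType) n (F1 F2 : seq bool -> V) :
  (forall w, size w = n -> F1 w = F2 w) ->
  \sum_(w <- bits n) F1 w = \sum_(w <- bits n) F2 w.
Proof. by move=> h; apply: eq_big_seq => w; rewrite mem_bits => /eqP/h. Qed.

Lemma sum_bits_cat (V : nmodType) n m (F : seq bool -> V) :
  \sum_(w <- bits (n + m)) F w = \sum_(u <- bits n) \sum_(v <- bits m) F (u ++ v).
Proof.
rewrite -[RHS]big_allpairs_dep.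
apply: perm_big; apply: uniq_perm; first exact: bits_uniq.
  apply: allpairs_uniq; try exact: bits_uniq.
  move=> [u v] [u' v'] /allpairsP[[p q] /= [hp hq [-> ->]]].
  move=> /allpairsP[[p' q'] /= [hp' hq' [-> ->]]] /eqP.
  move: hp hp'; rewrite !mem_bits => /eqP hp /eqP hp'.
  by rewrite eqseq_cat ?hp ?hp' // => /andP[/eqP-> /eqP->].
move=> w; rewrite mem_bits; apply/eqP/allpairsP => [sz|[[u v]/= []]].
  exists (take n w, drop n w); rewrite !mem_bits size_takel ?size_drop; last by lia.
  by rewrite cat_take_drop eqxx; split=> //; apply/eqP; lia.
by rewrite !mem_bits => /eqP<- /eqP<- ->; rewrite size_cat.
Qed.

Lemma sum_bits0 (V : nmodType) (F : seq bool -> V) :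
  \sum_(w <- bits 0) F w = F [::].
Proof.
rewrite (perm_big [:: [::]]) ?big_seq1 //.
by apply: uniq_perm; rewrite ?bits_uniq // => w; rewrite mem_bits inE size_eq0.
Qed.

Lemma sum_bits1 (V : nmodType) (F : seq bool -> V) :
  \sum_(w <- bits 1) F w = \sum_(b : bool) F [:: b].
Proof.
rewrite big_bool /= (perm_big [:: [:: true]; [:: false]]).
  by rewrite big_cons big_seq1.
apply: uniq_perm; rewrite ?bits_uniq // => w; rewrite mem_bits !inE.
by case: w => [|[] [|? ?]].
Qed.

Lemma sum_bits_delta (V : pzRingType) n s (F : seq bool -> V) : size s = n ->
  \sum_(w <- bits n) (w == s)%:R * F w = F s.
Proof.
move=> sz; rewrite (bigD1_seq s) ?bits_uniq ?mem_bits ?sz //= eqxx mul1r.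
by rewrite big1 ?addr0 // => w /negbTE->; rewrite mul0r.
Qed.

Lemma sum_bits_delta_sym (V : pzRingType) n s (F : seq bool -> V) : size s = n ->
  \sum_(w <- bits n) (s == w)%:R * F w = F s.
Proof.
by move=> sz; under eq_bigr do rewrite eq_sym; apply: sum_bits_delta.
Qed.

Lemma size_cut3 i n q (x : seq bool) : size x = (i + (n + q))%N ->
  exists p z s, [/\ x = p ++ z ++ s, size p = i, size z = n & size s = q].
Proof.
move=> sx; exists (take i x), (take n (drop i x)), (drop n (drop i x)).
by rewrite !cat_take_drop; split; rewrite ?size_takel ?size_drop //; lia.
Qed.

Lemma take_cut3 i n (p z s : seq bool) : size p = i -> size z = n ->
  take n (drop i (p ++ z ++ s)) = z.
Proof. by move=> <- <-; rewrite drop_size_cat // take_size_cat. Qed.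

Lemma drop_cut3 i n (p z s : seq bool) : size p = i -> size z = n ->
  drop i (drop n (p ++ z ++ s)) = s.
Proof.
by move=> <- <-; rewrite drop_drop catA drop_size_cat // size_cat.
Qed.

Section Channels.
Variable R : realType.
Local Notation operator := (operator R).
Implicit Types (rho : operator) (a x y u : seq bool).

(* [K x y x' y'] is the coefficient of <x'|rho|y'> in <x|Phi(rho)|y>.         *)
Definition kernel := seq bool -> seq bool -> seq bool -> seq bool -> R[i].

(** The spectator strings [a], [u] of the row and [a'], [u'] of the column are independent of each
    other: [Phi] acts as the identity on the other wires even when these are entangled with its
    input. *)
Definition has_kernel k n m (Phi : operator -> operator) (K : kernel) :=
  forall rho a a' x y u u', size a = k -> size a' = k -> size x = m -> size y = m ->
    Phi rho (a ++ x ++ u) (a' ++ y ++ u') =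
    \sum_(x' <- bits n) \sum_(y' <- bits n)
      K x y x' y' * rho (a ++ x' ++ u) (a' ++ y' ++ u').

Definition trace_preserving n m (K : kernel) :=
  forall x' y', size x' = n -> size y' = n ->
    \sum_(x <- bits m) K x x x' y' = (x' == y')%:R.

(** One kernel serves all positions [k], so an operation can be moved to other wires by changing its
    position alone. *)
Definition channel n m (Phi : nat -> operator -> operator) :=
  exists2 K, trace_preserving n m K & forall k, has_kernel k n m (Phi k) K.

Lemma has_kernel_comp k n m p Phi Psi K L :
  has_kernel k n m Phi K -> has_kernel k m p Psi L ->
  has_kernel k n p (fun rho => Psi (Phi rho))
    (fun x y x' y' => \sum_(z <- bits m) \sum_(t <- bits m) L x y z t * K z t x' y').
Proof.
move=> hK hL rho a a' x y u u' sa sa' sx sy; rewrite hL //.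
under eq_sum_bits => z sz do under eq_sum_bits => t st do rewrite hK // mulr_sumr.
rewrite [RHS](eq_bigr (fun x' => \sum_(z <- bits m) \sum_(t <- bits m)
  L x y z t * (\sum_(y' <- bits n) K z t x' y' * rho (a ++ x' ++ u) (a' ++ y' ++ u')))).
  rewrite [RHS]exchange_big; apply: eq_bigr => z _.
  by rewrite [RHS]exchange_big.
move=> x' _; under eq_bigr do rewrite mulr_suml.
rewrite exchange_big; apply: eq_bigr => z _.
under eq_bigr do rewrite mulr_suml.
rewrite exchange_big; apply: eq_bigr => t _.
by rewrite mulr_sumr; apply: eq_bigr => y' _; rewrite mulrA.
Qed.

Lemma trace_preserving_comp n m p K L :
  trace_preserving n m K -> trace_preserving m p L ->
  trace_preserving n p
    (fun x y x' y' => \sum_(z <- bits m) \sum_(t <- bits m) L x y z t * K z t x' y').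
Proof.
move=> hK hL x' y' sx sy; rewrite exchange_big /=.
rewrite (eq_sum_bits (F2 := fun z => K z z x' y')); first exact: hK.
move=> z sz; rewrite exchange_big /=.
rewrite (eq_sum_bits (F2 := fun t => (z == t)%:R * K z t x' y')).
  by rewrite sum_bits_delta_sym.
by move=> t st; rewrite -mulr_suml hL.
Qed.

Lemma channel_comp n m p Phi Psi : channel n m Phi -> channel m p Psi ->
  channel n p (fun k rho => Psi k (Phi k rho)).
Proof.
move=> [K tK hK] [L tL hL].
exists (fun x y x' y' => \sum_(z <- bits m) \sum_(t <- bits m) L x y z t * K z t x' y').
  exact: trace_preserving_comp.
by move=> k; apply: has_kernel_comp.
Qed.

Lemma channel_id n : channel n n (fun _ rho => rho).
Proof.
exists (fun x y x' y' => (x == x')%:R * (y == y')%:R).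
  move=> x' y' sx sy; under eq_bigr do rewrite mulrC.
  rewrite (eq_bigr (fun x => (x == y')%:R * (x == x')%:R)) //.
  by rewrite sum_bits_delta // eq_sym.
move=> k rho a a' x y u u' sa sa' sx sy.
under eq_bigr do under eq_bigr do rewrite -mulrA.
under eq_bigr do rewrite -mulr_sumr.
by rewrite sum_bits_delta_sym // sum_bits_delta_sym.
Qed.

Lemma channel_ext n m Phi Psi : (forall k rho, Phi k rho = Psi k rho) ->
  channel n m Phi -> channel n m Psi.
Proof.
move=> eq_Phi [K tK hK]; exists K => // k rho; rewrite -eq_Phi; exact: hK.
Qed.

Lemma channel_embed i q n m Phi : channel n m Phi ->
  channel (i + (n + q)) (i + (m + q)) (fun k => Phi (k + i)%N).
Proof.
move=> [K tK hK].
(* The kernel of [Phi] tensored with the identity, given by Kronecker deltas on the [i] wires before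
   and the [q] wires after. *)
exists (fun x y x' y' =>
  (take i x == take i x')%:R * ((drop i (drop m x) == drop i (drop n x'))%:R *
  ((take i y == take i y')%:R * ((drop i (drop m y) == drop i (drop n y'))%:R *
    K (take m (drop i x)) (take m (drop i y)) (take n (drop i x')) (take n (drop i y')))))).
  move=> x' y' /size_cut3[px [zx [sx [-> hpx hzx hsx]]]].
  move=> /size_cut3[py [zy [sy [-> hpy hzy hsy]]]].
  rewrite sum_bits_cat; under eq_bigr do rewrite sum_bits_cat.
  rewrite (eq_sum_bits (F2 := fun p => (p == px)%:R * (\sum_(z <- bits m)
     \sum_(s <- bits q) (s == sx)%:R * ((p == py)%:R * ((s == sy)%:R * K z z zx zy))))).
    rewrite sum_bits_delta //.
    rewrite (eq_bigr (fun z => (px == py)%:R * ((sx == sy)%:R * K z z zx zy))).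
      rewrite -!mulr_sumr tK // !eqseq_cat ?hpx ?hzx //.
      by case: (px == py); case: (sx == sy); case: (zx == zy); rewrite ?mul1r ?mul0r.
    by move=> z _; rewrite sum_bits_delta.
  move=> p sp; rewrite mulr_sumr; apply: eq_sum_bits => z sz.
  rewrite mulr_sumr; apply: eq_sum_bits => s ss.
  by rewrite !take_size_cat // !drop_cut3 // !take_cut3.
move=> k rho a a' x y u u' sa sa' hx hy.
have [p [z [s [-> hp hz hs]]]] := size_cut3 hx.
have [p' [z' [s' [-> hp' hz' hs']]]] := size_cut3 hy.
have -> : a ++ (p ++ z ++ s) ++ u = (a ++ p) ++ z ++ (s ++ u) by rewrite -!catA.
have -> : a' ++ (p' ++ z' ++ s') ++ u' = (a' ++ p') ++ z' ++ (s' ++ u').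
  by rewrite -!catA.
rewrite hK ?size_cat ?sa ?sa' ?hp ?hp' //.
pose T p1 z1 s1 p2 z2 s2 := K z z' z1 z2 *
  rho (a ++ (p1 ++ z1 ++ s1) ++ u) (a' ++ (p2 ++ z2 ++ s2) ++ u').
rewrite sum_bits_cat [RHS](eq_sum_bits (F2 := fun p1 => (p == p1)%:R *
  \sum_(z1 <- bits n) \sum_(z2 <- bits n) T p1 z1 s p' z2 s')).
  rewrite sum_bits_delta_sym //; apply: eq_bigr => z1 _; apply: eq_bigr => z2 _.
  by rewrite /T -!catA.
move=> p1 hp1; rewrite sum_bits_cat mulr_sumr; apply: eq_sum_bits => z1 hz1.
rewrite (eq_sum_bits (F2 := fun s1 => (s == s1)%:R * ((p == p1)%:R *
  \sum_(z2 <- bits n) T p1 z1 s1 p' z2 s'))); first by rewrite sum_bits_delta_sym.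
move=> s1 hs1; rewrite sum_bits_cat (eq_sum_bits (F2 := fun p2 => (p' == p2)%:R *
  ((s == s1)%:R * ((p == p1)%:R * \sum_(z2 <- bits n) T p1 z1 s1 p2 z2 s')))).
  by rewrite sum_bits_delta_sym.
move=> p2 hp2; rewrite sum_bits_cat !mulr_sumr; apply: eq_sum_bits => z2 hz2.
rewrite (eq_sum_bits (F2 := fun s2 => (s' == s2)%:R * ((p' == p2)%:R *
  ((s == s1)%:R * ((p == p1)%:R * T p1 z1 s1 p2 z2 s2))))).
  by rewrite sum_bits_delta_sym.
move=> s2 hs2; rewrite !take_size_cat // !drop_cut3 // !take_cut3 // /T.
by ring.
Qed.

(** * Every gate is a channel *)

Lemma set_bit_cat3 k a x u i b : size a = k -> (i < size x)%N ->
  set_bit (a ++ x ++ u) (k + i) b = a ++ set_bit x i b ++ u.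
Proof.
move=> <-; elim: a => [|c a IH] lt_i /=; last by rewrite -IH.
by elim: x i lt_i => [|c x IH] [|i] //= lt_i; rewrite -IH.
Qed.

Lemma size_set_bit x i b : (i < size x)%N -> size (set_bit x i b) = size x.
Proof. by move=> lt_i; rewrite size_set_nth; apply/maxn_idPr. Qed.

Lemma nth_cat3 k a x u i : size a = k -> (i < size x)%N ->
  nth false (a ++ x ++ u) (k + i) = nth false x i.
Proof.
by move=> <- lt_i; rewrite nth_cat ltnNge leq_addr /= addKn nth_cat lt_i.
Qed.

Lemma nth_set_bit x i b j :
  nth false (set_bit x i b) j = if j == i then b else nth false x j.
Proof. exact: nth_set_nth. Qed.

Lemma channel_involution n (f : nat -> seq bool -> seq bool) :
  (forall k a x u, size a = k -> size x = n ->
     f k (a ++ x ++ u) = a ++ f 0 x ++ u) ->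
  (forall x, size x = n -> size (f 0 x) = n /\ f 0 (f 0 x) = x) ->
  channel n n (fun k => apply_involution (f k)).
Proof.
move=> f_loc f_inv; exists (fun x y x' y' => (x' == f 0 x)%:R * (y' == f 0 y)%:R).
  move=> x' y' sx sy.
  rewrite (eq_sum_bits (F2 := fun x => (x == f 0 x')%:R * (y' == f 0 x)%:R)).
    have [sz fK] := f_inv _ sx.
    by rewrite sum_bits_delta // fK eq_sym.
  move=> x hx; congr (_%:R * _); congr nat_of_bool; apply/eqP/eqP => [->|->].
    by have [_ ->] := f_inv _ hx.
  by have [_ ->] := f_inv _ sx.
move=> k rho a a' x y u u' sa sa' sx sy; rewrite /apply_involution !f_loc //.
under eq_bigr do under eq_bigr do rewrite -mulrA.
under eq_bigr do rewrite -mulr_sumr.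
have [fx _] := f_inv _ sx; have [fy _] := f_inv _ sy.
by rewrite sum_bits_delta // sum_bits_delta.
Qed.

Lemma channel_toffoli n i j l : uniq [:: i; j; l] ->
  (i < n)%N -> (j < n)%N -> (l < n)%N ->
  channel n n (fun k rho => apply_gate k rho (Toffoli i j l)).
Proof.
rewrite /= !inE negb_or andbT => /andP[/andP[ij il] jl] lt_i lt_j lt_l.
apply: (channel_involution (f := fun k x =>
  set_bit x (k + l) (nth false x (k + l) (+)
        (nth false x (k + i) && nth false x (k + j))))).
  by move=> k a x u sa sx; rewrite !nth_cat3 ?sx // set_bit_cat3 ?sx.
move=> x sx; have sz : size (set_bit x l
    (nth false x l (+) (nth false x i && nth false x j))) = n.
  by rewrite size_set_bit sx.
split=> //; apply: (@eq_from_nth _ false); rewrite !add0n ?size_set_bit ?sx ?sz //.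
move=> q _; rewrite !nth_set_bit (negbTE il) (negbTE jl) eqxx.
by case: eqP => [->|//]; rewrite -addbA addbb addbF.
Qed.

Lemma channel_swap n i j : (i < n)%N -> (j < n)%N ->
  channel n n (fun k rho => apply_gate k rho (Swap i j)).
Proof.
move=> lt_i lt_j; apply: (channel_involution (f := fun k x =>
  set_bit (set_bit x (k + i) (nth false x (k + j))) (k + j) (nth false x (k + i)))).
  move=> k a x u sa sx; rewrite !nth_cat3 ?sx // set_bit_cat3 ?sx //.
  by rewrite set_bit_cat3 ?size_set_bit ?sx.
move=> x sx; rewrite !add0n.
have sz b c : size (set_bit (set_bit x i b) j c) = n.
  by rewrite !size_set_bit ?sx.
split=> //; apply: (@eq_from_nth _ false); rewrite !size_set_bit ?sz ?sx //.
move=> q _; rewrite !nth_set_bit !eqxx.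
case: (eqVneq q j) => [->|_]; first by case: (eqVneq i j) => [->|].
by case: (eqVneq q i) => [->|].
Qed.

Lemma channel_unitary1 (U : bool -> bool -> R[i]) :
  (forall b c, \sum_(d : bool) U d b * (U d c)^* = (b == c)%:R) ->
  channel 1 1 (fun k => apply_unitary1 U k).
Proof.
move=> U_unit; pose K x y x' y' : R[i] :=
  U (nth false x 0) (nth false x' 0) * (U (nth false y 0) (nth false y' 0))^*.
exists K.
  move=> [|b []] // [|c []] // _ _; rewrite sum_bits1 /K /= U_unit.
  by rewrite eqseq_cons andbT.
move=> k rho a a' [|b []] // [|c []] // u u' sa sa' _ _.
rewrite sum_bits1 /apply_unitary1; apply: eq_bigr => d _.
rewrite sum_bits1; apply: eq_bigr => e _; rewrite /K /=.
have := nth_cat3 (i := 0) (x := [:: b]) u sa isT; rewrite addn0 /= => ->.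
have := nth_cat3 (i := 0) (x := [:: c]) u' sa' isT; rewrite addn0 /= => ->.
have := set_bit_cat3 (i := 0) (x := [:: b]) u d sa isT; rewrite addn0 /= => ->.
have := set_bit_cat3 (i := 0) (x := [:: c]) u' e sa' isT; rewrite addn0 /= => ->.
by rewrite mulrAC.
Qed.

Lemma insert_basis_cat k s rho a a' x y u u' : size a = k -> size a' = k ->
  size x = size s -> size y = size s ->
  insert_basis k s rho (a ++ x ++ u) (a' ++ y ++ u') =
  ((x == s) && (y == s))%:R * rho (a ++ u) (a' ++ u').
Proof.
move=> sa sa' sx sy.
have cut (b z v : seq bool) : size b = k -> size z = size s ->
    [/\ take (size s) (drop k (b ++ z ++ v)) = z, take k (b ++ z ++ v) = b
      & drop (k + size s) (b ++ z ++ v) = v].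
  move=> sb sz; rewrite drop_size_cat // !take_size_cat //.
  by rewrite catA drop_size_cat ?size_cat ?sb ?sz.
have [h1 h2 h3] := cut _ _ u sa sx;
have [h1' h2' h3'] := cut _ _ u' sa' sy.
by rewrite /insert_basis h1 h2 h3 h1' h2' h3'.
Qed.

Lemma trace_out_cat k n rho a a' u u' : size a = k -> size a' = k ->
  trace_out k n rho (a ++ u) (a' ++ u') =
  \sum_(w <- bits n) rho (a ++ w ++ u) (a' ++ w ++ u').
Proof.
move=> <- sa'; rewrite /trace_out -sum_tuple_bits; apply: eq_bigr => w _.
by rewrite take_size_cat // drop_size_cat // -sa' take_size_cat // drop_size_cat.
Qed.

Lemma channel_insert_basis s : channel 0 (size s) (fun k => insert_basis k s).
Proof.
exists (fun x y _ _ => (x == s)%:R * (y == s)%:R).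
  by move=> [] // [] // _ _; rewrite sum_bits_delta // eqxx.
move=> k rho a a' x y u u' sa sa' sx sy; rewrite insert_basis_cat // !sum_bits0.
by rewrite -natrM mulnb.
Qed.

Lemma channel_trace_out n : channel n 0 (fun k => trace_out k n).
Proof.
exists (fun _ _ x' y' => (x' == y')%:R).
  by move=> x' y' _ _; rewrite sum_bits0.
move=> k rho a a' [] // [] // u u' sa sa' _ _; rewrite trace_out_cat //.
by apply: eq_sum_bits => w sw; rewrite sum_bits_delta_sym.
Qed.

Lemma channel_wire i n (m q : nat) Phi : channel n m Phi -> (i + n <= q)%N ->
  channel q (q - n + m) (fun k => Phi (k + i)%N).
Proof.
move=> /(channel_embed i (q - (i + n))); set p := (q - _)%N => ch le_q.
have -> : q = (i + (n + p))%N by rewrite /p; lia.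
by have -> : (i + (n + p) - n + m = i + (m + p))%N by lia.
Qed.

Lemma hadamard_mxE b c :
  hadamard_mx R b c = ((-1) ^+ (b && c) / Num.sqrt 2)%:C.
Proof.
rewrite /hadamard_mx; case: (b && c); rewrite ?expr0 ?expr1 ?mulN1r ?mul1r.
  by rewrite rmorphN fmorphV.
by rewrite fmorphV.
Qed.

Lemma sqrt2_sq : Num.sqrt (2 : R) * Num.sqrt 2 = 2.
Proof. by rewrite -expr2 sqr_sqrtr. Qed.

Lemma conjE (z : R[i]) : Num.conj z = conjc z.
Proof. by []. Qed.

Lemma hadamard_unit (b c : bool) :
  \sum_(d : bool) hadamard_mx R d b * (hadamard_mx R d c)^* = (b == c)%:R.
Proof.
have s2 : (Num.sqrt (2 : R))^-1 * (Num.sqrt 2)^-1 = 2^-1.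
  by rewrite -invfM sqrt2_sq.
rewrite big_bool !hadamard_mxE !conjE !conjc_real.
move: (Num.sqrt _)^-1 s2 => s s2; apply/eqP; rewrite eq_complex.
by case: b; case: c; rewrite /= ?expr0 ?expr1; apply/andP; split; apply/eqP; lra.
Qed.

Lemma phase_unit (b c : bool) :
  \sum_(d : bool) phase_mx R d b * (phase_mx R d c)^* = (b == c)%:R.
Proof.
rewrite big_bool /phase_mx !conjE; apply/eqP; rewrite eq_complex.
by case: b; case: c; rewrite /= ?mul0r ?mulr0 /=; apply/andP; split; apply/eqP; ring.
Qed.

Lemma channel_gate n m g : gate_arity n g = Some m ->
  channel n m (fun k rho => apply_gate k rho g).
Proof.
case: g => [i j l|i|i|i j|i|i] /=.
- by case: ifP => // /and4P[un lt_i lt_j lt_l] [<-]; apply: channel_toffoli.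
- case: ifP => // lt_i [<-]; have := channel_wire (i := i) (q := n)
    (channel_unitary1 hadamard_unit); rewrite addn1 subnK //; first exact.
  exact: leq_ltn_trans lt_i.
- case: ifP => // lt_i [<-]; have := channel_wire (i := i) (q := n)
    (channel_unitary1 phase_unit); rewrite addn1 subnK //; first exact.
  exact: leq_ltn_trans lt_i.
- by case: ifP => // /andP[lt_i lt_j] [<-]; apply: channel_swap.
- case: ifP => // le_i [<-]; have := channel_wire (i := i) (q := n)
    (channel_insert_basis [:: false]); rewrite addn0 subn0 addn1; exact.
- case: ifP => // lt_i [<-]; have := channel_wire (i := i) (q := n)
    (channel_trace_out 1); rewrite addn1 addn0 subn1; exact.
Qed.

End Channels.

(** * Gadgets *)

Lemma gates_arity_cons n g s :
  gates_arity n (g :: s) = obind (gates_arity^~ s) (gate_arity n g).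
Proof.
rewrite /gates_arity /=; case: (gate_arity n g) => //=.
by elim: s => //= a s ->.
Qed.

Lemma gates_arity_cat n m p s1 s2 : gates_arity n s1 = Some m ->
  gates_arity m s2 = Some p -> gates_arity n (s1 ++ s2) = Some p.
Proof. by rewrite /gates_arity foldl_cat => ->. Qed.

Lemma gates_arity_Anc n k j : (k <= n)%N ->
  gates_arity n (nseq j (Anc k)) = Some (n + j)%N.
Proof.
elim: j n => [|j IH] n le_k; first by rewrite addn0.
by rewrite gates_arity_cons /= le_k /= IH ?addnS //; apply: leqW.
Qed.

Lemma gates_arity_Erase n k j : (k <= n)%N ->
  gates_arity (n + j) (nseq j (Erase k)) = Some n.
Proof.
elim: j => [|j IH] le_k; first by rewrite addn0.
by rewrite gates_arity_cons /= addnS ltnS (leq_trans le_k) ?leq_addr //= IH.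
Qed.

Lemma gates_arity_nseq n j s : gates_arity n s = Some n ->
  gates_arity n (flatten (nseq j s)) = Some n.
Proof.
by move=> h; elim: j => //= j IH; apply: gates_arity_cat IH.
Qed.

Section Gates.
Variable R : realType.
Local Notation operator := (operator R).
Implicit Types (rho : operator) (a x y u : seq bool).

Definition run k (gs : seq gate) rho : operator := foldl (apply_gate k) rho gs.

Arguments run : simpl never.

Lemma run_cat k s1 s2 rho : run k (s1 ++ s2) rho = run k s2 (run k s1 rho).
Proof. exact: foldl_cat. Qed.

Lemma channel_run n m gs : gates_arity n gs = Some m ->
  channel n m (fun k (rho : operator) => run k gs rho).
Proof.
elim: gs n => [|g gs IH] n; first by move=> [<-]; apply: channel_id.
rewrite gates_arity_cons; case ar_g: (gate_arity n g) => [p|] //= /IH.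
exact: channel_comp (channel_gate R ar_g).
Qed.

(** Only entries at strings of the right length carry meaning, so this is the equality of states on
    [n] wires. *)
Definition eqop n (rho sigma : operator) :=
  forall x y, size x = n -> size y = n -> rho x y = sigma x y.

Lemma channel_eqop n m Phi rho sigma : channel n m Phi -> eqop n rho sigma ->
  eqop m (Phi 0 rho) (Phi 0 sigma).
Proof.
move=> [K _ hK] eq_rs x y sx sy.
rewrite -[x]cats0 -[y]cats0 -[x ++ _]cat0s -[y ++ _]cat0s !(hK 0) //.
apply: eq_sum_bits => x' sx'; apply: eq_sum_bits => y' sy'.
by rewrite !cats0 eq_rs.
Qed.

Lemma run_Erase k n rho a a' u u' : size a = k -> size a' = k ->
  run 0 (nseq n (Erase k)) rho (a ++ u) (a' ++ u') =
  \sum_(w <- bits n) rho (a ++ w ++ u) (a' ++ w ++ u').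
Proof.
move=> sa sa'; elim: n rho => [|n IH] rho; first by rewrite sum_bits0.
rewrite [LHS]IH -[n.+1]add1n sum_bits_cat [RHS]exchange_big /= add0n.
apply: eq_sum_bits => w _; rewrite trace_out_cat //.
by apply: eq_bigr => b _; rewrite -!catA.
Qed.

Lemma run_Anc k n rho a a' x y u u' : size a = k -> size a' = k ->
  size x = n -> size y = n ->
  run 0 (nseq n (Anc k)) rho (a ++ x ++ u) (a' ++ y ++ u') =
  ((x == nseq n false) && (y == nseq n false))%:R * rho (a ++ u) (a' ++ u').
Proof.
move=> sa sa'; elim: n x y rho => [|n IH] [|b x] [|d y] rho // => [_ _|[sx] [sy]].
  by rewrite mul1r.
have -> : nseq n.+1 (Anc k) = nseq n (Anc k) ++ [:: Anc k].
  by rewrite -[n.+1]addn1 nseqD.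
rewrite run_cat {1}/run /= add0n.
have := insert_basis_cat (s := [:: false]) (x := [:: b]) (y := [:: d])
  (run 0 (nseq n (Anc k)) rho) (x ++ u) (y ++ u') sa sa' erefl erefl.
rewrite /= => ->; rewrite IH // mulrA -natrM mulnb !eqseq_cons !andbT.
by congr (_ * _); congr (nat_of_bool _)%:R; rewrite -!andbA; do !bool_congr.
Qed.

(* A wire moves by a swap with a fresh ancilla, whose place is then erased:   *)
(* [pull r] brings wire [r] to the front and [push r] is its inverse.         *)
Definition pull r := [:: Anc 0; Swap 0 r.+1; Erase r.+1].
Definition push r := [:: Anc r.+1; Swap 0 r.+1; Erase 0].

Lemma gates_arity_pull n r : (r < n)%N -> gates_arity n (pull r) = Some n.
Proof. by move=> lt_r; rewrite /gates_arity /= !ltnS lt_r /= ltnS lt_r. Qed.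

Lemma gates_arity_push n r : (r < n)%N -> gates_arity n (push r) = Some n.
Proof. by move=> lt_r; rewrite /gates_arity /= lt_r /= ltnS lt_r. Qed.

Lemma apply_swap0 r rho b b' d d' a a' u u' : size a = r -> size a' = r ->
  apply_gate 0 rho (Swap 0 r.+1) (b :: a ++ d :: u) (b' :: a' ++ d' :: u') =
  rho (d :: a ++ b :: u) (d' :: a' ++ b' :: u').
Proof.
have swapE (e f : bool) (z w : seq bool) : size z = r ->
    set_bit (set_bit (e :: z ++ f :: w) 0 (nth false (e :: z ++ f :: w) r.+1))
      r.+1 (nth false (e :: z ++ f :: w) 0) = f :: z ++ e :: w.
  move=> <-; rewrite /= nth_cat ltnn subnn /= /set_bit /=; congr (_ :: _).
  by elim: z => //= g z ->.
by move=> sa sa'; rewrite /apply_gate /apply_involution !add0n !swapE.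
Qed.

Lemma apply_anc k rho a a' (b b' : bool) u u' : size a = k -> size a' = k ->
  apply_gate 0 rho (Anc k) (a ++ b :: u) (a' ++ b' :: u') =
  (~~ b && ~~ b')%:R * rho (a ++ u) (a' ++ u').
Proof.
move=> sa sa'; rewrite /apply_gate add0n.
rewrite -[b :: u]cat1s -[b' :: u']cat1s insert_basis_cat //.
by rewrite !eqseq_cons !andbT !eqbF_neg.
Qed.

Lemma apply_erase k rho a a' u u' : size a = k -> size a' = k ->
  apply_gate 0 rho (Erase k) (a ++ u) (a' ++ u') =
  \sum_(b : bool) rho (a ++ b :: u) (a' ++ b :: u').
Proof.
by move=> sa sa'; rewrite /apply_gate add0n trace_out_cat // sum_bits1.
Qed.

Lemma run_pull r rho b b' a a' u u' : size a = r -> size a' = r ->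
  run 0 (pull r) rho (b :: a ++ u) (b' :: a' ++ u') =
  rho (a ++ b :: u) (a' ++ b' :: u').
Proof.
move=> sa sa'; set rho1 := apply_gate 0 rho (Anc 0).
rewrite -[LHS]/(apply_gate 0 (apply_gate 0 rho1 (Swap 0 r.+1)) (Erase r.+1)
  ((b :: a) ++ u) ((b' :: a') ++ u')).
rewrite (@apply_erase _ _ (b :: a) (b' :: a')) ?[size _]/= ?sa ?sa' //.
rewrite (eq_bigr (fun w => rho1 (w :: a ++ b :: u) (w :: a' ++ b' :: u'))).
  rewrite big_bool /rho1.
  have ancE w := @apply_anc 0 rho [::] [::] w w (a ++ b :: u) (a' ++ b' :: u') erefl erefl.
  rewrite (ancE true) (ancE false).
  by rewrite /= mul0r mul1r add0r.
by move=> w _; rewrite apply_swap0.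
Qed.

Lemma run_push r rho b b' a a' u u' : size a = r -> size a' = r ->
  run 0 (push r) rho (a ++ b :: u) (a' ++ b' :: u') =
  rho (b :: a ++ u) (b' :: a' ++ u').
Proof.
move=> sa sa'; set rho1 := apply_gate 0 rho (Anc r.+1).
rewrite -[LHS]/(apply_gate 0 (apply_gate 0 rho1 (Swap 0 r.+1)) (Erase 0)
  ([::] ++ a ++ b :: u) ([::] ++ a' ++ b' :: u')).
rewrite (@apply_erase _ _ [::] [::]) //.
rewrite (eq_bigr (fun w => rho1 (b :: a ++ w :: u) (b' :: a' ++ w :: u'))).
  have ancE w : rho1 (b :: a ++ w :: u) (b' :: a' ++ w :: u') =
      (~~ w && ~~ w)%:R * rho (b :: a ++ u) (b' :: a' ++ u').
    by apply: (@apply_anc _ _ (b :: a) (b' :: a')); rewrite /= ?sa ?sa'.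
  rewrite big_bool !ancE.
  by rewrite /= mul0r mul1r add0r.
by move=> w _; rewrite apply_swap0.
Qed.

(** Each pull takes the current wire [r] and shifts the wires before it by one place. Repeating it
    brings the block that ends at wire [r] to the front, last wire first, so its order is
    preserved. *)
Lemma run_pulls r j rho x y a a' u u' : size x = j -> size y = j ->
  (j + size a)%N = r.+1 -> (j + size a')%N = r.+1 ->
  run 0 (flatten (nseq j (pull r))) rho (x ++ a ++ u) (y ++ a' ++ u') =
  rho (a ++ x ++ u) (a' ++ y ++ u').
Proof.
elim: j x y a a' u u' rho => [|j IH] [|b x] [|b' y] a a' u u' rho //.
move=> [sx] [sy] sa sa'.
have -> : flatten (nseq j.+1 (pull r)) = flatten (nseq j (pull r)) ++ pull r.
  by rewrite -[j.+1]addn1 nseqD flatten_cat.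
rewrite run_cat !cat_cons (catA x) (catA y) run_pull ?size_cat; try lia.
rewrite -!catA -[b :: u]cat1s -[b' :: u']cat1s (catA a) (catA a').
rewrite IH ?size_cat //=; try lia.
by rewrite -!catA.
Qed.

Lemma run_pushes r j rho x y a a' u u' : size x = j -> size y = j ->
  (j + size a)%N = r.+1 -> (j + size a')%N = r.+1 ->
  run 0 (flatten (nseq j (push r))) rho (a ++ x ++ u) (a' ++ y ++ u') =
  rho (x ++ a ++ u) (y ++ a' ++ u').
Proof.
elim: j x y a a' u u' rho => [|j IH] x y a a' u u' rho.
  by move=> /size0nil-> /size0nil->.
case/lastP: x => // x b; case/lastP: y => // y b'.
rewrite !size_rcons => -[sx] [sy] sa sa'.
have -> : flatten (nseq j.+1 (push r)) = flatten (nseq j (push r)) ++ push r.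
  by rewrite -[j.+1]addn1 nseqD flatten_cat.
rewrite run_cat !cat_rcons (catA a) (catA a') run_push ?size_cat; try lia.
rewrite -!catA -!cat_cons IH //=; lia.
Qed.

(** The Fredkin gate: three CNOT gates of alternating direction swap two wires, and here each of
    them is also controlled by [T]. *)
Definition controlled_swap T i j := [:: Toffoli T i j; Toffoli T j i; Toffoli T i j].

Definition cnot_bits T i j (z : seq bool) :=
  set_bit z j (nth false z j (+) (nth false z T && nth false z i)).

Definition controlled_swap_bits T i j z :=
  cnot_bits T i j (cnot_bits T j i (cnot_bits T i j z)).

Lemma run_controlled_swap T i j rho z z' :
  run 0 (controlled_swap T i j) rho z z' =
  rho (controlled_swap_bits T i j z) (controlled_swap_bits T i j z').
Proof. by []. Qed.

Lemma nth_controlled_swap T i j z r : T != i -> T != j -> i != j ->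
  nth false (controlled_swap_bits T i j z) r =
  nth false z (if nth false z T then if r == i then j else if r == j then i else r
               else r).
Proof.
move=> Ti Tj ij; have ji : j != i by rewrite eq_sym.
rewrite /controlled_swap_bits /cnot_bits !nth_set_bit !eqxx.
rewrite ?(negbTE Ti) ?(negbTE Tj) ?(negbTE ij) ?(negbTE ji).
case: (nth false z T) => /=; last first.
  rewrite !addbF; case: (eqVneq r j) => [->|_] //.
  by case: (eqVneq r i) => [->|].
case: (eqVneq r j) => [->|_]; first rewrite ?(negbTE ji).
  by case: (nth false z i); case: (nth false z j).
case: (eqVneq r i) => [_|//].
by case: (nth false z i); case: (nth false z j).
Qed.

Lemma size_controlled_swap T i j z : (i < size z)%N -> (j < size z)%N ->
  size (controlled_swap_bits T i j z) = size z.
Proof.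
move=> lt_i lt_j.
by rewrite /controlled_swap_bits /cnot_bits !size_set_bit.
Qed.

(* Swaps wires [p], ..., [p + n - 1] with wires [q], ..., [q + n - 1] when    *)
(* wire [T] is set.                                                           *)
Definition block_swap T p q n :=
  flatten [seq controlled_swap T (p + i) (q + i) | i <- iota 0 n].

Lemma block_swapS T p q n :
  block_swap T p q n.+1 = block_swap T p q n ++ controlled_swap T (p + n) (q + n).
Proof.
by rewrite /block_swap -[n.+1]addn1 iotaD map_cat flatten_cat.
Qed.

(** A description bit by bit is the form that passes through the induction on [n]; [run_block_swap]
    turns it into an exchange of substrings. The control must lie outside both blocks in order to
    keep its value throughout. *)
Lemma block_swap_bits T p q n : (p + n <= q)%N ->
  (forall i, (i < n)%N -> (T != p + i)%N && (T != q + i)%N) ->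
  exists2 F : seq bool -> seq bool,
    forall rho z z', run 0 (block_swap T p q n) rho z z' = rho (F z) (F z') &
    forall z, (q + n <= size z)%N -> size (F z) = size z /\
      forall r, nth false (F z) r = nth false z
        (if nth false z T then
           if (p <= r < p + n)%N then q + (r - p)
           else if (q <= r < q + n)%N then p + (r - q) else r
         else r)%N.
Proof.
elim: n => [|n IH] le_q neq_T.
  exists id => // z _; split=> // r; rewrite !addn0.
  by case: ifP => // _; case: ifP => [|_]; [lia | case: ifP => //; lia].
have [||F runF hF] := IH; [lia | by move=> i lt_i; apply: neq_T; lia |].
exists (fun z => F (controlled_swap_bits T (p + n) (q + n) z)).
  by move=> rho z z'; rewrite block_swapS run_cat run_controlled_swap runF.
move=> z sz; have /andP[Tp Tq] := neq_T n (ltnSn n).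
have pq : (p + n != q + n)%N by lia.
have sf : size (controlled_swap_bits T (p + n) (q + n) z) = size z.
  by rewrite size_controlled_swap //; lia.
have [|sF nthF] := hF (controlled_swap_bits T (p + n) (q + n) z); first by lia.
split=> [|r]; first by rewrite sF.
rewrite nthF !nth_controlled_swap // (negbTE Tp) (negbTE Tq) if_same.
case: (nth false z T) => //; congr nth.
by clear -le_q; case: (boolP (p <= r < p + n)%N) => ?;
  case: (boolP (q <= r < q + n)%N) => ?; repeat (case: ifP => ?); lia.
Qed.

Lemma nth_cat5 (a x d y e : seq bool) r :
  nth false (a ++ x ++ d ++ y ++ e) r =
  (if r < size a then nth false a r
   else if r < size a + size x then nth false x (r - size a)
   else if r < size a + size x + size d then nth false d (r - size a - size x)
   else if r < size a + size x + size d + size y then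
     nth false y (r - size a - size x - size d)
   else nth false e (r - size a - size x - size d - size y))%N.
Proof.
rewrite !nth_cat; case: ltnP => // h1.
have -> : (r - size a < size x)%N = (r < size a + size x)%N by lia.
case: ltnP => // h2.
have -> : (r - size a - size x < size d)%N = (r < size a + size x + size d)%N by lia.
case: ltnP => // h3.
by have -> : (r - size a - size x - size d < size y)%N =
  (r < size a + size x + size d + size y)%N by lia.
Qed.

Lemma run_block_swap T p q n : (p + n <= q)%N ->
  (T < p)%N || (p + n <= T < q)%N || (q + n <= T)%N ->
  exists2 F : seq bool -> seq bool,
    forall rho z z', run 0 (block_swap T p q n) rho z z' = rho (F z) (F z') &
    forall a x d y e, size a = p -> size x = n -> size y = n ->
      (p + n + size d)%N = q ->
      F (a ++ x ++ d ++ y ++ e) =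
        if nth false (a ++ x ++ d ++ y ++ e) T then a ++ y ++ d ++ x ++ e
        else a ++ x ++ d ++ y ++ e.
Proof.
move=> le_q neq_T; have [|F runF hF] := @block_swap_bits T p q n le_q.
  by move=> i lt_i; move: neq_T; lia.
exists F => // a x d y e sa sx sy sd.
have [|sF nthF] := hF (a ++ x ++ d ++ y ++ e); first by rewrite !size_cat; lia.
apply: (@eq_from_nth _ false).
  by rewrite sF; case: ifP => // _; rewrite !size_cat; lia.
move=> r _; rewrite nthF; case: ifP => // _; rewrite !nth_cat5 sa sx sy.
clear -sa sx sy sd le_q; case: (boolP (p <= r < p + n)%N) => ?;
  case: (boolP (q <= r < q + n)%N) => ?;
  repeat (case: ifP => ?); first [lia | by congr nth; lia].
Qed.

(* A control wire in state H|0> is added at the end of blocks of [n], [n] and *)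
(* [e] wires; if it is set, then the first block is replaced with the second  *)
(* one, which becomes |0>.                                                    *)
Definition sel n e :=
  let T := (n + n + e)%N in
  [:: Anc T; Hadamard T] ++ nseq n (Anc T.+1) ++ block_swap T 0 n n ++
  block_swap T n T.+1 n ++ nseq n (Erase T.+1).

(** Meant for the ciphertexts: the same control wire puts the halves exchanged by [sel] back in
    place, and erasing it sums over its two values. *)
Definition unsel n e :=
  let T := (n + n + e)%N in rcons (block_swap T 0 n n) (Erase T).

Lemma nth_control n e (z1 z2 v : seq bool) w y :
  size z1 = n -> size z2 = n -> size v = e ->
  nth false (z1 ++ z2 ++ v ++ w :: y) (n + n + e) = w.
Proof.
move=> s1 s2 sv; rewrite !catA nth_cat !size_cat s1 s2 sv.
by rewrite ltnn subnn.
Qed.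

Lemma run_unsel n e rho x1 x2 y1 y2 u u' :
  size x1 = n -> size x2 = n -> size y1 = n -> size y2 = n ->
  size u = e -> size u' = e ->
  run 0 (unsel n e) rho (x1 ++ x2 ++ u) (y1 ++ y2 ++ u') =
  rho (x1 ++ x2 ++ u ++ [:: false]) (y1 ++ y2 ++ u' ++ [:: false]) +
  rho (x2 ++ x1 ++ u ++ [:: true]) (y2 ++ y1 ++ u' ++ [:: true]).
Proof.
move=> sx1 sx2 sy1 sy2 su su'; rewrite /unsel -cats1 run_cat.
have [||F runF hF] := @run_block_swap (n + n + e) 0 n n; try lia.
have FE z1 z2 v w : size z1 = n -> size z2 = n -> size v = e ->
    F (z1 ++ z2 ++ v ++ [:: w]) = if w then z2 ++ z1 ++ v ++ [:: w] else
      z1 ++ z2 ++ v ++ [:: w].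
  move=> s1 s2 sv; have := hF [::] z1 [::] z2 (v ++ [:: w]) erefl s1 s2 (addn0 _).
  by rewrite !cat0s => ->; rewrite nth_control.
rewrite -[x1 ++ _]cats0 -[y1 ++ _]cats0.
have := @run_Erase (n + n + e) 1 (run 0 (block_swap (n + n + e) 0 n n) rho)
  (x1 ++ x2 ++ u) (y1 ++ y2 ++ u') [::] [::].
rewrite [nseq 1 _]/= => ->; rewrite ?size_cat; try lia.
by rewrite sum_bits1 big_bool /= -!catA !runF !FE // addrC.
Qed.

Lemma hadamard0 b : hadamard_mx R b false * (hadamard_mx R b false)^* = (2^-1)%:C.
Proof.
rewrite !hadamard_mxE andbF expr0 mul1r conjE conjc_real -(rmorphM (real_complex R)).
by rewrite /= -invfM sqrt2_sq.
Qed.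

(* Only the blocks that are diagonal in the control wire are described; the   *)
(* control wire is eventually erased.                                         *)
Lemma run_sel n e rho x1 x2 y1 y2 u u' w :
  size x1 = n -> size x2 = n -> size y1 = n -> size y2 = n ->
  size u = e -> size u' = e ->
  run 0 (sel n e) rho (x1 ++ x2 ++ u ++ [:: w]) (y1 ++ y2 ++ u' ++ [:: w]) =
  (2^-1)%:C * (if w then ((x2 == nseq n false) && (y2 == nseq n false))%:R *
       \sum_(v <- bits n) rho (v ++ x1 ++ u) (v ++ y1 ++ u')
     else rho (x1 ++ x2 ++ u) (y1 ++ y2 ++ u')).
Proof.
move=> sx1 sx2 sy1 sy2 su su'; rewrite /sel !run_cat; set T := (n + n + e)%N.
set rho1 := run 0 [:: _; _] rho; set rho2 := run 0 (nseq n (Anc _)) rho1.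
have [||F runF hF] := @run_block_swap T 0 n n; try lia.
have [||F' runF' hF'] := @run_block_swap T n T.+1 n; try lia.
have FE z1 z2 v y : size z1 = n -> size z2 = n -> size v = e ->
    F (z1 ++ z2 ++ v ++ w :: y) = if w then z2 ++ z1 ++ v ++ w :: y else
      z1 ++ z2 ++ v ++ w :: y.
  move=> s1 s2 sv; have := hF [::] z1 [::] z2 (v ++ w :: y) erefl s1 s2 (addn0 _).
  by rewrite !cat0s => ->; rewrite nth_control.
have F'E z1 z2 v y : size z1 = n -> size z2 = n -> size v = e -> size y = n ->
    F' (z1 ++ z2 ++ v ++ w :: y) = if w then z1 ++ y ++ v ++ w :: z2 else
      z1 ++ z2 ++ v ++ w :: y.
  move=> s1 s2 sv sy; have := hF' z1 z2 (v ++ [:: w]) y [::] s1 s2 sy.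
  rewrite !cats0 -!catA => ->; first by rewrite nth_control.
  by rewrite size_cat sv addn1 -addnS.
have rho1E z z' : size z = T -> size z' = T ->
    rho1 (z ++ [:: w]) (z' ++ [:: w]) = (2^-1)%:C * rho z z'.
  move=> sz sz'; rewrite -[LHS]/(apply_unitary1 (@hadamard_mx R) (0 + T)
    (apply_gate 0 rho (Anc T)) (z ++ [:: w]) (z' ++ [:: w])) add0n /apply_unitary1.
  have nthE (x : seq bool) : size x = T -> nth false (x ++ [:: w]) T = w.
    by move=> <-; rewrite nth_cat ltnn subnn.
  have setE (x : seq bool) b : size x = T -> set_bit (x ++ [:: w]) T b = x ++ [:: b].
    by move=> <-; rewrite /set_bit; elim: x => //= c x ->.
  rewrite !big_bool !nthE // !setE // !apply_anc // !cats0 /=.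
  by rewrite !mul0r !mulr0 !mul0r !add0r mul1r mulrAC hadamard0.
have rho2E z1 z2 z1' z2' v v' y y' : size z1 = n -> size z2 = n ->
    size z1' = n -> size z2' = n -> size v = e -> size v' = e ->
    size y = n -> size y' = n ->
    rho2 (z1 ++ z2 ++ v ++ w :: y) (z1' ++ z2' ++ v' ++ w :: y') =
    ((y == nseq n false) && (y' == nseq n false))%:R *
    ((2^-1)%:C * rho (z1 ++ z2 ++ v) (z1' ++ z2' ++ v')).
  move=> s1 s2 s1' s2' sv sv' sy sy'.
  have := @run_Anc T.+1 n rho1 (z1 ++ z2 ++ v ++ [:: w]) (z1' ++ z2' ++ v' ++ [:: w])
    y y' [::] [::].
  rewrite !cats0 -!catA /= -/rho2 => ->; rewrite ?size_cat /= ?size_cat /=;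
    try (rewrite /T; lia).
  congr (_ * _); rewrite !catA rho1E // !size_cat /T; lia.
have := @run_Erase T.+1 n (run 0 (block_swap T n T.+1 n) (run 0 (block_swap T 0 n n) rho2))
  (x1 ++ x2 ++ u ++ [:: w]) (y1 ++ y2 ++ u' ++ [:: w]) [::] [::].
rewrite !cats0 => ->; rewrite ?size_cat /= ?size_cat /=; try (rewrite /T; lia).
(* When the control is set, the erased block holds the old first half, whence the sum over [v].
   Otherwise it is still in state |0> and the sum has one nonzero term. *)
case: w FE F'E rho1E rho2E => FE F'E _ rho2E.
  rewrite mulr_sumr mulr_sumr; apply: eq_sum_bits => v sv.
  by rewrite !cats0 -!catA /= runF' !F'E // runF !FE // rho2E // mulrCA.
rewrite (eq_sum_bits (F2 := fun v => (v == nseq n false)%:R *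
  ((2^-1)%:C * rho (x1 ++ x2 ++ u) (y1 ++ y2 ++ u')))).
  by rewrite sum_bits_delta ?size_nseq.
move=> v sv; rewrite !cats0 -!catA /= runF' !F'E // runF !FE //.
by rewrite rho2E // andbb.
Qed.

End Gates.

(** * Adversaries as lists of circuits, and the hybrid argument *)

(** Sequential composition of two oracle computations. No oracle call separates the last circuit of
    [l1] from the first one of [l2], so their gates are joined into one circuit. *)
Fixpoint glue (l1 l2 : seq (seq gate)) : seq (seq gate) :=
  if l1 is g :: s then
    if s is [::] then
      if l2 is h :: t then (g ++ h) :: t else [:: g]
    else g :: glue s l2
  else l2.

Section Wiring.
Variables (S : qhe) (k W : nat).
Local Notation m := (msg_len S k).
Local Notation c := (ct_len S k).

(* [n] wires in, [q] wires out, and [W] private wires at each oracle call.    *)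
Fixpoint chain n (gs : seq (seq gate)) q : Prop :=
  if gs is g :: s then
    if s is [::] then gates_arity n g = Some q
    else gates_arity n g = Some (m + W)%N /\ chain (c + W)%N s q
  else False.

Lemma chain_glue n p q l1 l2 : chain n l1 p -> chain p l2 q -> chain n (glue l1 l2) q.
Proof.
elim: l1 n => [|g [|h s] IH] n //.
  case: l2 {IH} => // h [|h' t] /= hg; first exact: gates_arity_cat.
  by move=> [hh ht]; split=> //; apply: gates_arity_cat hh.
move=> [hg hs] h2; have := IH _ hs h2; rewrite [glue (g :: _) _]/= -/(glue (h :: s) l2).
by case: (glue _ _) => //.
Qed.

Fixpoint chains n (ps : seq (seq (seq gate))) q : Prop :=
  if ps is l :: ps' then exists2 p, chain n l p & chains p ps' q else n = q.

Definition glues := foldl glue [:: [::]].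

Lemma chains_cat n p q ps1 ps2 : chains n ps1 p -> chains p ps2 q ->
  chains n (ps1 ++ ps2) q.
Proof.
elim: ps1 n => [|l ps1 IH] n /=; first by move=> ->.
by move=> [r hl /IH h] /h; exists r.
Qed.

Lemma chain_glues n ps q : chains n ps q -> chain n (glues ps) q.
Proof.
have : chain n [:: [::]] n by [].
rewrite /glues; elim: ps [:: [::]] {2 3}n => [|l ps IH] acc p /= h_acc.
  by move=> <-.
by move=> [r hl hps]; apply: IH hps; apply: chain_glue hl.
Qed.

(* [front p v] moves the message register from position [p] to the front of a *)
(* state with [v] other wires and pads the private register to [W] wires;     *)
(* [back p v] does the converse for the ciphertext.                           *)
Definition front p v :=
  flatten (nseq m (pull (p + m).-1)) ++ nseq (W - v) (Anc (m + v)).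
Definition back p v :=
  nseq (W - v) (Erase (c + v)) ++ flatten (nseq c (push (p + c).-1)).
Definition call p v := [:: front p v; back p v].

Lemma arity_front p v : (p <= v <= W)%N ->
  gates_arity (m + v) (front p v) = Some (m + W)%N.
Proof.
move=> /andP[le_p le_v].
apply: (@gates_arity_cat _ (m + v)); last first.
  by rewrite gates_arity_Anc // -addnA subnKC.
(* For an empty register, wire [(p + m).-1] need not exist, but it is then never pulled. *)
case: (posnP m) => [->|m_gt0] //; apply: gates_arity_nseq.
by apply: gates_arity_pull; lia.
Qed.

Lemma arity_back p v : (p <= v <= W)%N ->
  gates_arity (c + W) (back p v) = Some (c + v)%N.
Proof.
move=> /andP[le_p le_v].
apply: (@gates_arity_cat _ (c + v)).
  by rewrite -{1}(subnKC le_v) addnA gates_arity_Erase.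
case: (posnP c) => [->|c_gt0] //; apply: gates_arity_nseq.
by apply: gates_arity_push; lia.
Qed.

Lemma chain_call p v : (p <= v <= W)%N -> chain (m + v) (call p v) (c + v).
Proof. by move=> h; split; [apply: arity_front | apply: arity_back]. Qed.

Lemma arity_block_swap n T p q j : (p + j <= q)%N -> (q + j <= n)%N -> (T < n)%N ->
  (T < p)%N || (p + j <= T < q)%N || (q + j <= T)%N ->
  gates_arity n (block_swap T p q j) = Some n.
Proof.
move=> le_pq le_q lt_T neq_T; elim: j {-2}j (leqnn j) le_pq le_q neq_T => [|j0 IH].
  by case.
case=> [|j] le_j le_pq le_q neq_T //; rewrite block_swapS.
apply: gates_arity_cat; first by apply: IH; lia.
rewrite /gates_arity /= !inE.
by do 3!(rewrite ifT /=; last by lia).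
Qed.

Lemma arity_sel n e : gates_arity (n + n + e) (sel n e) = Some (n + n + e).+1.
Proof.
rewrite /sel; set T := (n + n + e)%N.
apply: (@gates_arity_cat _ T.+1); first by rewrite /gates_arity /= leqnn /= ltnSn.
apply: gates_arity_cat; first exact: gates_arity_Anc.
apply: (@gates_arity_cat _ (T.+1 + n)).
  by apply: arity_block_swap; rewrite /T; lia.
apply: (@gates_arity_cat _ (T.+1 + n)).
  by apply: arity_block_swap; rewrite /T; lia.
exact: gates_arity_Erase.
Qed.

Lemma arity_unsel n e : gates_arity (n + n + e).+1 (unsel n e) = Some (n + n + e)%N.
Proof.
rewrite /unsel -cats1; apply: gates_arity_cat.
  by apply: arity_block_swap; lia.
by rewrite /gates_arity /= ltnSn.
Qed.

(** After [sel] the challenge slot always lies in the first half, so the recursion continues there;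
    the second half and the new control wire join the [e] wires behind. *)
Fixpoint selG L e : seq gate :=
  if L is l.+1 then sel (2 ^ l * m) e ++ selG l (2 ^ l * m + e).+1 else [::].

Lemma arity_selG L e : gates_arity (2 ^ L * m + e) (selG L e) = Some (2 ^ L * m + e + L)%N.
Proof.
elim: L e => [|L IH] e; first by rewrite addn0.
rewrite expnS -mulnA mul2n -addnn; apply: gates_arity_cat (arity_sel _ _) _.
by have := IH (2 ^ L * m + e).+1; rewrite !addnS !addnA addSn.
Qed.

(** The first half already consists of ciphertexts, so the calls start at slot [h]. When slot [i] is
    reached, the other wires are [i] ciphertexts in front of it and, behind it, [h + h - i.+1]
    messages, the [e] wires and the control. *)
Definition level h e :=
  rcons [seq call (i * c) (i * c + (h + h - i.+1) * m + e).+1 | i <- iota h h]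
    [:: unsel (h * c) e].

Fixpoint slots L e :=
  if L is l.+1 then slots l (2 ^ l * m + e).+1 ++ level (2 ^ l) e else [::].

End Wiring.

(** * Semantics of oracle computations *)

Section Adversaries.
Variables (R : realType) (S : qhe) (k : nat) (sk : seq bool) (W : nat).
Hypothesis size_sk : size sk = sk_len S k.
Local Notation operator := (operator R).
Implicit Types (rho : operator) (a x y u : seq bool).

Local Notation m := (msg_len S k).
Local Notation c := (ct_len S k).
Local Notation enc_at p rho := (@apply_enc R S k sk p rho).

Local Notation chain := (chain S k W).
Local Notation chains := (chains S k W).
Local Notation front := (front S k W).
Local Notation back := (back S k W).
Local Notation call := (call S k W).
Local Notation selG := (selG S k).
Local Notation level := (level S k W).
Local Notation slots := (slots S k W).

Lemma channel_enc : channel m c (fun p rho => enc_at p rho).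
Proof.
have [c_inE c_outE ar] := encT S k.
have := channel_embed 0 m (channel_insert_basis R sk); rewrite size_sk => ch.
have ar' : gates_arity (sk_len S k + m) (c_gates (enc S k)) = Some c.
  by rewrite /= addn0 addn0 in ar.
apply: channel_ext (channel_comp ch (channel_run R ar')) => p rho.
by rewrite addn0.
Qed.

Definition zero_at n p rho : operator :=
  insert_basis p (nseq n false) (trace_out p n rho).

Lemma channel_zero n : channel n n (zero_at n).
Proof.
have := channel_comp (channel_trace_out R n) (channel_insert_basis R (nseq n false)).
by rewrite size_nseq.
Qed.

Definition encs p h rho : operator :=
  foldl (fun sigma j => enc_at (p + j * c) sigma) rho (iota 0 h).

Lemma encsS p h rho : encs p h.+1 rho = enc_at (p + h * c) (encs p h rho).
Proof. by rewrite /encs -[h.+1]addn1 iotaD foldl_cat. Qed.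

Lemma encsD p h l rho : encs p (h + l) rho = encs (p + h * c) l (encs p h rho).
Proof.
elim: l => [|l IH]; first by rewrite addn0.
by rewrite addnS !encsS IH mulnDl addnA.
Qed.

Lemma channel_encs h : channel (h * m) (h * c) (fun p rho => encs p h rho).
Proof.
elim: h => [|h IH]; first exact: channel_id.
have ch1 := channel_embed 0 m IH; have ch2 := channel_embed (h * c) 0 channel_enc.
rewrite !addn0 in ch2; rewrite !add0n in ch1.
rewrite !mulSn [(m + _)%N]addnC [(c + _)%N]addnC.
by apply: channel_ext (channel_comp ch1 ch2) => p rho; rewrite encsS addn0.
Qed.

Definition runl p (gs : seq (seq gate)) rho : operator :=
  if gs is g :: s then
    foldl (fun sigma h => run p h (enc_at p sigma)) (run p g rho) s
  else rho.

Lemma runl_cons p g h s rho :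
  runl p (g :: h :: s) rho = runl p (h :: s) (enc_at p (run p g rho)).
Proof. by []. Qed.

Lemma runl_glue p l1 l2 rho : runl p (glue l1 l2) rho = runl p l2 (runl p l1 rho).
Proof.
elim: l1 rho => [|g [|h s] IH] rho //.
  by case: l2 {IH} => [|h t] //=; rewrite run_cat.
by rewrite [glue _ _]/= -/(glue (h :: s) l2) runl_cons -IH; case: s {IH} => //; case: l2.
Qed.

Lemma channel_runl n gs q : chain n gs q -> channel n q (fun p rho => runl p gs rho).
Proof.
elim: gs n => [|g [|h s] IH] n //; first exact: channel_run.
move=> [hg /IH hs].
have ch1 := channel_embed 0 W channel_enc; rewrite !add0n in ch1.
apply: channel_ext (channel_comp (channel_run R hg) (channel_comp ch1 hs)) => p rho.
by rewrite addn0.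
Qed.

Lemma runl_glues p ps rho :
  runl p (glues ps) rho = foldl (fun sigma l => runl p l sigma) rho ps.
Proof.
rewrite /glues -[in RHS](_ : runl p [:: [::]] rho = rho) //.
by elim: ps [:: [::]] => //= l ps IH acc; rewrite IH runl_glue.
Qed.

Lemma channel_runls n ps q : chains n ps q ->
  channel n q (fun p rho => foldl (fun sigma l => runl p l sigma) rho ps).
Proof.
move=> /chain_glues/channel_runl; apply: channel_ext => p rho; exact: runl_glues.
Qed.

Definition implements n ps q (Phi : operator -> operator) :=
  chains n ps q /\
  forall rho, eqop q (foldl (fun sigma l => runl 0 l sigma) rho ps) (Phi rho).

Lemma implements_nil n : implements n [::] n id.
Proof. by []. Qed.

Lemma implements_cat n p q ps1 ps2 Phi Psi : implements n ps1 p Phi ->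
  implements p ps2 q Psi -> implements n (ps1 ++ ps2) q (fun rho => Psi (Phi rho)).
Proof.
move=> [t1 e1] [t2 e2]; split; first exact: chains_cat t2.
move=> rho x y sx sy; rewrite foldl_cat -e2 //.
by have /(_ x y sx sy) := channel_eqop (channel_runls t2) (e1 rho).
Qed.

Lemma implements_chain n l q : chain n l q -> implements n [:: l] q (runl 0 l).
Proof. by move=> h; split=> //=; exists q. Qed.

Lemma implements_run n g q : gates_arity n g = Some q ->
  implements n [:: [:: g]] q (run 0 g).
Proof. by move=> h; apply: (@implements_chain n [:: g]). Qed.

Lemma implements_ext n ps q Phi Psi : (forall rho, eqop q (Phi rho) (Psi rho)) ->
  implements n ps q Phi -> implements n ps q Psi.
Proof.
by move=> e [t h]; split=> // rho x y sx sy; rewrite h // e.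
Qed.

(** The padding is created in state |0>, is untouched by [Phi], and is erased afterwards. Stating
    this for an arbitrary channel covers both the oracle calls, in [implements_call], and the action
    of the challenger, in [run_hyb]. *)
Lemma back_front Phi p v rho : channel m c Phi -> (p <= v <= W)%N ->
  eqop (c + v) (run 0 (back p v) (Phi 0 (run 0 (front p v) rho))) (Phi p rho).
Proof.
move=> [K _ hK] /andP[le_p le_v] s s' hs hs'.
have cut t : size t = (c + v)%N -> exists a x u, [/\ t = a ++ x ++ u, size a = p,
    size x = c & size u = v - p]%N.
  by move=> ht; apply: size_cut3; lia.
have [a [x [u [-> sa sx su]]]] := cut _ hs.
have [a' [x' [u' [-> sa' sx' su']]]] := cut _ hs'.
have pushE (sigma : operator) : run 0 (flatten (nseq c (push (p + c).-1))) sigma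
    (a ++ x ++ u) (a' ++ x' ++ u') = sigma (x ++ a ++ u) (x' ++ a' ++ u').
  case: (posnP c) => [c0|c_gt0]; last by apply: run_pushes; lia.
  by move: sx sx'; rewrite c0 => /size0nil-> /size0nil->.
have pullE (sigma : operator) z z' : size z = m -> size z' = m ->
    run 0 (flatten (nseq m (pull (p + m).-1))) sigma
    (z ++ a ++ u) (z' ++ a' ++ u') = sigma (a ++ z ++ u) (a' ++ z' ++ u').
  move=> sz sz'; case: (posnP m) => [m0|m_gt0]; last by apply: run_pulls; lia.
  by move: sz sz'; rewrite m0 => /size0nil-> /size0nil->.
rewrite /back run_cat pushE.
rewrite -[x ++ _]cats0 -[x' ++ _]cats0 run_Erase ?size_cat; try lia.
rewrite hK // (eq_sum_bits (F2 := fun w => (w == nseq (W - v) false)%:R *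
  \sum_(z <- bits m) \sum_(z' <- bits m)
    K x x' z z' * rho (a ++ z ++ u) (a' ++ z' ++ u'))).
  by rewrite sum_bits_delta ?size_nseq.
move=> w sw; rewrite !cats0 -!catA -[x ++ _]cat0s -[x' ++ _]cat0s hK //.
rewrite mulr_sumr; apply: eq_sum_bits => z sz.
rewrite mulr_sumr; apply: eq_sum_bits => z' sz'; rewrite !cat0s /front run_cat.
have := @run_Anc R (m + v) (W - v) (run 0 (flatten (nseq m (pull (p + m).-1))) rho)
  (z ++ a ++ u) (z' ++ a' ++ u') w w [::] [::].
rewrite !cats0 -!catA => ->; rewrite ?size_cat; try lia.
by rewrite andbb pullE // mulrCA.
Qed.

Lemma implements_call p v : (p <= v <= W)%N ->
  implements (m + v) [:: call p v] (c + v) (fun rho => enc_at p rho).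
Proof.
move=> h; apply: implements_ext (implements_chain (chain_call S k h)) => rho.
exact: (back_front rho channel_enc h).
Qed.

(** The meaning of [slots], with each encryption performed in place. Slot 0 is expected to hold the
    ciphertext returned by the challenger; the remaining slots are encrypted half by half, and the
    control wires are consumed from the innermost level outwards. *)
Fixpoint hyb L e rho : operator :=
  if L is l.+1 then
    run 0 (unsel (2 ^ l * c) e) (encs (2 ^ l * c) (2 ^ l) (hyb l (2 ^ l * m + e).+1 rho))
  else rho.

Lemma implements_calls h e j : (j <= h)%N -> (h.*2 * (m + c) + e < W)%N ->
  implements (h * c + h * m + e).+1
    [seq call (i * c) (i * c + (h + h - i.+1) * m + e).+1 | i <- iota h j]
    ((h + j) * c + (h - j) * m + e).+1 (encs (h * c) j).
Proof.
move=> le_j le_W; elim: j le_j => [|j IH] lt_j.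
  by rewrite addn0 subn0; apply: implements_nil.
rewrite -[j.+1]addn1 iotaD map_cat addn1.
have {}IH := IH (ltnW lt_j).
set v := ((h + j) * c + (h + h - (h + j).+1) * m + e).+1.
have bnd : ((h + j) * c <= v <= W)%N by rewrite /v; nia.
have := implements_call bnd.
have -> : (m + v = ((h + j) * c + (h - j) * m + e).+1)%N.
  have -> : (h - j = (h + h - (h + j).+1).+1)%N by lia.
  by rewrite /v mulSn; lia.
have -> : (c + v = ((h + j.+1) * c + (h - j.+1) * m + e).+1)%N.
  have -> : (h - j.+1 = h + h - (h + j).+1)%N by lia.
  by rewrite /v !addnS mulSn; lia.
move=> /(implements_cat IH); apply: implements_ext => rho.
by move=> x y _ _; rewrite encsS mulnDl.
Qed.

Lemma implements_level l e : (2 ^ l.+1 * (m + c) + e < W)%N ->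
  implements (2 ^ l * c + 2 ^ l * m + e).+1 (level (2 ^ l) e) (2 ^ l.+1 * c + e)
    (fun rho => run 0 (unsel (2 ^ l * c) e) (encs (2 ^ l * c) (2 ^ l) rho)).
Proof.
rewrite /level expnS mul2n => le_W; rewrite -cats1.
have := implements_calls (leqnn _) le_W; rewrite subnn mul0n addn0 => h.
apply: implements_cat h _; rewrite -addnn mulnDl.
exact: implements_run (arity_unsel _ _).
Qed.

Lemma implements_slots L e : (2 ^ L * (m + c) + e + L <= W)%N ->
  implements (c + ((2 ^ L - 1) * m + e + L)) (slots L e) (2 ^ L * c + e) (hyb L e).
Proof.
elim: L e => [|l IH] e le_W /=.
  by rewrite subnn mul0n addn0 mul1n; apply: implements_nil.
have p_gt0 : (0 < 2 ^ l)%N by rewrite expn_gt0.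
have bnd : (2 ^ l * (m + c) + (2 ^ l * m + e).+1 + l <= W)%N.
  by move: le_W; rewrite expnS; nia.
have := IH _ bnd.
have -> : (c + ((2 ^ l - 1) * m + (2 ^ l * m + e).+1 + l) =
          c + ((2 ^ l.+1 - 1) * m + e + l.+1))%N.
  rewrite expnS.
  by have -> : (2 * 2 ^ l - 1 = (2 ^ l - 1) + 2 ^ l)%N; [lia | rewrite mulnDl; lia].
have bnd' : (2 ^ l.+1 * (m + c) + e < W)%N by move: le_W; lia.
have -> : (2 ^ l * c + (2 ^ l * m + e).+1 = (2 ^ l * c + 2 ^ l * m + e).+1)%N.
  by rewrite addnS addnA.
move=> h; have := implements_level bnd'.
exact: implements_cat h.
Qed.

(** * The hybrid identity *)

Section DoubleKernel.
Variables (n : nat) (K : kernel R).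

Definition double_kernel x1 x2 y1 y2
    (f : seq bool -> seq bool -> seq bool -> seq bool -> R[i]) :=
  \sum_(a <- bits n) \sum_(a' <- bits n) \sum_(b <- bits n) \sum_(b' <- bits n)
    K x1 y1 a a' * (K x2 y2 b b' * f a b a' b').

Lemma double_kernel_ext al x1 x2 y1 y2 f g :
  (forall a b a' b', size a = n -> size b = n -> size a' = n -> size b' = n ->
     f a b a' b' = al * g a b a' b') ->
  double_kernel x1 x2 y1 y2 f = al * double_kernel x1 x2 y1 y2 g.
Proof.
move=> fg; rewrite /double_kernel !mulr_sumr; apply: eq_sum_bits => a sa.
rewrite !mulr_sumr; apply: eq_sum_bits => a' sa'.
rewrite !mulr_sumr; apply: eq_sum_bits => b sb.
rewrite !mulr_sumr; apply: eq_sum_bits => b' sb'.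
by rewrite fg //; ring.
Qed.

(** The two halves are encrypted by the same kernel [K], so exchanging the halves of the ciphertexts
    amounts to exchanging the halves of the messages. This is why a swap made before encryption can
    be undone after it. *)
Lemma double_kernel_swap x1 x2 y1 y2 f :
  double_kernel x2 x1 y2 y1 f =
  double_kernel x1 x2 y1 y2 (fun a b a' b' => f b a b' a').
Proof.
rewrite /double_kernel.
under eq_bigr do rewrite exchange_big.
rewrite exchange_big; apply: eq_bigr => a _.
under eq_bigr do rewrite exchange_big.
rewrite exchange_big; apply: eq_bigr => a' _.
by do 2!apply: eq_bigr => ? _; rewrite mulrCA.
Qed.

End DoubleKernel.

(** Linearity, in the form needed by the hybrid argument: proportionality of differences survives
    any later operation on part of the wires. *)
Lemma channel_diff n q Phi p r al (A1 A0 C1 C0 : operator) : channel n q Phi ->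
  (forall x y, size x = (p + (n + r))%N -> size y = (p + (n + r))%N ->
     A1 x y - A0 x y = al * (C1 x y - C0 x y)) ->
  forall x y, size x = (p + (q + r))%N -> size y = (p + (q + r))%N ->
    Phi p A1 x y - Phi p A0 x y = al * (Phi p C1 x y - Phi p C0 x y).
Proof.
move=> [K _ hK] hA x y /size_cut3[a [x1 [u [-> sa sx su]]]].
move=> /size_cut3[a' [y1 [u' [-> sa' sy su']]]].
rewrite !hK // -!sumrB mulr_sumr; apply: eq_sum_bits => z sz.
rewrite -!sumrB mulr_sumr; apply: eq_sum_bits => z' sz'.
by rewrite -!mulrBr hA ?size_cat ?sa ?sa' ?su ?su' ?sz ?sz' // mulrCA.
Qed.

Lemma encs_double h K rho x1 x2 y1 y2 u u' :
  (forall p, has_kernel p (h * m) (h * c) (fun rho => encs p h rho) K) ->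
  size x1 = (h * c)%N -> size x2 = (h * c)%N ->
  size y1 = (h * c)%N -> size y2 = (h * c)%N ->
  encs 0 (h + h) rho (x1 ++ x2 ++ u) (y1 ++ y2 ++ u') =
  double_kernel (h * m) K x1 x2 y1 y2
    (fun a b a' b' => rho (a ++ b ++ u) (a' ++ b' ++ u')).
Proof.
move=> hK sx1 sx2 sy1 sy2; rewrite encsD add0n hK // /double_kernel.
transitivity (\sum_(b <- bits (h * m)) \sum_(b' <- bits (h * m))
  \sum_(a <- bits (h * m)) \sum_(a' <- bits (h * m))
    K x1 y1 a a' * (K x2 y2 b b' * rho (a ++ b ++ u) (a' ++ b' ++ u'))).
  apply: eq_bigr => b _; apply: eq_bigr => b' _.
  rewrite -[x1 ++ _]cat0s -[y1 ++ _]cat0s hK // mulr_sumr.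
  apply: eq_bigr => a _; rewrite mulr_sumr; apply: eq_bigr => a' _.
  by rewrite mulrCA.
under eq_bigr do rewrite exchange_big.
rewrite exchange_big; apply: eq_bigr => a _.
under eq_bigr do rewrite exchange_big.
by rewrite exchange_big.
Qed.

Lemma zero_at_cat n rho x y u u' : size x = n -> size y = n ->
  zero_at n 0 rho (x ++ u) (y ++ u') =
  ((x == nseq n false) && (y == nseq n false))%:R *
  \sum_(v <- bits n) rho (v ++ u) (v ++ u').
Proof.
move=> sx sy; rewrite /zero_at -[x ++ _]cat0s -[y ++ _]cat0s.
by rewrite insert_basis_cat ?size_nseq // trace_out_cat.
Qed.

(* By induction on [L]: unset and set, the control wire of the outermost      *)
(* level contributes the hybrids over the first and over the second half of   *)
(* the slots, and the middle terms cancel.                                    *)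
Lemma hybrid L e rho x y :
  size x = (2 ^ L * c + e)%N -> size y = (2 ^ L * c + e)%N ->
  hyb L e (enc_at 0 (run 0 (selG L e) rho)) x y -
  hyb L e (enc_at 0 (zero_at m 0 (run 0 (selG L e) rho))) x y =
  (2^-1)%:C ^+ L * (encs 0 (2 ^ L) rho x y -
                    encs 0 (2 ^ L) (zero_at (2 ^ L * m) 0 rho) x y).
Proof.
elim: L e rho x y => [|L IH] e rho x y.
  by move=> _ _; rewrite expr0 mul1r expn0 mul1n.
set h := (2 ^ L)%N in IH *; have -> : (2 ^ L.+1 = h + h)%N by rewrite expnS mul2n addnn.
rewrite !mulnDl -!addnA => sx sy.
set n := (h * m)%N; set n' := (h * c)%N; set tau := run 0 (sel n e) rho.
have -> : run 0 (selG L.+1 e) rho = run 0 (selG L (n + e).+1) tau.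
  by rewrite /= run_cat.
rewrite /= -/h -/n -/n'.
have {}IH := IH (n + e).+1 tau; rewrite addnS addnA -/n -/n' in IH.
set A1 := hyb L (n + e).+1 (enc_at 0 (run _ _ _)).
set A0 := hyb L (n + e).+1 (enc_at 0 (zero_at _ _ _)).
rewrite -/A1 -/A0 in IH.
pose D sigma z1 z2 v t1 t2 v' : R[i] :=
  encs 0 (h + h) sigma (z1 ++ z2 ++ v) (t1 ++ t2 ++ v').
(* The induction hypothesis, carried through the encryption of the second half by linearity. *)
have diffE z1 z2 v t1 t2 v' : size z1 = n' -> size z2 = n' -> size v = e.+1 ->
    size t1 = n' -> size t2 = n' -> size v' = e.+1 ->
    encs n' h A1 (z1 ++ z2 ++ v) (t1 ++ t2 ++ v') -
    encs n' h A0 (z1 ++ z2 ++ v) (t1 ++ t2 ++ v') =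
    (2^-1)%:C ^+ L * (D tau z1 z2 v t1 t2 v' - D (zero_at n 0 tau) z1 z2 v t1 t2 v').
  move=> sz1 sz2 sv st1 st2 sv'; rewrite /D !encsD add0n.
  apply: (channel_diff (channel_encs h) (p := n') (r := e.+1)).
  - by move=> s t hs ht; apply: IH; rewrite ?hs ?ht -/n; lia.
  - by rewrite !size_cat sz1 sz2 sv.
  - by rewrite !size_cat st1 st2 sv'.
move: sx sy => /size_cut3[x1 [x2 [u [-> sx1 sx2 su]]]].
move=> /size_cut3[y1 [y2 [u' [-> sy1 sy2 su']]]].
rewrite !run_unsel // opprD addrACA !diffE ?size_cat ?su ?su' ?addn1 // -mulrDr.
have [K _ hK] := channel_encs h.
(* Of the four terms that follow, [D0z] and [D1] have the same value: in both, the first half is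
   zero and the second half is kept. They cancel, leaving all slots kept minus all slots zeroed,
   with one more factor 1/2. *)
have D0 : D tau x1 x2 (u ++ [:: false]) y1 y2 (u' ++ [:: false]) =
    (2^-1)%:C * D rho x1 x2 u y1 y2 u'.
  rewrite /D !(encs_double _ _ _ hK) //; apply: double_kernel_ext.
  by move=> a b a' b' sa sb sa' sb'; rewrite /tau run_sel.
have D0z : D (zero_at n 0 tau) x1 x2 (u ++ [:: false]) y1 y2 (u' ++ [:: false]) =
    (2^-1)%:C * D (zero_at n 0 rho) x1 x2 u y1 y2 u'.
  rewrite /D !(encs_double _ _ _ hK) //; apply: double_kernel_ext.
  move=> a b a' b' sa sb sa' sb'; rewrite !zero_at_cat // mulrCA; congr (_ * _).
  by rewrite mulr_sumr; apply: eq_sum_bits => v sv; rewrite /tau run_sel.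
have D1 : D tau x2 x1 (u ++ [:: true]) y2 y1 (u' ++ [:: true]) =
    (2^-1)%:C * D (zero_at n 0 rho) x1 x2 u y1 y2 u'.
  rewrite /D !(encs_double _ _ _ hK) // double_kernel_swap; apply: double_kernel_ext.
  by move=> a b a' b' sa sb sa' sb'; rewrite !zero_at_cat // /tau run_sel.
have D1z : D (zero_at n 0 tau) x2 x1 (u ++ [:: true]) y2 y1 (u' ++ [:: true]) =
    (2^-1)%:C * D (zero_at (n + n) 0 rho) x1 x2 u y1 y2 u'.
  rewrite /D !(encs_double _ _ _ hK) // double_kernel_swap; apply: double_kernel_ext.
  move=> a b a' b' sa sb sa' sb'; rewrite zero_at_cat //.
  have := @zero_at_cat (n + n) rho (a ++ b) (a' ++ b') u u'; rewrite -!catA => ->.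
  - rewrite nseqD !eqseq_cat ?size_nseq ?sa ?sa' // sum_bits_cat [in RHS]exchange_big.
    under eq_sum_bits => v sv do rewrite /tau run_sel //.
    rewrite -!mulr_sumr mulrCA; congr (_ * _); rewrite mulrA -natrM mulnb.
    congr (_ * _); first by congr (nat_of_bool _)%:R; rewrite -!andbA; do !bool_congr.
    by apply: eq_bigr => v _; apply: eq_bigr => v' _; rewrite -!catA.
  - by rewrite size_cat sa sb.
  - by rewrite size_cat sa' sb'.
rewrite D0 D0z D1 D1z -/(D rho x1 x2 u y1 y2 u').
rewrite -/(D (zero_at (n + n) 0 rho) x1 x2 u y1 y2 u') exprS; ring.
Qed.

End Adversaries.

(** * Adversaries and their lists of gates *)

Definition adv_gates (A : oracle_adversary) : seq (seq gate) :=
  [seq c_gates C | C <- A.1 :: A.2].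

Fixpoint mk_circuits X I O Y (gs : seq (seq gate)) : seq circuit :=
  if gs is g :: s then
    Circuit X g (if s is [::] then Y else O) :: mk_circuits I I O Y s
  else [::].

Definition mk_adv X I O Y gs : oracle_adversary :=
  let cs := mk_circuits X I O Y gs in (head (Circuit X [::] Y) cs, behead cs).

Lemma adv_gates_mk_adv X I O Y gs : gs <> [::] -> adv_gates (mk_adv X I O Y gs) = gs.
Proof.
case: gs => // g s _; rewrite /adv_gates /=; congr (_ :: _).
by elim: s => //= h s ->.
Qed.

Lemma chain_adv S k e X Y A : adv_from_to S k e X Y A ->
  chain S k e (sumn X) (adv_gates A) (sumn Y).
Proof.
rewrite /adv_from_to /adv_gates; case: A => A s /=.
elim: s X A => [|B s IH] X A /=; first by move=> [].
move=> [[_ _ hA] /IH hB]; rewrite /= !addn0 in hA hB.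
by split.
Qed.

(* The private register size is read off the first circuit; it is irrelevant  *)
(* when there are no oracle calls.                                            *)
Lemma chain_adv_last S k e X Y A : adv_from_to S k e X Y A ->
  chain S k (last 0%N (c_out A.1)) (sumn X) (adv_gates A) (sumn Y).
Proof.
case: A => A [|B s] h; first by case: h.
by have := chain_adv h; case: h => [[_ /= -> _] _].
Qed.

Lemma adv_mk_adv S k e X Y gs : chain S k e (sumn X) gs (sumn Y) ->
  adv_from_to S k e X Y
    (mk_adv X [:: ct_len S k; e] [:: msg_len S k; e] Y gs).
Proof.
rewrite /adv_from_to /=; case: gs => // g s.
elim: s X g => [|h s IH] X g; first by move=> hg; split.
move=> [hg hs]; split; first by split=> //=; rewrite addn0.
by apply: IH; rewrite /= addn0.
Qed.

Lemma size_cut2 n q (x : seq bool) : size x = (n + q)%N ->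
  exists z s, [/\ x = z ++ s, size z = n & size s = q].
Proof.
move=> sx; exists (take n x), (drop n x).
by rewrite cat_take_drop size_takel ?size_drop ?sx ?leq_addr // addKn.
Qed.

(** * Traces and winning probabilities *)

Section Traces.
Variables (R : realType) (S : qhe) (k : nat).
Local Notation operator := (operator R).
Implicit Types (rho : operator) (sk a x y u : seq bool).
Local Notation m := (msg_len S k).
Local Notation c := (ct_len S k).
Local Notation enc_at sk p rho := (@apply_enc R S k sk p rho).

Lemma run_advE sk A rho : run_adv S k sk A rho = runl S k sk 0 (adv_gates A) rho.
Proof.
rewrite /run_adv /adv_gates; case: A => A s /=.
by elim: s A rho => //= B s IH A rho; rewrite IH.
Qed.

Lemma channel_trace n q Phi p rho a a' u u' : channel n q Phi ->
  size a = p -> size a' = p ->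
  \sum_(x <- bits q) Phi p rho (a ++ x ++ u) (a' ++ x ++ u') =
  \sum_(x <- bits n) rho (a ++ x ++ u) (a' ++ x ++ u').
Proof.
move=> [K tK hK] sa sa'; under eq_sum_bits => x sx do rewrite hK //.
rewrite exchange_big /=; apply: eq_sum_bits => x sx; rewrite exchange_big /=.
under eq_sum_bits => y sy do rewrite -mulr_suml tK //.
by rewrite sum_bits_delta_sym.
Qed.

Definition trace n rho : R[i] := \sum_(x <- bits n) rho x x.

Lemma channel_trace0 n q Phi rho : channel n q Phi -> trace q (Phi 0 rho) = trace n rho.
Proof.
move=> ch; have := @channel_trace n q Phi 0 rho [::] [::] [::] [::] ch erefl erefl.
by rewrite /trace; under eq_bigr do rewrite !cat0s !cats0; move=> ->;
  apply: eq_bigr => x _; rewrite !cats0.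
Qed.

(** Key generation has trace 1, and its diagonal splits into the blocks of the keys: the
    probabilities of the keys add up to 1. *)
Lemma trace_evk :
  \sum_(sk <- bits (sk_len S k)) trace (evk_len S k) (evk_state R S k sk) = 1.
Proof.
have [_ _ ar] := keygenT S k; rewrite /= addn0 in ar.
have := channel_trace0 (unit_state R) (channel_run R ar).
rewrite /trace sum_bits0 sum_bits_cat /unit_state => <-.
by [].
Qed.

Lemma channel_enc_wires sk (e : nat) : size sk = sk_len S k ->
  channel (m + e) (c + e) (fun p rho => enc_at sk p rho).
Proof.
move=> size_sk; have := channel_embed 0 e (channel_enc R size_sk).
by rewrite !add0n; apply: channel_ext => p rho; rewrite addn0.
Qed.

Lemma cpa_challengeE sk r rho : cpa_challenge S k sk r rho =
  enc_at sk 0 (if r then rho else zero_at m 0 rho).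
Proof. by []. Qed.

Lemma mult_challengeE t sk r rho : mult_challenge S k t sk r rho =
  encs S k sk 0 t (trace_out (if r then 0 else t * m)%N (t * m) rho).
Proof. by rewrite /mult_challenge /encs; case: r. Qed.

Lemma win_probE challenge A1 A2 : win_prob S k challenge A1 A2 =
  2^-1 * \sum_(sk <- bits (sk_len S k)) \sum_(r : bool)
    complex.Re (runl S k sk 0 (adv_gates A2)
      (challenge sk r (runl S k sk 0 (adv_gates A1) (evk_state R S k sk))) [:: r] [:: r]).
Proof.
rewrite /win_prob [LHS](sum_tuple_bits _ (fun sk => \sum_(r : bool)
   2^-1 * complex.Re (run_adv S k sk A2
     (challenge sk r (run_adv S k sk A1 (evk_state R S k sk))) [:: r] [:: r]))).
rewrite mulr_sumr; apply: eq_bigr => sk _; rewrite mulr_sumr.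
by apply: eq_bigr => r _; rewrite !run_advE.
Qed.

Lemma eq_win_prob ch ch' A1 A2 A1' A2' :
  (forall sk r, size sk = sk_len S k ->
    runl S k sk 0 (adv_gates A2)
      (ch sk r (runl S k sk 0 (adv_gates A1) (evk_state R S k sk))) [:: r] [:: r] =
    runl S k sk 0 (adv_gates A2')
      (ch' sk r (runl S k sk 0 (adv_gates A1') (evk_state R S k sk))) [:: r] [:: r]) ->
  win_prob S k ch A1 A2 = win_prob S k ch' A1' A2'.
Proof.
move=> eq_ch; rewrite !win_probE; congr (_ * _); apply: eq_sum_bits => sk ssk.
by apply: eq_bigr => r _; rewrite eq_ch.
Qed.

(** The ancillas play the part of M_0 = |0>. For r = 1 they are what the challenger traces out; for
    r = 0 the submitted message is traced out and the zeros are encrypted. *)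
Lemma mult1_cpa e sk r rho : size sk = sk_len S k ->
  eqop (c + e) (mult_challenge S k 1 sk r (run 0 (nseq m (Anc 0)) rho))
    (cpa_challenge S k sk r rho).
Proof.
move=> size_sk; rewrite mult_challengeE cpa_challengeE /encs [foldl _ _ _]/=.
rewrite mul1n mul0n addn0.
apply: (channel_eqop (channel_enc_wires e size_sk)) => x y.
move=> /size_cut2[z [u [-> sz su]]] /size_cut2[z' [u' [-> sz' su']]].
case: r.
  rewrite -[z ++ u]cat0s -[z' ++ u']cat0s trace_out_cat //.
  under eq_sum_bits => w sw do rewrite run_Anc // andbb.
  by rewrite sum_bits_delta ?size_nseq.
rewrite trace_out_cat // zero_at_cat // mulr_sumr.
apply: eq_sum_bits => w sw.
by rewrite -[z ++ _]cat0s -[z' ++ _]cat0s run_Anc.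
Qed.

End Traces.

(** * The reduction *)

(* The gates [H Z H] negate a wire.                                           *)
Definition flip (b : bool) :=
  if b then [::] else [:: Hadamard 0; Phase 0; Phase 0; Hadamard 0].

Lemma arity_flip b : gates_arity 1 (flip b) = Some 1%N.
Proof. by case: b. Qed.

Lemma apply_unitary1_bit (R : realType) U (rho : operator R) b d :
  apply_unitary1 U 0 rho [:: b] [:: d] =
  \sum_(b' : bool) \sum_(d' : bool) U b b' * rho [:: b'] [:: d'] * (U d d')^*.
Proof. by []. Qed.

Lemma run_flip (R : realType) b (rho : operator R) r :
  run 0 (flip b) rho [:: r] [:: r] = rho [:: r (+) ~~ b] [:: r (+) ~~ b].
Proof.
case: b; rewrite /= ?addbF // addbT.
rewrite -[LHS]/(apply_unitary1 (@hadamard_mx R) 0 (apply_unitary1 (@phase_mx R) 0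
  (apply_unitary1 (@phase_mx R) 0 (apply_unitary1 (@hadamard_mx R) 0 rho))) [:: r] [:: r]).
set rho1 := apply_unitary1 (@hadamard_mx R) 0 rho.
(* Two phase gates make a Z gate, which puts one sign on each side of the entry. *)
have phaseE (sigma : operator R) x y :
    apply_unitary1 (@phase_mx R) 0 (apply_unitary1 (@phase_mx R) 0 sigma) [:: x] [:: y] =
    (-1) ^+ x * sigma [:: x] [:: y] * (-1) ^+ y.
  have ii : 'i%C * 'i%C = -1 :> R[i] by rewrite -expr2 sqr_i.
  have ic : ('i%C : R[i])^*%R = - 'i%C.
    by apply/eqP; rewrite conjE eq_complex /= oppr0 !eqxx.
  rewrite !apply_unitary1_bit !big_bool !apply_unitary1_bit !big_bool /phase_mx.
  case: x; case: y; rewrite /= ?ic ?conjE ?conjc0 ?conjc1.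
  - transitivity (('i%C * 'i%C) * ('i%C * 'i%C) * sigma [:: true] [:: true] : R[i]); first ring.
    by rewrite ii; ring.
  - transitivity (('i%C * 'i%C) * sigma [:: true] [:: false] : R[i]); first ring.
    by rewrite ii; ring.
  - transitivity (('i%C * 'i%C) * sigma [:: false] [:: true] : R[i]); first ring.
    by rewrite ii; ring.
  - by ring.
pose s : R[i] := (Num.sqrt (2 : R))^-1%:C.
have hE x y : hadamard_mx R x y = (-1) ^+ (x && y) * s.
  by rewrite hadamard_mxE rmorphM rmorphXn rmorphN1.
have hcE x y : (hadamard_mx R x y)^*%R = (-1) ^+ (x && y) * s.
  by rewrite -hE conjE hadamard_mxE conjc_real.
have s4 : 4 * (s * s) * (s * s) = 1.
  have -> : s * s = (2^-1)%:C.
    by rewrite /s -(rmorphM (real_complex R)) /= -invfM sqrt2_sq.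
  rewrite -(rmorph_nat (real_complex R)) -!(rmorphM (real_complex R)).
  by rewrite -(rmorph1 (real_complex R)); congr (_%:C); field.
rewrite apply_unitary1_bit !big_bool !phaseE /rho1 !apply_unitary1_bit !big_bool.
rewrite !hcE !hE -[RHS]mul1r -[X in _ = X * _]s4.
by case: r => /=; rewrite ?expr0 ?expr1; ring.
Qed.

Section Reduction.
Variables (R : realType) (S : qhe) (k : nat).
Local Notation operator := (operator R).
Implicit Types (rho : operator) (sk a x y u : seq bool).
Local Notation m := (msg_len S k).
Local Notation c := (ct_len S k).
Local Notation enc_at sk p rho := (@apply_enc R S k sk p rho).

(** The given second adversary keeps [e2] private wires during its calls, but an adversary has the
    same private size at all of its calls. Each call is therefore rerouted through [call], padded to
    [W]. *)
Definition repad W e2 (gs : seq (seq gate)) : seq (seq (seq gate)) :=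
  if gs is g :: s then
    [:: g] :: flatten [seq [:: call S k W 0 e2; [:: h]] | h <- s]
  else [::].

Lemma implements_repad sk W e2 n gs q : size sk = sk_len S k -> (e2 <= W)%N ->
  chain S k e2 n gs q -> @implements R S k sk W n (repad W e2 gs) q (runl S k sk 0 gs).
Proof.
move=> size_sk le_e2; elim: gs n => [|g [|h s] IH] n //.
  exact: implements_run.
move=> [hg /IH hs].
have hc := implements_call (p := 0) (v := e2) R size_sk (W := W).
have := implements_cat size_sk (implements_cat size_sk (implements_run R S k sk W hg)
  (hc le_e2)) hs.
exact.
Qed.

Variables (t e e1 e2 L : nat) (A1 A2 : oracle_adversary).
Local Notation N := (2 ^ L)%N.
Hypothesis le_t : (t <= N)%N.
Hypothesis A1T : adv_from_to S k e1 [:: evk_len S k] (nseq t m ++ nseq t m ++ [:: e]) A1.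
Hypothesis A2T : adv_from_to S k e2 (nseq t c ++ [:: e]) [:: 1%N] A2.

(* Bounds the private register at every oracle call of the reduction.         *)
Definition privsize := (N * (m + c) + e + L + e2)%N.
Local Notation W := privsize.
(** The wires behind the challenge slot: the other N - 1 slots, the register E and the L control
    wires. *)
Definition rest := ((N - 1) * m + e + L)%N.

(** M_0 starts at wire 0 and M_1 at wire [t * m]; the erasure removes the list not indexed by [b].
    The zero slots then go between M_b and E. *)
Definition prepare (b : bool) :=
  nseq (t * m) (Erase (if b then 0 else t * m)%N) ++ nseq ((N - t) * m) (Anc (t * m)).
Definition discard := nseq ((N - t) * c) (Erase (t * c)).

(** The challenge is routed like an oracle call cut in two: [front] ends the first adversary and
    [back] begins the second. *)
Definition hyb_gates1 b :=
  glue (adv_gates A1) [:: prepare b ++ selG S k L e ++ front S k W 0 rest].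
Definition hyb_gates2 b :=
  glues ([:: [:: back S k W 0 rest]] ++ slots S k W L e ++ [:: [:: discard]] ++
         repad W e2 (adv_gates A2) ++ [:: [:: flip b]]).

Lemma arity_prepare b :
  gates_arity (t * m + (t * m + e)) (prepare b) = Some (N * m + e)%N.
Proof.
apply: (@gates_arity_cat _ (t * m + e)).
  by rewrite addnC gates_arity_Erase //; case: b; lia.
rewrite gates_arity_Anc ?leq_addr //; congr Some.
by rewrite mulnBl; have := leq_mul le_t (leqnn m); lia.
Qed.

Lemma arity_discard : gates_arity (N * c + e) discard = Some (t * c + e)%N.
Proof.
have -> : (N * c + e = t * c + e + (N - t) * c)%N.
  by rewrite mulnBl; have := leq_mul le_t (leqnn c); lia.
by rewrite gates_arity_Erase ?leq_addr.
Qed.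

Lemma sumn_outs n : sumn (nseq t n ++ nseq t n ++ [:: e]) = (t * n + (t * n + e))%N.
Proof. by rewrite !sumn_cat sumn_nseq /= addn0 mulnC. Qed.

Lemma sumn_ins n : sumn (nseq t n ++ [:: e]) = (t * n + e)%N.
Proof. by rewrite sumn_cat sumn_nseq /= addn0 mulnC. Qed.

Lemma rest_bound : (0 <= rest <= W)%N.
Proof. by rewrite /rest /privsize; nia. Qed.

Lemma restE : (N * m + e + L = m + rest)%N.
Proof.
have N_gt0 : (0 < N)%N by rewrite expn_gt0.
by rewrite /rest -[in LHS](subnK N_gt0) mulnDl mul1n; lia.
Qed.

Lemma chain_hyb1 b e1' : chain S k e1' (evk_len S k) (adv_gates A1) (t * m + (t * m + e)) ->
  chain S k e1' (evk_len S k) (hyb_gates1 b) (m + W).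
Proof.
move=> h; apply: chain_glue h _.
apply: (@gates_arity_cat _ (N * m + e)%N); first exact: arity_prepare.
apply: (@gates_arity_cat _ (N * m + e + L)%N); first exact: arity_selG.
rewrite restE; exact: (arity_front _ _ rest_bound).
Qed.

Lemma implements_hyb2 sk b : size sk = sk_len S k ->
  @implements R S k sk W (c + rest)
    (slots S k W L e ++ [:: [:: discard]] ++ repad W e2 (adv_gates A2) ++ [:: [:: flip b]]) 1
    (fun rho => run 0 (flip b) (runl S k sk 0 (adv_gates A2)
       (run 0 discard (hyb S k sk L e rho)))).
Proof.
move=> size_sk.
have bnd : (N * (m + c) + e + L <= W)%N by rewrite /privsize leq_addr.
have h1 := implements_slots R size_sk bnd.
have h2 := implements_run R S k sk W arity_discard.
have := chain_adv A2T; rewrite sumn_ins => ch.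
have le_e2 : (e2 <= W)%N by rewrite /privsize leq_addl.
have h3 := implements_repad size_sk le_e2 ch.
have h4 := implements_run R S k sk W (arity_flip b).
exact (implements_cat size_sk h1 (implements_cat size_sk h2 (implements_cat size_sk h3 h4))).
Qed.

Lemma chain_hyb2 sk b : size sk = sk_len S k -> chain S k W (c + W) (hyb_gates2 b) 1.
Proof.
move=> size_sk; apply: chain_glues; exists (c + rest)%N.
  exact: (arity_back _ _ rest_bound).
by have [] := implements_hyb2 b size_sk.
Qed.

Section Key.
Variable sk : seq bool.
Hypothesis size_sk : size sk = sk_len S k.

Definition decide rho := runl S k sk 0 (adv_gates A2) (run 0 discard rho).

Lemma channel_decide :
  channel (N * c + e) 1 (fun p rho => runl S k sk p (adv_gates A2) (run p discard rho)).
Proof.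
have := chain_adv A2T; rewrite sumn_ins => ch.
exact: channel_comp (channel_run R arity_discard) (channel_runl R size_sk ch).
Qed.

Definition challenge r rho := enc_at sk 0 (if r then rho else zero_at m 0 rho).

Lemma channel_challenge r :
  channel m c (fun p rho => enc_at sk p (if r then rho else zero_at m p rho)).
Proof.
case: r; first exact: channel_enc.
exact: channel_comp (channel_zero R m) (channel_enc R size_sk).
Qed.

(** An instance of [back_front] in which the challenge takes the place of encryption. Owing to
    [flip], the reduction guesses 1 exactly when the given adversary answers b. *)
Lemma run_hyb b r r' rho :
  runl S k sk 0 (hyb_gates2 b)
    (cpa_challenge S k sk r (runl S k sk 0 (hyb_gates1 b) rho)) [:: r'] [:: r'] =
  decide (hyb S k sk L e (challenge r (run 0 (selG S k L e)
    (run 0 (prepare b) (runl S k sk 0 (adv_gates A1) rho)))))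
    [:: r' (+) ~~ b] [:: r' (+) ~~ b].
Proof.
rewrite /hyb_gates1 runl_glue [runl S k sk 0 [:: _] _]/=.
set rho0 := runl S k sk 0 (adv_gates A1) rho.
rewrite run_cat run_cat; set rho1 := run 0 (selG S k L e) _.
rewrite /hyb_gates2 runl_glues foldl_cat.
have [tch himp] := implements_hyb2 b size_sk.
have hbf := back_front size_sk rho1 (channel_challenge r) rest_bound.
have h := channel_eqop (channel_runls R size_sk tch) hbf.
rewrite -run_flip -himp //; exact: h.
Qed.

(** Every step preserves the trace. Hence the weight of the answer 0 is determined by that of the
    answer 1, which is how [hyb_outcomes] reduces winning to a difference. *)
Lemma trace_hyb b r rho :
  trace 1 (runl S k sk 0 (hyb_gates2 b)
    (cpa_challenge S k sk r (runl S k sk 0 (hyb_gates1 b) rho))) =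
  trace (evk_len S k) rho.
Proof.
have := chain_adv_last A1T; rewrite sumn_outs /= addn0 => ch1.
rewrite (channel_trace0 _ (channel_runl R size_sk (chain_hyb2 b size_sk))).
have chW : channel (m + W) (c + W) (fun p (rho : operator) =>
    enc_at sk p (if r then rho else zero_at m p rho)).
  have := channel_embed 0 W (channel_challenge r); rewrite !add0n.
  by apply: channel_ext => p sigma; rewrite addn0.
rewrite (channel_trace0 _ chW).
exact: channel_trace0 (channel_runl R size_sk (chain_hyb1 b ch1)).
Qed.

Lemma decide_diff rho b :
   decide (hyb S k sk L e (challenge true (run 0 (selG S k L e) rho))) [:: b] [:: b] -
   decide (hyb S k sk L e (challenge false (run 0 (selG S k L e) rho))) [:: b] [:: b] =
   (2^-1)%:C ^+ L * (decide (encs S k sk 0 N rho) [:: b] [:: b] -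
     decide (encs S k sk 0 N (zero_at (N * m) 0 rho)) [:: b] [:: b]).
Proof.
apply: (channel_diff (p := 0) (r := 0) channel_decide) => // x y.
rewrite !addn0 !add0n => sx sy; exact: hybrid.
Qed.

Definition select (b : bool) := trace_out (R := R) (if b then 0 else t * m)%N (t * m).

Lemma run_prepare b rho z z' w w' u u' : size z = (t * m)%N -> size z' = (t * m)%N ->
  size w = ((N - t) * m)%N -> size w' = ((N - t) * m)%N ->
  run 0 (prepare b) rho (z ++ w ++ u) (z' ++ w' ++ u') =
  ((w == nseq ((N - t) * m) false) && (w' == nseq ((N - t) * m) false))%:R *
  select b rho (z ++ u) (z' ++ u').
Proof.
move=> sz sz' sw sw'; rewrite /prepare run_cat run_Anc //; congr (_ * _).
rewrite /select; case: b.
  have := @run_Erase R 0 (t * m) rho [::] [::] (z ++ u) (z' ++ u') erefl erefl.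
  have := @trace_out_cat R 0 (t * m) rho [::] [::] (z ++ u) (z' ++ u') erefl erefl.
  by rewrite !cat0s => -> ->.
by rewrite run_Erase // trace_out_cat.
Qed.

(** Encrypting a padding slot and erasing the ciphertext preserves the trace, so it amounts to
    erasing the slot, and the slot was in state |0>. *)
Lemma discard_encs b rho :
  eqop (t * c + e) (run 0 discard (encs S k sk 0 N (run 0 (prepare b) rho)))
    (encs S k sk 0 t (select b rho)).
Proof.
move=> x y /size_cut2[z [u [-> sz su]]] /size_cut2[z' [u' [-> sz' su']]].
have -> sigma : encs S k sk 0 N sigma = encs S k sk (t * c) (N - t) (encs S k sk 0 t sigma).
  by rewrite -{1}(subnKC le_t) encsD add0n.
rewrite run_Erase //.
have [K _ hK] := channel_encs R size_sk t.
have hK0 sigma v v' : encs S k sk 0 t sigma (z ++ v) (z' ++ v') =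
    \sum_(a <- bits (t * m)) \sum_(a' <- bits (t * m))
      K z z' a a' * sigma (a ++ v) (a' ++ v').
  exact: (hK 0 sigma [::] [::] z z' v v' erefl erefl sz sz').
rewrite (channel_trace _ _ _ (channel_encs R size_sk (N - t)) sz sz').
rewrite (eq_sum_bits (F2 := fun w => (w == nseq ((N - t) * m) false)%:R *
   encs S k sk 0 t (select b rho) (z ++ u) (z' ++ u'))).
  by rewrite sum_bits_delta ?size_nseq.
move=> w sw; rewrite !hK0 mulr_sumr.
apply: eq_sum_bits => a sa; rewrite mulr_sumr; apply: eq_sum_bits => a' sa'.
by rewrite run_prepare // andbb mulrCA.
Qed.

Lemma decide_encs b rho : decide (encs S k sk 0 N (run 0 (prepare b) rho)) [:: b] [:: b] =
  runl S k sk 0 (adv_gates A2) (mult_challenge S k t sk b rho) [:: b] [:: b].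
Proof.
have := chain_adv A2T; rewrite sumn_ins => ch.
rewrite mult_challengeE.
exact: (channel_eqop (channel_runl R size_sk ch) (@discard_encs b rho)).
Qed.

(** Once all slots are zeroed, only the reduced state on E is left, and it does not depend on which
    list was discarded earlier. *)
Lemma zero_prepare b rho : eqop (N * m + e) (zero_at (N * m) 0 (run 0 (prepare b) rho))
  (zero_at (N * m) 0 (run 0 (prepare true) rho)).
Proof.
case: b => // x y /size_cut2[z [u [-> sz su]]] /size_cut2[z' [u' [-> sz' su']]].
rewrite !zero_at_cat //; congr (_ * _).
have -> : (N * m = t * m + (N - t) * m)%N by rewrite -mulnDl subnKC.
rewrite !sum_bits_cat.
have E b : \sum_(a <- bits (t * m)) \sum_(w <- bits ((N - t) * m))
   run 0 (prepare b) rho ((a ++ w) ++ u) ((a ++ w) ++ u') =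
   \sum_(a <- bits (t * m)) select b rho (a ++ u) (a ++ u').
  apply: eq_sum_bits => a sa.
  rewrite (eq_sum_bits (F2 := fun w => (w == nseq ((N - t) * m) false)%:R *
    select b rho (a ++ u) (a ++ u'))); first by rewrite sum_bits_delta ?size_nseq.
  by move=> w sw; rewrite -!catA run_prepare // andbb.
rewrite !E /select.
under eq_sum_bits => a sa do rewrite trace_out_cat //.
under [RHS]eq_sum_bits => a sa do
  rewrite -[a ++ u]cat0s -[a ++ u']cat0s trace_out_cat //.
by rewrite exchange_big.
Qed.

(** This is F_1(N) + F_0(N) = 1, weighted by the trace of [rho]: by [zero_prepare], the two terms
    are the two outcomes of one and the same run. *)
Lemma decide_zero rho :
  decide (encs S k sk 0 N (zero_at (N * m) 0 (run 0 (prepare true) rho)))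
    [:: true] [:: true] +
  decide (encs S k sk 0 N (zero_at (N * m) 0 (run 0 (prepare false) rho)))
    [:: false] [:: false] =
  trace (t * m + (t * m + e)) rho.
Proof.
have chE := channel_embed 0 e (channel_encs R size_sk N); rewrite !add0n in chE.
have chZ := channel_embed 0 e (channel_zero R (N * m)); rewrite !add0n in chZ.
have ch : channel (N * m + e) 1 (fun p (rho : operator) =>
    runl S k sk p (adv_gates A2) (run p discard (encs S k sk p N rho))).
  apply: channel_ext (channel_comp chE channel_decide) => p sigma.
  by rewrite addn0.
have chP := channel_comp (channel_run R (arity_prepare true)) chZ.
rewrite -(channel_trace0 rho (channel_comp chP ch)) /trace sum_bits1 big_bool.
congr (_ + _).
exact: (channel_eqop ch (@zero_prepare false rho)).
Qed.

Lemma trace1 (rho : operator) :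
  trace 1 rho = rho [:: true] [:: true] + rho [:: false] [:: false].
Proof. by rewrite /trace sum_bits1 big_bool. Qed.

Lemma Re_scale (al : R) (z : R[i]) : complex.Re (al%:C * z) = al * complex.Re z.
Proof. by case: z => x y /=; rewrite mul0r subr0. Qed.

Lemma hyb_outcomes b rho :
  let out r := runl S k sk 0 (hyb_gates2 b)
    (cpa_challenge S k sk r (runl S k sk 0 (hyb_gates1 b) rho)) in
  let rho0 := run 0 (prepare b) (runl S k sk 0 (adv_gates A1) rho) in
  \sum_(r : bool) complex.Re (out r [:: r] [:: r]) =
  complex.Re (trace (evk_len S k) rho) + 2^-1 ^+ L *
  (complex.Re (decide (encs S k sk 0 N rho0) [:: b] [:: b]) -
   complex.Re (decide (encs S k sk 0 N (zero_at (N * m) 0 rho0)) [:: b] [:: b])).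
Proof.
(* For r = 0, the weight of the answer 0 is the trace minus the weight of the answer 1. The winning
   weight is thus the trace plus the change in the weight of the answer 1 between r = 0 and r = 1,
   and [decide_diff] applies to this change. *)
move=> out rho0; have tr := trace_hyb b false rho; rewrite trace1 -/(out false) in tr.
rewrite big_bool /= -tr.
have h1 : out true [:: true] [:: true] - out false [:: true] [:: true] =
    (2^-1 ^+ L)%:C * (decide (encs S k sk 0 N rho0) [:: b] [:: b] -
      decide (encs S k sk 0 N (zero_at (N * m) 0 rho0)) [:: b] [:: b]).
  rewrite /out !run_hyb addTb negbK -/rho0 rmorphXn; exact: decide_diff.
have {}h1 := congr1 (@complex.Re R) h1; rewrite Re_scale !raddfB in h1.
by rewrite /= -h1 raddfD /=; ring.
Qed.

End Key.

Lemma win_hyb b B1 B2 : adv_gates B1 = hyb_gates1 b -> adv_gates B2 = hyb_gates2 b ->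
  let rho0 sk := run 0 (prepare b) (runl S k sk 0 (adv_gates A1) (evk_state R S k sk)) in
  win_prob S k (@cpa_challenge R S k) B1 B2 = 2^-1 + 2^-1 * (2^-1 ^+ L *
    \sum_(sk <- bits (sk_len S k))
      (complex.Re (decide sk (encs S k sk 0 N (rho0 sk)) [:: b] [:: b]) -
       complex.Re (decide sk (encs S k sk 0 N (zero_at (N * m) 0 (rho0 sk))) [:: b] [:: b]))).
Proof.
move=> gB1 gB2 rho0; rewrite win_probE gB1 gB2.
under eq_sum_bits => sk ssk do rewrite hyb_outcomes //.
rewrite big_split /= -mulr_sumr mulrDr; congr (_ + _).
by rewrite -raddf_sum trace_evk /= mulr1.
Qed.

(** The factor N cancels the factor 1/N of [hybrid]. The two all-zero terms add up to 1 by
    [decide_zero], and the terms without zeroing are the two halves of the multiple-message game by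
    [decide_encs]. *)
Lemma win_mult B1 B2 B1' B2' :
  adv_gates B1 = hyb_gates1 true -> adv_gates B2 = hyb_gates2 true ->
  adv_gates B1' = hyb_gates1 false -> adv_gates B2' = hyb_gates2 false ->
  win_prob S k (@mult_challenge R S k t) A1 A2 = 2^-1 +
    N%:R * (win_prob S k (@cpa_challenge R S k) B1 B2 - 2^-1) +
    N%:R * (win_prob S k (@cpa_challenge R S k) B1' B2' - 2^-1).
Proof.
move=> gB1 gB2 gB1' gB2'; rewrite (win_hyb gB1 gB2) (win_hyb gB1' gB2') win_probE.
have NK (z : R) : N%:R * (2^-1 * (2^-1 ^+ L * z)) = 2^-1 * z.
  by rewrite mulrCA natrX exprVn mulVKf // expf_neq0 // pnatr_eq0.
rewrite ![2^-1 + _ - _]addrAC !subrr !add0r !NK -addrA -mulrDr.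
rewrite -[X in _ = X + _]mulr1 -mulrDr; congr (_ * _).
have tr1 : \sum_(sk <- bits (sk_len S k))
    complex.Re (trace (evk_len S k) (evk_state R S k sk)) = 1.
  by rewrite -raddf_sum trace_evk.
rewrite -tr1 -!big_split; apply: eq_sum_bits => sk ssk.
rewrite big_bool -!(decide_encs ssk).
set rho := runl S k sk 0 (adv_gates A1) _.
have ch1 : chain S k (last 0%N (c_out A1.1)) (evk_len S k) (adv_gates A1)
    (t * m + (t * m + e)).
  by have := chain_adv_last A1T; rewrite sumn_outs /= addn0.
have := decide_zero ssk rho.
rewrite (channel_trace0 _ (channel_runl R ssk ch1)) => <-.
by rewrite raddfD /=; ring.
Qed.

End Reduction.

Local Close Scope complex_scope.
Local Close Scope ring_scope.

(** * Uniformity of the reduction *)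

Local Notation tree_gates := (tree_seq tree_gate).

(** Syntax-directed search: one closure lemma for each head symbol, and [pt_comp] for functions
    whose polynomial time is a hypothesis. *)
Ltac pt_hyp := match goal with
  | H : ptime _ _ ?h |- ptime _ _ ?h => exact H
  | H : ptime _ _ ?h |- ptime _ _ (fun g => ?h (@?f g)) =>
      refine (pt_comp (f := f) H _)
  end.

Ltac pt_step :=
  lazymatch goal with
  | |- ptime ?e _ (fun g => g) => exact (pt_id e)
  | |- ptime _ _ fst => exact (pt_fst (pt_id _))
  | |- ptime _ _ snd => exact (pt_snd (pt_id _))
  | |- ptime _ _ (fun _ => ?a) => exact (pt_const _ _ a)
  | |- ptime _ _ (fun g => (@?m g + @?n g)%N) => refine (@pt_addn _ _ m n _ _)
  | |- ptime _ _ (fun g => (@?m g * @?n g)%N) => refine (@pt_muln _ _ m n _ _)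
  | |- ptime _ _ (fun g => (@?m g - @?n g)%N) => refine (@pt_subn _ _ m n _ _)
  | |- ptime _ _ (fun g => (@?n g).-1) => refine (@pt_predn _ _ n _)
  | |- ptime _ _ (fun g => (@?n g).+1) => refine (@pt_succn _ _ n _)
  | |- ptime _ _ (fun g => @?s g ++ @?t g) => refine (@pt_cat _ _ _ _ s t _ _)
  | |- ptime _ _ (fun g => rev (@?s g)) => refine (@pt_rev _ _ _ _ s _)
  | |- ptime _ _ (fun g => nseq (@?n g) (@?x g)) => refine (@pt_nseq _ _ _ _ n x _ _)
  | |- ptime _ _ (fun g => flatten (@?s g)) => refine (@pt_flatten _ _ _ _ s _)
  | |- ptime _ _ (fun g => iota (@?m g) (@?n g)) => refine (@pt_iota _ _ m n _ _)
  | |- ptime _ _ (fun g => map (@?f g) (@?s g)) => refine (@pt_map _ _ _ _ _ _ f s _ _)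
  | |- ptime _ _ (fun g => @?x g :: @?s g) => refine (@pt_cons _ _ _ _ x s _ _)
  | |- ptime _ _ (fun g => (@?x g, @?y g)) => refine (@pt_pair _ _ _ _ _ _ x y _ _)
  | |- ptime _ _ (fun g => Circuit (@?x g) (@?y g) (@?z g)) =>
      refine (@pt_circuit _ _ x y z _ _ _)
  | |- ptime _ _ (fun g => Toffoli (@?x g) (@?y g) (@?z g)) =>
      refine (@pt_toffoli _ _ x y z _ _ _)
  | |- ptime _ _ (fun g => Swap (@?x g) (@?y g)) => refine (@pt_swap _ _ x y _ _)
  | |- ptime _ _ (fun g => Hadamard (@?x g)) => refine (@pt_hadamard _ _ x _)
  | |- ptime _ _ (fun g => Anc (@?x g)) => refine (@pt_anc _ _ x _)
  | |- ptime _ _ (fun g => Erase (@?x g)) => refine (@pt_erase _ _ x _)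
  | |- ptime _ _ (fun g => c_gates (@?x g)) => refine (@pt_c_gates _ _ x _)
  | |- ptime _ _ (fun g => c_in (@?x g)) => refine (@pt_c_in _ _ x _)
  | |- ptime _ _ (fun g => c_out (@?x g)) => refine (@pt_c_out _ _ x _)
  | |- ptime _ _ (fun g => (@?x g).1) => refine (@pt_fst _ _ _ _ _ _ x _)
  | |- ptime _ _ (fun g => (@?x g).2) => refine (@pt_snd _ _ _ _ _ _ x _)
  end.
Ltac pt := cbv beta; repeat (first [pt_hyp | pt_step]; cbv beta).

Lemma pt_on_head (G A : Type) (eG : G -> tree) (eA : A -> tree) (d : A) (F : G -> A -> A) s :
  ptime (tree_pair eG eA) eA (fun u => F u.1 u.2) ->
  ptime eG (tree_seq eA) s ->
  ptime eG (tree_seq eA)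
    (fun g => if s g is a :: l then F g a :: l else [::]).
Proof.
move=> hF hs; apply: (@pt_eq _ _ _ _ (fun g =>
  if size (s g) == 0 then [::] else F g (head d (s g)) :: behead (s g))).
  by move=> g; case: (s g).
apply: pt_if0; [exact: pt_size hs | exact: pt_const |].
apply: pt_cons; last exact: pt_behead.
apply: (pt_comp (f := fun g => (g, head d (s g))) hF); apply: pt_pair; first exact: pt_id.
by apply: pt_head hs; apply: pt_const.
Qed.

(** The interior circuits form a plain map; only the input of the first circuit and the output of
    the last one deviate. The tuple is thus obtained from a map by [pt_on_head], applied to the list
    and to its reverse. *)
Lemma mk_circuits_rcons X I O Y s g :
  mk_circuits I I O Y (rcons s g) =
  rcons [seq Circuit I h O | h <- s] (Circuit I g Y) /\
  mk_circuits X I O Y (rcons s g) =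
  if rcons [seq Circuit I h O | h <- s] (Circuit I g Y) is C :: l then
    Circuit X (c_gates C) (c_out C) :: l else [::].
Proof.
have h1 : mk_circuits I I O Y (rcons s g) =
    rcons [seq Circuit I h O | h <- s] (Circuit I g Y).
  by elim: s => //= h s ->; case: s.
split=> //; case: s h1 => //= h s [e ->].
by case: s e.
Qed.

Section PolyTime.
Variables (G : Type) (eG : G -> tree).

Lemma pt_mk_adv X I O Y gs :
  ptime eG (tree_seq tree_nat) X -> ptime eG (tree_seq tree_nat) I ->
  ptime eG (tree_seq tree_nat) O -> ptime eG (tree_seq tree_nat) Y ->
  ptime eG (tree_seq tree_gates) gs ->
  ptime eG tree_oracle_adversary (fun g => mk_adv (X g) (I g) (O g) (Y g) (gs g)).
Proof.
move=> hX hI hO hY hgs.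
have h : ptime eG (tree_seq tree_circuit) (fun g =>
    mk_circuits (X g) (I g) (O g) (Y g) (gs g)).
  pose setY g C := Circuit (c_in C) (c_gates C) (Y g).
  pose setX g C := Circuit (X g) (c_gates C) (c_out C).
  pose s g := [seq Circuit (I g) h (O g) | h <- gs g].
  pose s1 g := if rev (s g) is C :: l then setY g C :: l else [::].
  apply: (@pt_eq _ _ _ _ (fun g =>
    if rev (s1 g) is C :: l then setX g C :: l else [::])).
    move=> g; rewrite /s1 /s; case/lastP: (gs g) => // l h.
    rewrite map_rcons rev_rcons rev_cons revK.
    by have [_ ->] := mk_circuits_rcons (X g) (I g) (O g) (Y g) l h.
  have d := Circuit [::] [::] [::].
  apply: (pt_on_head d (F := setX)); first by rewrite /setX; pt.
  apply: pt_rev; apply: (pt_on_head d (F := setY)); first by rewrite /setY; pt.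
  by rewrite /s; pt.
apply: pt_pair; last exact: pt_behead.
by apply: pt_head h; pt.
Qed.

Lemma pt_adv_gates A : ptime eG tree_oracle_adversary A ->
  ptime eG (tree_seq tree_gates) (fun g => adv_gates (A g)).
Proof.
move=> hA; rewrite /adv_gates; apply: pt_map; first by pt.
by apply: pt_cons; [apply: pt_fst hA | apply: pt_snd hA].
Qed.

End PolyTime.

Lemma glueE l1 l2 : glue l1 l2 = if size l1 == 0 then l2 else
  rev (behead (rev l1)) ++ ((last [::] l1 ++ head [::] l2) :: behead l2).
Proof.
case/lastP: l1 => // l g; rewrite size_rcons /= rev_rcons /= revK last_rcons.
elim: l => [|h l IH] /=; first by case: l2 => //=; rewrite cats0.
by rewrite IH; case: l {IH}.
Qed.

(** Subadditivity bounds the growth at each step of the fold in [glues]. *)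
Lemma tsize_glue (l1 l2 : seq (seq gate)) : tsize (tree_seq tree_gates (glue l1 l2)) <=
  tsize (tree_seq tree_gates l1) + tsize (tree_seq tree_gates l2).
Proof.
elim: l1 => [|g [|h s] IH]; first by rewrite /=; lia.
  by case: l2 {IH} => [|h t] /=; rewrite ?cats0; last (have := tsize_cat tree_gate g h); lia.
by move: IH; rewrite [glue (g :: _) _]/= -/(glue (h :: s) l2) /=; lia.
Qed.

Lemma pt_glue (G : Type) (eG : G -> tree)
    l1 l2 : ptime eG (tree_seq tree_gates) l1 ->
  ptime eG (tree_seq tree_gates) l2 ->
  ptime eG (tree_seq tree_gates) (fun g => glue (l1 g) (l2 g)).
Proof.
move=> h1 h2; apply: (pt_eq (fun g => esym (glueE (l1 g) (l2 g)))).
apply: pt_if0; [exact: pt_size h1 | exact: h2 |].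
apply: pt_cat; first by apply: pt_rev; apply: pt_behead; apply: pt_rev.
apply: pt_cons; last exact: pt_behead.
by apply: pt_cat; [apply: pt_last h1 | apply: pt_head h2]; apply: pt_const.
Qed.

Lemma pt_glues (G : Type) (eG : G -> tree)
    ps : ptime eG (tree_seq (tree_seq tree_gates)) ps ->
  ptime eG (tree_seq tree_gates) (fun g => glues (ps g)).
Proof.
move=> hps; have [q hq] := ptime_tsize hps.
apply: (@pt_foldl_inc _ _ _ _ _ _ (fun _ => glue) _ _ _ hps (pt_const _ _ _)).
  by apply: pt_glue; pt.
exists (fun n => q.[n]%R); first by polyb.
move=> g b a le_a; apply: leq_trans (tsize_glue _ _) _.
by rewrite leq_add2l (leq_trans le_a).
Qed.

Section Gadgets.
Variables (G : Type) (eG : G -> tree).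
Local Notation ptn := (ptime eG tree_nat).
Local Notation ptg := (ptime eG tree_gates).

Lemma pt_pull r : ptn r -> ptg (fun g => pull (r g)).
Proof. by move=> hr; rewrite /pull; pt. Qed.

Lemma pt_push r : ptn r -> ptg (fun g => push (r g)).
Proof. by move=> hr; rewrite /push; pt. Qed.

Lemma pt_block_swap T p q n : ptn T -> ptn p -> ptn q -> ptn n ->
  ptg (fun g => block_swap (T g) (p g) (q g) (n g)).
Proof. by move=> hT hp hq hn; rewrite /block_swap /controlled_swap; pt. Qed.

Lemma pt_sel n e : ptn n -> ptn e -> ptg (fun g => sel (n g) (e g)).
Proof.
move=> hn he; rewrite /sel /=.
by do 2!(apply: pt_cons; first by pt); do !(apply: pt_cat); try apply: pt_block_swap; pt.
Qed.

Lemma pt_unsel n e : ptn n -> ptn e -> ptg (fun g => unsel (n g) (e g)).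
Proof.
move=> hn he; apply: (@pt_eq _ _ _ _ (fun g =>
  block_swap (n g + n g + e g) 0 (n g) (n g) ++ [:: Erase (n g + n g + e g)])).
  by move=> g; rewrite cats1.
by apply: pt_cat; try apply: pt_block_swap; pt.
Qed.

End Gadgets.

(** The lengths of the registers are computable because they can be read off a circuit of the
    scheme, which is itself printed in polynomial time. *)
Lemma pt_msg_len S : ptime tree_nat tree_nat (msg_len S).
Proof.
have h : ptime tree_nat tree_circuit (enc S) by apply: enc_poly.
apply: (@pt_eq _ _ _ _ (fun k => head 0 (behead (c_in (enc S k))))).
  by move=> k; have [-> _ _] := encT S k.
by apply: pt_head; [pt | apply: pt_behead; pt].
Qed.

Lemma pt_ct_len S : ptime tree_nat tree_nat (ct_len S).
Proof.
have h : ptime tree_nat tree_circuit (enc S) by apply: enc_poly.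
apply: (@pt_eq _ _ _ _ (fun k => head 0 (c_out (enc S k)))).
  by move=> k; have [_ -> _] := encT S k.
by apply: pt_head; pt.
Qed.

Lemma pt_evk_len S : ptime tree_nat tree_nat (evk_len S).
Proof.
have h : ptime tree_nat tree_circuit (keygen S) by apply: keygen_poly.
apply: (@pt_eq _ _ _ _ (fun k => head 0 (behead (c_out (keygen S k))))).
  by move=> k; have [_ -> _] := keygenT S k.
by apply: pt_head; [pt | apply: pt_behead; pt].
Qed.

Section Calls.
Variables (G : Type) (eG : G -> tree) (S : qhe) (kappa W p v : G -> nat).
Hypotheses (hk : ptime eG tree_nat kappa) (hW : ptime eG tree_nat W).
Hypotheses (hp : ptime eG tree_nat p) (hv : ptime eG tree_nat v).

Lemma pt_front : ptime eG tree_gates (fun g => front S (kappa g) (W g) (p g) (v g)).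
Proof.
have hm := pt_msg_len S; rewrite /front; apply: pt_cat; last by pt.
by apply: pt_flatten; apply: pt_nseq; [pt | apply: pt_pull; pt].
Qed.

Lemma pt_back : ptime eG tree_gates (fun g => back S (kappa g) (W g) (p g) (v g)).
Proof.
have hc := pt_ct_len S; rewrite /back; apply: pt_cat; first by pt.
by apply: pt_flatten; apply: pt_nseq; [pt | apply: pt_push; pt].
Qed.

Lemma pt_call :
  ptime eG (tree_seq tree_gates) (fun g => call S (kappa g) (W g) (p g) (v g)).
Proof. by have h1 := pt_front; have h2 := pt_back; rewrite /call; pt. Qed.

End Calls.

Lemma pt_level (G : Type) (eG : G -> tree) S kappa W h e :
  ptime eG tree_nat kappa -> ptime eG tree_nat W -> ptime eG tree_nat h ->
  ptime eG tree_nat e ->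
  ptime eG (tree_seq (tree_seq tree_gates))
    (fun g => level S (kappa g) (W g) (h g) (e g)).
Proof.
move=> hk hW hh he; have hm := pt_msg_len S; have hc := pt_ct_len S.
apply: (@pt_eq _ _ _ _ (fun g =>
  [seq call S (kappa g) (W g) (i * ct_len S (kappa g))
     (i * ct_len S (kappa g) + (h g + h g - i.+1) * msg_len S (kappa g) + e g).+1
  | i <- iota (h g) (h g)] ++ [:: [:: unsel (h g * ct_len S (kappa g)) (e g)]])).
  by move=> g; rewrite cats1.
apply: pt_cat; last by apply: pt_cons; [apply: pt_cons; [apply: pt_unsel|]|]; pt.
by apply: pt_map; [apply: pt_call|]; pt.
Qed.

Definition levels L := [seq (l, 2 ^ l) | l <- iota 0 L].

Lemma levelsS L : levels L.+1 = rcons (levels L) (L, 2 ^ L).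
Proof. by rewrite /levels -[L.+1]addn1 iotaD map_cat cats1. Qed.

Lemma mem_levels L p : p \in levels L -> p.1 < L /\ p.2 + p.2 <= 2 ^ L.
Proof.
case/mapP => l; rewrite mem_iota => lt_l -> /=; split; first by lia.
by rewrite addnn -mul2n -expnS leq_exp2l //; lia.
Qed.

(* Closed form of the number of wires that follow the active slots at level   *)
(* [p = (l, 2 ^ l)] in the recursive definitions of [selG] and [slots].       *)
Definition level_rest m L e p := (2 ^ L - (p.2 + p.2)) * m + e + (L - p.1.+1).

Lemma level_restS m L e p : p \in levels L ->
  level_rest m L (2 ^ L * m + e).+1 p = level_rest m L.+1 e p.
Proof.
move=> /mem_levels[lt_p le_p]; rewrite /level_rest expnS.
have -> : 2 * 2 ^ L - (p.2 + p.2) = (2 ^ L - (p.2 + p.2)) + 2 ^ L by lia.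
rewrite mulnDl; clear le_p; case: p lt_p => l h /= lt_p.
by rewrite subSS -(subnSK lt_p); set a := (_ * m); set b := (_ * m); lia.
Qed.

Lemma level_rest_top m L e : level_rest m L.+1 e (L, 2 ^ L) = e.
Proof. by rewrite /level_rest /= expnS mul2n -addnn !subnn mul0n addn0. Qed.

(** The recursion changes its parameter [e] at each level. With the closed form [level_rest] in its
    place, the gates become a map over the levels, to which [pt_map] applies. *)
Lemma selG_levels S k L e : selG S k L e =
  flatten [seq sel (p.2 * msg_len S k) (level_rest (msg_len S k) L e p)
          | p <- rev (levels L)].
Proof.
elim: L e => [|L IH] e //; rewrite levelsS rev_rcons map_cons level_rest_top.
transitivity (sel (2 ^ L * msg_len S k) e ++ selG S k L (2 ^ L * msg_len S k + e).+1) => //.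
rewrite IH; apply: (congr1 (fun s => sel (2 ^ L * msg_len S k) e ++ flatten s)).
apply/eq_in_map => p; rewrite mem_rev => hp.
by rewrite level_restS.
Qed.

Lemma slots_levels S k W L e : slots S k W L e =
  flatten [seq level S k W p.2 (level_rest (msg_len S k) L e p) | p <- levels L].
Proof.
elim: L e => [|L IH] e //; rewrite levelsS map_rcons flatten_rcons level_rest_top.
rewrite [LHS]/(slots _ _ _ _ _ ++ _) IH; congr (_ ++ _); apply: (congr1 flatten).
apply/eq_in_map => p hp.
by rewrite level_restS.
Qed.

Lemma up_log_le t : up_log 2 t <= t.
Proof. by apply: up_log_min => //; apply: ltnW; apply: ltn_expl. Qed.

(** Half of the least power of two above is still smaller than [t] when [t > 1]; the successor
    accounts for [t = 0], where the power is 1. *)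
Lemma exp_up_log_le t : 2 ^ up_log 2 t <= (2 * t).+1.
Proof.
case: (leqP t 1) => [|lt_t]; first by case: t => [|[]].
have h := up_log_gtn (ltnSn 1) lt_t.
have L_gt0 : 0 < up_log 2 t by rewrite up_log_gt0.
by rewrite -(prednK L_gt0) expnS; lia.
Qed.

(** The power is doubled until it reaches [t]. By [up_log_le], [t] rounds are enough, and the state
    is stationary afterwards. *)
Lemma pt_levels (G : Type) (eG : G -> tree) t : ptime eG tree_nat t ->
  ptime eG (tree_seq (tree_pair tree_nat tree_nat)) (fun g => levels (up_log 2 (t g))) /\
  ptime eG tree_nat (fun g => 2 ^ up_log 2 (t g)).
Proof.
(* Truncated subtraction provides the comparison: the difference is 0 exactly when [t g <= st.2]. *)
move=> ht; pose F g (st : seq (nat * nat) * nat) (_ : unit) :=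
  if t g - st.2 == 0 then st else (st.1 ++ [:: (size st.1, st.2)], st.2 + st.2).
have FE g i : foldl (F g) ([::], 1) (nseq i tt) =
    (levels (minn i (up_log 2 (t g))), 2 ^ minn i (up_log 2 (t g))).
  elim: i => [|i IH]; first by rewrite min0n.
  have -> : nseq i.+1 tt = nseq i tt ++ [:: tt] by rewrite -[i.+1]addn1 nseqD.
  rewrite foldl_cat IH /= /F /=.
  have -> : (t g - 2 ^ minn i (up_log 2 (t g)) == 0) = (up_log 2 (t g) <= i).
    rewrite subn_eq0; apply/idP/idP => [h|le_i].
      by have := up_log_min (ltnSn 1) h; lia.
    by have -> : minn i (up_log 2 (t g)) = up_log 2 (t g); [lia | apply: up_logP].
  case: (boolP (up_log 2 (t g) <= i)) => [le_i|]; last rewrite -ltnNge => lt_i.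
    by have -> : minn i.+1 (up_log 2 (t g)) = minn i (up_log 2 (t g)) by lia.
  have -> : minn i.+1 (up_log 2 (t g)) = i.+1 by lia.
  have -> : minn i (up_log 2 (t g)) = i by lia.
  rewrite levelsS cats1 /levels size_map size_iota; congr (_, _).
  by rewrite expnS mul2n addnn.
have hF : ptime eG (tree_pair (tree_seq (tree_pair tree_nat tree_nat)) tree_nat)
    (fun g => foldl (F g) ([::], 1) (nseq (t g) tt)).
  apply: (pt_foldl _ (pt_unary ht) (pt_const _ _ _)).
    apply: pt_if0; [by pt | by pt |].
    apply: pt_pair; last by pt.
    apply: pt_cat; first by pt.
    apply: pt_cons; last by pt.
    apply: pt_pair; last by pt.
    by apply: pt_size; pt.
  have [q hq] := ptime_tsize ht.
  suff [p hp] : polybnd (fun n => (q.[n]%R * (6 * q.[n]%R + 10)) + 4 * q.[n]%R + 10).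
    exists p => g i; apply: leq_trans (hp _).
    have [j ->] : exists j, take i (nseq (t g) tt) = nseq j tt.
      have [le_i | /ltnW lt_i] := leqP i (t g); first by exists i; rewrite take_nseq.
      by exists (t g); rewrite take_oversize ?size_nseq.
    rewrite FE; set l := minn _ _.
    have le_l : l <= up_log 2 (t g) by rewrite geq_minr.
    have le_t : t g <= q.[tsize (eG g)]%R by have := hq g; rewrite tsize_nat; lia.
    have le_L := leq_trans le_l (up_log_le (t g)).
    have le_exp i' : i' <= l -> 2 ^ i' <= (2 * q.[tsize (eG g)]%R).+1.
      move=> le_i'; apply: leq_trans (leq_trans _ (exp_up_log_le (t g))) _; last by lia.
      by rewrite leq_exp2l // (leq_trans le_i').
    have le_exp_l := le_exp _ (leqnn l).
    have szl : tsize (tree_seq (tree_pair tree_nat tree_nat) (levels l)) <=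
        (l * (6 * q.[tsize (eG g)]%R + 9).+1).+1.
      apply: leq_trans (tsize_seq_le (M := 6 * q.[tsize (eG g)]%R + 9) _) _.
        apply/allP => _ /mapP[j' + ->]; rewrite mem_iota => lt_j' /=.
        by rewrite !tsize_nat; have := le_exp j'; lia.
      by rewrite size_map size_iota.
    rewrite /= tsize_nat; move: szl le_exp_l le_L le_t.
    move: (tsize (tree_seq _ _)) (2 ^ l) (q.[_])%R => s1 s2 s3; nia.
  by polyb.
split.
  apply: pt_eq (pt_fst hF) => g; rewrite FE /=; congr levels.
  by apply/minn_idPr; apply: up_log_le.
apply: pt_eq (pt_snd hF) => g; rewrite FE /=; congr expn.
by apply/minn_idPr; apply: up_log_le.
Qed.

Section Hybrids.
Variables (S : qhe) (t e e2 : nat -> nat) (A1 A2 : nat -> oracle_adversary) (b : bool).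
Hypotheses (pt_t : ptime tree_nat tree_nat t) (pt_e : ptime tree_nat tree_nat e).
Hypothesis pt_e2 : ptime tree_nat tree_nat e2.
Hypothesis pt_A1 : ptime tree_nat tree_oracle_adversary A1.
Hypothesis pt_A2 : ptime tree_nat tree_oracle_adversary A2.
Local Notation L k := (up_log 2 (t k)).

Lemma pt_levels_data : [/\
  ptime tree_nat (tree_seq (tree_pair tree_nat tree_nat)) (fun k => levels (L k)),
  ptime tree_nat tree_nat (fun k => 2 ^ L k) & ptime tree_nat tree_nat (fun k => L k)].
Proof.
have [h1 h2] := pt_levels pt_t; split=> //.
by apply: pt_eq (pt_size h1) => k; rewrite size_map size_iota.
Qed.

Lemma pt_privsize : ptime tree_nat tree_nat (fun k => privsize S k (e k) (e2 k) (L k)).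
Proof.
have [_ h2 h3] := pt_levels_data; have hm := pt_msg_len S; have hc := pt_ct_len S.
by rewrite /privsize; pt.
Qed.

Lemma pt_rest : ptime tree_nat tree_nat (fun k => rest S k (e k) (L k)).
Proof.
have [_ h2 h3] := pt_levels_data; have hm := pt_msg_len S.
by rewrite /rest; pt.
Qed.

Lemma pt_level_rest (G : Type) (eG : G -> tree)
    (kappa : G -> nat) (p : G -> nat * nat) :
  ptime eG tree_nat kappa -> ptime eG (tree_pair tree_nat tree_nat) p ->
  ptime eG tree_nat (fun g =>
    level_rest (msg_len S (kappa g)) (L (kappa g)) (e (kappa g)) (p g)).
Proof.
move=> hk hp; have [_ h2 h3] := pt_levels_data; have hm := pt_msg_len S.
rewrite /level_rest.
have h2' := pt_comp h2 hk; have h3' := pt_comp h3 hk.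
by pt.
Qed.

Lemma pt_hyb_gates1 : ptime tree_nat (tree_seq tree_gates)
  (fun k => hyb_gates1 S k (t k) (e k) (e2 k) (L k) (A1 k) b).
Proof.
have [h1 h2 h3] := pt_levels_data; have hm := pt_msg_len S.
have hW := pt_privsize; have hr := pt_rest.
rewrite /hyb_gates1; apply: pt_glue; first exact: pt_adv_gates.
apply: pt_cons; last exact: pt_const.
apply: pt_cat; first by rewrite /prepare; case: b => /=; pt.
apply: pt_cat; last by apply: pt_front; pt.
apply: (@pt_eq _ _ _ _ (fun k => flatten [seq sel (p.2 * msg_len S k)
  (level_rest (msg_len S k) (L k) (e k) p) | p <- rev (levels (L k))])).
  by move=> k; rewrite selG_levels.
apply: pt_flatten; apply: pt_map; last by pt.
by apply: pt_sel; [pt | apply: pt_level_rest; pt].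
Qed.

Lemma pt_repad W gs : ptime tree_nat tree_nat W ->
  ptime tree_nat (tree_seq tree_gates) gs ->
  ptime tree_nat (tree_seq (tree_seq tree_gates))
    (fun k => repad S k (W k) (e2 k) (gs k)).
Proof.
move=> hW hgs; apply: (@pt_eq _ _ _ _ (fun k =>
  if size (gs k) == 0 then [::] else [:: head [::] (gs k)] ::
   flatten [seq [:: call S k (W k) 0 (e2 k); [:: h]] | h <- behead (gs k)])).
  by move=> k; case: (gs k).
apply: pt_if0; [exact: pt_size hgs | exact: pt_const | apply: pt_cons].
  by apply: pt_cons; [apply: pt_head hgs; apply: pt_const | apply: pt_const].
apply: pt_flatten; apply: pt_map; last exact: pt_behead hgs.
by apply: pt_cons; [apply: pt_call; pt | pt].
Qed.

Lemma pt_hyb_gates2 : ptime tree_nat (tree_seq tree_gates)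
  (fun k => hyb_gates2 S k (t k) (e k) (e2 k) (L k) (A2 k) b).
Proof.
have [h1 h2 h3] := pt_levels_data; have hc := pt_ct_len S.
have hW := pt_privsize; have hr := pt_rest.
rewrite /hyb_gates2; apply: pt_glues; apply: pt_cat.
  by do 2!(apply: pt_cons; last by exact: pt_const); apply: pt_back; pt.
apply: pt_cat.
  apply: (@pt_eq _ _ _ _ (fun k => flatten [seq
    level S k (privsize S k (e k) (e2 k) (L k)) p.2
      (level_rest (msg_len S k) (L k) (e k) p) | p <- levels (L k)])).
    by move=> k; rewrite slots_levels.
  apply: pt_flatten; apply: pt_map; last by pt.
  apply: pt_level; try by pt.
    by apply: (pt_comp hW); pt.
  by apply: pt_level_rest; pt.
apply: pt_cat; first by rewrite /discard; pt.
by apply: pt_cat; [apply: pt_repad => //; apply: pt_adv_gates | apply: pt_const].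
Qed.

End Hybrids.

Local Open Scope ring_scope.

(** * Negligible functions and the two implications *)

Lemma horner_nat_real (R : realType) (p : {poly nat}) :
  exists P : {poly R}, forall n : nat, P.[n%:R] = (p.[n])%:R.
Proof.
elim/poly_ind: p => [|p c [P hP]]; first by exists 0 => n; rewrite !horner0.
by exists (P * 'X + c%:R%:P) => n; rewrite !hornerMXaddC hP natrD natrM.
Qed.

Lemma negligible_sum (R : realType) (N : nat -> nat) (p : {poly nat})
    (eta eta' : nat -> R) :
  (forall k, (N k <= p.[k])%N) -> negligible eta -> negligible eta' ->
  negligible (fun k => (N k)%:R * eta k + (N k)%:R * eta' k).
Proof.
move=> le_N neg neg' q q_gt0; have [P hP] := horner_nat_real R p.
(* When both functions are below 1/Q, the weighted sum is at most 2p/((1 + 2p)q), hence below 1/q.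
   The summand 1 keeps [Q] positive where [p] vanishes. *)
pose Q := (1 + P *+ 2) * q.
have QE (n : nat) : Q.[n%:R] = (1 + 2 * (p.[n])%:R) * q.[n%:R].
  by rewrite /Q hornerM hornerD hornerMn hP hornerC mulr_natl.
have Q_gt0 (n : nat) : 0 < Q.[n%:R].
  by rewrite QE mulr_gt0 // ltr_pwDl // mulr_ge0 // ler0n.
have [M1 h1] := neg _ Q_gt0; have [M2 h2] := neg' _ Q_gt0.
exists (maxn M1 M2) => n; rewrite gtn_max => /andP[/h1 + /h2]; rewrite QE.
set d := 1 / _ => lt1 lt2.
have dE : d * (1 + 2 * (p.[n])%:R) = 1 / q.[n%:R].
  rewrite /d !div1r invfM mulrAC mulVf ?mul1r //.
  by rewrite gt_eqF // ltr_pwDl // mulr_ge0 // ler0n.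
have d_gt0 : 0 < d by rewrite /d -QE divr_gt0.
rewrite -dE.
have N_ge0 : 0 <= (N n)%:R :> R by rewrite ler0n.
have le_Nn : (N n)%:R <= (p.[n])%:R :> R by rewrite ler_nat.
by nra.
Qed.

(** The private size that comes with an adversary is an arbitrary function of k, whereas this value
    is computable by [pt_last_out], so that the reduction can use it. *)
Lemma adv_last_out S k e X Y A : adv_from_to S k e X Y A ->
  adv_from_to S k (last 0%N (c_out A.1)) X Y A.
Proof.
by case: A => A [|B s] //; case=> [[h1 h2 h3] h4]; rewrite /= h2.
Qed.

Lemma adv_in S k e X Y A : adv_from_to S k e X Y A -> c_in A.1 = X.
Proof. by case: A => A [|B s]; [case | case=> -[]]. Qed.

Lemma pt_last_out A : ptime tree_nat tree_oracle_adversary A ->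
  ptime tree_nat tree_nat (fun k => last 0%N (c_out (A k).1)).
Proof.
move=> hA; apply: pt_last; first exact: pt_const.
by apply: pt_c_out; apply: pt_fst hA.
Qed.

Lemma q_ind_cpa_mult_cpa (R : realType) (S : qhe) : q_ind_cpa_mult R S -> q_ind_cpa R S.
Proof.
move=> hmult e e1 e2 A1 A2 A1T A2T pA1 pA2.
have {}pA1 : ptime tree_nat tree_oracle_adversary A1 by [].
have {}pA2 : ptime tree_nat tree_oracle_adversary A2 by [].
have hm := pt_msg_len S; have hc := pt_ct_len S; have hv := pt_evk_len S.
pose e1' k := last 0%N (c_out (A1 k).1).
have pe1 : ptime tree_nat tree_nat e1' := pt_last_out pA1.
have pe : ptime tree_nat tree_nat e.
  apply: (@pt_eq _ _ _ _ (fun k => last 0%N (c_in (A2 k).1))).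
    by move=> k; rewrite (adv_in (A2T k)).
  by apply: pt_last; [exact: pt_const | apply: pt_c_in; apply: pt_fst pA2].
(* Here t = 1: the new zero register in front is M_0, and the submitted message becomes M_1. *)
pose gs k := glue (adv_gates (A1 k)) [:: nseq (msg_len S k) (Anc 0)].
pose Y k := [:: msg_len S k; msg_len S k; e k].
pose B1 k := mk_adv [:: evk_len S k] [:: ct_len S k; e1' k] [:: msg_len S k; e1' k]
  (Y k) (gs k).
have ch k : chain S k (e1' k) (evk_len S k) (gs k) (msg_len S k + (msg_len S k + e k)).
  have ch0 : chain S k (e1' k) (evk_len S k) (adv_gates (A1 k)) (msg_len S k + e k).
    by have := chain_adv_last (A1T k); rewrite /= !addn0.
  by apply: (chain_glue ch0); rewrite /= [in RHS]addnC; apply: gates_arity_Anc.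
have B1T k : adv_from_to S k (e1' k) [:: evk_len S k] (Y k) (B1 k).
  by apply: adv_mk_adv; rewrite /= !addn0; apply: ch.
have [||||||eta neg h] := hmult (fun=> 1%N) e e1' e2 B1 A2 => //.
- by exists 1%:P => k; rewrite hornerC.
- apply: pt_mk_adv; rewrite /Y; try by pt.
  by apply: pt_glue; [apply: pt_adv_gates | pt].
exists eta => // k; apply: le_trans (h k); rewrite le_eqVlt; apply/orP; left; apply/eqP.
apply: eq_win_prob => sk r ssk.
have -> : adv_gates (B1 k) = gs k.
  apply: adv_gates_mk_adv => gs0; have := ch k; by rewrite gs0.
rewrite runl_glue [runl S k sk 0 [:: _] _]/=.
have := chain_adv (A2T k); rewrite [sumn _]/= addn0 => ch2.
symmetry; apply: (channel_eqop (channel_runl R ssk ch2)) => //.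
exact: mult1_cpa.
Qed.

Lemma q_ind_cpa_cpa_mult (R : realType) (S : qhe) : q_ind_cpa R S -> q_ind_cpa_mult R S.
Proof.
move=> hcpa t e e1 e2 A1 A2 t_gt0 [p le_t] A1T A2T pA1 pA2.
have {}pA1 : ptime tree_nat tree_oracle_adversary A1 by [].
have {}pA2 : ptime tree_nat tree_oracle_adversary A2 by [].
have hm := pt_msg_len S; have hc := pt_ct_len S; have hv := pt_evk_len S.
pose e1' k := last 0%N (c_out (A1 k).1); pose e2' k := last 0%N (c_out (A2 k).1).
have pe1 : ptime tree_nat tree_nat e1' := pt_last_out pA1.
have pe2 : ptime tree_nat tree_nat e2' := pt_last_out pA2.
have pin : ptime tree_nat (tree_seq tree_nat) (fun k => c_in (A2 k).1).
  by apply: pt_c_in; apply: pt_fst pA2.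
have pe : ptime tree_nat tree_nat e.
  apply: (@pt_eq _ _ _ _ (fun k => last 0%N (c_in (A2 k).1))).
    by move=> k; rewrite (adv_in (A2T k)) last_cat.
  by apply: pt_last pin; apply: pt_const.
(* The number of messages is recovered from the second adversary, whose inputs are the t ciphertexts
   and the register E. *)
have pt_t : ptime tree_nat tree_nat t.
  apply: (@pt_eq _ _ _ _ (fun k => (size (c_in (A2 k).1)).-1)).
    by move=> k; rewrite (adv_in (A2T k)) size_cat size_nseq addn1.
  by apply: pt_predn; apply: pt_size pin.
pose L k := up_log 2 (t k); pose W k := privsize S k (e k) (e2' k) (L k).
have le_tN k : (t k <= 2 ^ L k)%N by apply: up_logP.
have A2T' k := adv_last_out (A2T k).
pose gs1 b k := hyb_gates1 S k (t k) (e k) (e2' k) (L k) (A1 k) b.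
pose gs2 b k := hyb_gates2 S k (t k) (e k) (e2' k) (L k) (A2 k) b.
pose B1 b k := mk_adv [:: evk_len S k] [:: ct_len S k; e1' k] [:: msg_len S k; e1' k]
  [:: msg_len S k; W k] (gs1 b k).
pose B2 b k := mk_adv [:: ct_len S k; W k] [:: ct_len S k; W k] [:: msg_len S k; W k]
  [:: 1%N] (gs2 b k).
have ch1 b k : chain S k (e1' k) (evk_len S k) (gs1 b k) (msg_len S k + W k).
  apply: chain_hyb1 => //.
  by have := chain_adv_last (A1T k); rewrite sumn_outs /= addn0.
have ch2 b k : chain S k (W k) (ct_len S k + W k) (gs2 b k) 1.
  (* The typing is obtained from [implements], which refers to a key; any string of the right length
     serves. *)
  exact: (@chain_hyb2 R S k _ _ _ _ _ (le_tN k) (A2T' k) (nseq (sk_len S k) false)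
    b (size_nseq _ _)).
have g1 b k : adv_gates (B1 b k) = gs1 b k.
  by apply: adv_gates_mk_adv => gs0; have := ch1 b k; rewrite gs0.
have g2 b k : adv_gates (B2 b k) = gs2 b k.
  by apply: adv_gates_mk_adv => gs0; have := ch2 b k; rewrite gs0.
have B1T b k : adv_from_to S k (e1' k) [:: evk_len S k] [:: msg_len S k; W k] (B1 b k).
  by apply: adv_mk_adv; rewrite /= !addn0; apply: ch1.
have B2T b k : adv_from_to S k (W k) [:: ct_len S k; W k] [:: 1%N] (B2 b k).
  by apply: adv_mk_adv; rewrite /= !addn0; apply: ch2.
have pW : ptime tree_nat tree_nat W by apply: pt_privsize.
have pB1 b : uniform tree_oracle_adversary (B1 b).
  by apply: pt_mk_adv; try (by pt); apply: pt_hyb_gates1.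
have pB2 b : uniform tree_oracle_adversary (B2 b).
  by apply: pt_mk_adv; try (by pt); apply: pt_hyb_gates2.
have [eta neg h] := hcpa W e1' W _ _ (B1T true) (B2T true) (pB1 true) (pB2 true).
have [eta' neg' h'] := hcpa W e1' W _ _ (B1T false) (B2T false) (pB1 false) (pB2 false).
exists (fun k => (2 ^ L k)%:R * eta k + (2 ^ L k)%:R * eta' k).
  (* The polynomial 2p + 1 comes from [exp_up_log_le] and the bound [p] on [t]. *)
  apply: (@negligible_sum R (fun k => 2 ^ L k)%N (p *+ 2 + 1%:P)) => // k.
  rewrite hornerD hornerMn hornerC; apply: leq_trans (exp_up_log_le _) _.
  by have := le_t k; rewrite -mulr_natl; lia.
move=> k; rewrite (win_mult R (le_tN k) (A1T k) (A2T' k) (g1 true k) (g2 true k)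
  (g1 false k) (g2 false k)).
rewrite -addrA lerD2l lerD // ler_wpM2l ?ler0n // lerBlDl; [exact: h | exact: h'].
Qed.

Theorem theorem3p15 (R : realType) (S : qhe) :
  q_ind_cpa R S <-> q_ind_cpa_mult R S.
Proof. by split; [apply: q_ind_cpa_cpa_mult | apply: q_ind_cpa_mult_cpa]. Qed.
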